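(* Let $\lambda\in\Lambda[a,b]$, $1\le p<2$, and let $f$ be a $(\lambda,p)$-decomposable function on $[a,b]$. If $D^+_{\lambda,p}(f)\ne\emptyset$, then in the class $\mathrm{dual}(\mathcal W_p)[a,b]\cap Q_\lambda[a,b]$ the Doléans exponential $\mathcal E_a(f)$ is the unique solution $F$, with $F(a)=1$, of the augmented forward linear Left $\lambda$-integral equation $d^{\to}_\lambda F=F\,d^{\to}_\lambda f$ on $[a,b]$.
   Context: Fix real $a<b$. A function $f:[a,b]\to\mathbb R$ is regulated if the finite limits $f(t-)$, $t\in(a,b]$, and $f(s+)$, $s\in[a,b)$, exist; $\Delta^-f(t)=f(t)-f(t-)$ and $\Delta^+f(s)=f(s+)-f(s)$. $\Lambda[a,b]$ is the set of sequences $\lambda=\{\lambda_m:m\ge1\}$ of partitions (finite sets $a=t_0<\dots<t_n=b$) of $[a,b]$ with $\lambda_m\subset\lambda_{m+1}$ and $\cup\lambda:=\bigcup_m\lambda_m$ dense in $[a,b]$. For $a\le s<t\le b$ let $\lambda_m|_{[s,t]}=\{s,t\}\cup(\lambda_m\cap(s,t))=\{s=x_0<\dots<x_n=t\}$. Sums over the points of an interval are unconditional (equivalently, absolutely convergent). Quadratic $\lambda$-covariation: for regulated $f_1,f_2$, the pair $(f_1,f_2)$ has the quadratic $\lambda$-covariation on $[a,b]$ if there is a regulated $B$ with $B(a)=0$ and, for all $a\le s<t\le b$, $B(t)-B(s)=\lim_m\sum_i[f_1(x_i)-f_1(x_{i-1})][f_2(x_i)-f_2(x_{i-1})]$ (sum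 over $\lambda_m|_{[s,t]}$), $\Delta^-B(t)=\Delta^-f_1(t)\Delta^-f_2(t)$, $\Delta^+B(s)=\Delta^+f_1(s)\Delta^+f_2(s)$; then $[f_1,f_2]_\lambda:=B$. $f$ has the quadratic $\lambda$-variation ($f\in Q_\lambda[a,b]$) if $(f,f)$ has the quadratic $\lambda$-covariation; $[f]_\lambda:=[f,f]_\lambda$ and $[f]^c_\lambda(t)=[f]_\lambda(t)-\sum_{(a,t]}(\Delta^-f)^2-\sum_{[a,t)}(\Delta^+f)^2$. The $2$-vector function $(f_1,f_2)$ has the quadratic $\lambda$-variation if $f_1,f_2\in Q_\lambda[a,b]$ and $(f_1,f_2)$ has the quadratic $\lambda$-covariation. For $0<p<\infty$, $v_p(f;[a,b])=\sup\sum_i|f(t_i)-f(t_{i-1})|^p$ over all partitions of $[a,b]$, and $\mathcal W_p[a,b]=\{f:v_p(f;[a,b])<\infty\}$. $\mathrm{dual}(\mathcal W_1)[a,b]$ is the set of all regulated functions; for $1<p<\infty$, $\mathrm{dual}(\mathcal W_p)[a,b]=\bigcup\{\mathcal W_q[a,b]:\tfrac1p+\tfrac1q>1\}$. A regulated $f$ is $(\lambda,p)$-decomposable if there is a pair $(g,h)$ of regulated functions with $g\in Q_\lambda[a,b]\cap\mathrm{dual}(\mathcal W_p)[a,b]$, $h\in\mathcal W_p[a,b]$, $g(a)=h(a)=0$ and $f\equiv C+g+h$ for some constant $C$; $D_{\lambda,p}(f)$ is the set of all such pairs, and $D^+_{\lambda,p}(f)$ is the set of $(g,h)\in D_{\lambda,p}(f)$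 with $\{t\in(a,b):\Delta^+g(t)\ne0\}\cup\{t\in(a,b):\Delta^+h(t)\ne0\}\subset\cup\lambda$. If $D^+_{\lambda,p}(f)\neq\emptyset$ then $f\in Q_\lambda[a,b]$. Vector Left Cauchy $\lambda$-integral: for regulated $F_1,F_2,f_1,f_2$, $(LC)\int\langle(F_1,F_2),d_\lambda(f_1,f_2)\rangle$ is defined on $[a,b]$ if there is a regulated $\Phi$ with $\Phi(a)=0$ and, for all $a\le s<t\le b$, $\Phi(t)-\Phi(s)=\lim_m\sum_i\sum_{k=1}^2F_k(x_{i-1})[f_k(x_i)-f_k(x_{i-1})]$ (sum over $\lambda_m|_{[s,t]}$), $\Delta^-\Phi(t)=\sum_kF_k(t-)\Delta^-f_k(t)$, $\Delta^+\Phi(s)=\sum_kF_k(s)\Delta^+f_k(s)$; its value over $[s,t]$ is $\Phi(t)-\Phi(s)$. Left Young integral: for regulated $G,h$ and $u<v$, $(LY)\int_u^vG\,dh=(RRS)\int_u^vG_-^{(u)}\,dh_+^{(v)}+G(u)\Delta^+h(u)+\sum_{(u,v)}\Delta^-G\Delta^+h$ provided the integral exists and the sum converges unconditionally, where $(RRS)$ is the refinement Riemann–Stieltjes integral (limit of Riemann–Stieltjes sums directed by refinement of partitions), $G_-^{(u)}(x)=G(x-)$ on $(u,v]$, $G_-^{(u)}(u)=G(u)$, $h_+^{(v)}(x)=h(x+)$ on $[u,v)$, $h_+^{(v)}(v)=h(v)$; it is $0$ if $u=v$. Augmented equation: $F\in\mathrm{dual}(\mathcal W_p)[a,b]\cap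 Q_\lambda[a,b]$ is a solution of $d^{\to}_\lambda F=F\,d^{\to}_\lambda f$ on $[a,b]$ if: (i) for every $(g,h)\in D^+_{\lambda,p}(f)$ and every $\psi\in\mathrm{dual}(\mathcal W_p)[a,b]$, $(LC)\int\langle(\psi,-\psi F),d_\lambda(F,g)\rangle$ is defined on $[a,b]$ and $(LC)\int_a^y\langle(\psi,-\psi F),d_\lambda(F,g)\rangle=(LY)\int_a^y\psi F\,dh$ for $a\le y\le b$; and (ii) the $2$-vector function $(F,f)$ has the quadratic $\lambda$-variation and, for $a\le y\le b$, $[F]_\lambda(y)=(LY)\int_a^yF^2\,d[f]_\lambda$ and $[F,f]_\lambda(y)=(LY)\int_a^yF\,d[f]_\lambda$. (Together with $F(a)=1$ this contains the equation $F(y)=1+(L)\int_a^yF\,d_\lambda f$, where $(L)\int F\,d_\lambda f=(LC)\int F\,d_\lambda g+(LY)\int F\,dh$.) Doléans exponential: $\mathcal E_a(f;a)=1$ and, for $x\in(a,b]$, $$\mathcal E_a(f;x)=\exp\{f(x)-f(a)-\tfrac12[f]^c_\lambda(x)\}\prod_{t\in(a,x]}(1+\Delta^-f(t))e^{-\Delta^-f(t)}\prod_{t\in[a,x)}(1+\Delta^+f(t))e^{-\Delta^+f(t)},$$ with absolutely convergent products. *)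

(* Defs.v *)
(* A function on [a, b] is represented by a total function
   R -> R; every notion below only depends on its values on [a, b], and
   functions on [a, b] are compared pointwise on `[a, b]. *)
From HB Require Import structures.
From mathcomp Require Import all_boot all_order all_algebra finmap.
From mathcomp Require Import all_classical all_reals all_analysis.
From mathcomp.analysis.showcase Require summability.

Set Implicit Arguments.
Unset Strict Implicit.
Unset Printing Implicit Defensive.

Import Order.TTheory GRing.Theory Num.Theory.
Import numFieldNormedType.Exports.

Local Open Scope classical_set_scope.
Local Open Scope ring_scope.

Definition left_lim {R : realType} (f : R -> R) (t : R) : R :=
  lim (f x @[x --> t^'-]).

Definition right_lim {R : realType} (f : R -> R) (s : R) : R :=
  lim (f x @[x --> s^'+]).

Definition left_jump {R : realType} (f : R -> R) (t : R) : R :=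
  f t - left_lim f t.

Definition right_jump {R : realType} (f : R -> R) (s : R) : R :=
  right_lim f s - f s.

Definition regulated {R : realType} (a b : R) (f : R -> R) : Prop :=
  (forall t, a < t <= b -> cvg (f x @[x --> t^'-])) /\
  (forall s, a <= s < b -> cvg (f x @[x --> s^'+])).

(* Limits over the finite subsets of R directed by inclusion. *)
Definition uncond_sum {R : realType} (D : set R) (u : R -> R) : R :=
  lim ((\sum_(t <- A | t \in D) u t) @[A --> @summability.totally R]).

Definition uncond_prod {R : realType} (D : set R) (u : R -> R) : R :=
  lim ((\prod_(t <- A | t \in D) u t) @[A --> @summability.totally R]).

Definition abs_summable {R : realType} (D : set R) (u : R -> R) : Prop :=
  summable D (EFin \o u).

Definition abs_multipliable {R : realType} (D : set R) (u : R -> R) : Prop :=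
  abs_summable D (fun t => u t - 1).

(* A partition u = x_0 < ... < x_n = v is represented, as in [itv_partition],
   by the sequence of the points x_1, ..., x_n; sequences of partitions are
   indexed from 0. *)
Definition partition_sum {R : realType} (phi : R -> R -> R) (u : R) (s : seq R)
    : R :=
  \sum_(0 <= i < size s) phi (nth u (u :: s) i) (nth u (u :: s) i.+1).

Definition in_Lambda {R : realType} (a b : R) (lambda : nat -> seq R) : Prop :=
  [/\ forall m, itv_partition a b (lambda m),
      forall m, {subset a :: lambda m <= a :: lambda m.+1} &
      `[a, b]%classic `<=` closure (\bigcup_m [set` a :: lambda m])].

Definition partition_restr {R : realType} (s t : R) (l : seq R) : seq R :=
  rcons [seq x <- l | s < x < t] t.

Definition is_qcov {R : realType} (a b : R) (lambda : nat -> seq R)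
    (f1 f2 B : R -> R) : Prop :=
  [/\ regulated a b f1, regulated a b f2, regulated a b B, B a = 0 &
      forall s t, a <= s -> s < t -> t <= b ->
      [/\ partition_sum (fun x y => (f1 y - f1 x) * (f2 y - f2 x)) s
            (partition_restr s t (lambda m)) @[m --> \oo] --> B t - B s,
          left_jump B t = left_jump f1 t * left_jump f2 t &
          right_jump B s = right_jump f1 s * right_jump f2 s]].

Definition has_qcov {R : realType} (a b : R) (lambda : nat -> seq R)
    (f1 f2 : R -> R) : Prop :=
  exists B, is_qcov a b lambda f1 f2 B.

Definition qcov {R : realType} (a b : R) (lambda : nat -> seq R)
    (f1 f2 : R -> R) : R -> R :=
  [get B : R -> R | is_qcov a b lambda f1 f2 B].

Definition in_Q {R : realType} (a b : R) (lambda : nat -> seq R)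
    (f : R -> R) : Prop :=
  has_qcov a b lambda f f.

Definition qvar {R : realType} (a b : R) (lambda : nat -> seq R)
    (f : R -> R) : R -> R :=
  qcov a b lambda f f.

Definition qvar_cont {R : realType} (a b : R) (lambda : nat -> seq R)
    (f : R -> R) (t : R) : R :=
  qvar a b lambda f t
  - uncond_sum `]a, t]%classic (fun x => left_jump f x ^+ 2)
  - uncond_sum `[a, t[%classic (fun x => right_jump f x ^+ 2).

Definition has_vector_qvar {R : realType} (a b : R) (lambda : nat -> seq R)
    (f1 f2 : R -> R) : Prop :=
  [/\ in_Q a b lambda f1, in_Q a b lambda f2 & has_qcov a b lambda f1 f2].

Definition pvar {R : realType} (a b p : R) (f : R -> R) : \bar R :=
  ereal_sup [set (partition_sum (fun x y => `|f y - f x| `^ p) a s)%:E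
            | s in [set s | itv_partition a b s]].

Definition in_W {R : realType} (a b p : R) (f : R -> R) : Prop :=
  (pvar a b p f < +oo)%E.

Definition in_dualW {R : realType} (a b p : R) (f : R -> R) : Prop :=
  (p = 1 /\ regulated a b f) \/
  (1 < p /\ exists q, [/\ 0 < q, 1 < p^-1 + q^-1 & in_W a b q f]).

Definition in_D {R : realType} (a b : R) (lambda : nat -> seq R) (p : R)
    (f g h : R -> R) : Prop :=
  [/\ regulated a b g /\ regulated a b h,
      in_Q a b lambda g /\ in_dualW a b p g,
      in_W a b p h,
      g a = 0 /\ h a = 0 &
      exists C, forall x, a <= x <= b -> f x = C + g x + h x].

Definition decomposable {R : realType} (a b : R) (lambda : nat -> seq R)
    (p : R) (f : R -> R) : Prop :=
  regulated a b f /\ exists g h, in_D a b lambda p f g h.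

Definition in_Dplus {R : realType} (a b : R) (lambda : nat -> seq R) (p : R)
    (f g h : R -> R) : Prop :=
  in_D a b lambda p f g h /\
  [set t | a < t < b /\ right_jump g t != 0]
    `|` [set t | a < t < b /\ right_jump h t != 0]
  `<=` \bigcup_m [set` a :: lambda m].

(* [is_LC F1 F2 f1 f2 Phi]: the vector Left Cauchy integral of (F1, F2) with
   respect to (f1, f2) is defined on [a, b] and Phi is its indefinite integral,
   so that its value over [s, t] is Phi t - Phi s. *)
Definition is_LC {R : realType} (a b : R) (lambda : nat -> seq R)
    (F1 F2 f1 f2 Phi : R -> R) : Prop :=
  [/\ regulated a b F1 /\ regulated a b F2,
      regulated a b f1 /\ regulated a b f2,
      regulated a b Phi, Phi a = 0 &
      forall s t, a <= s -> s < t -> t <= b ->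
      [/\ partition_sum
            (fun x y => F1 x * (f1 y - f1 x) + F2 x * (f2 y - f2 x)) s
            (partition_restr s t (lambda m)) @[m --> \oo] --> Phi t - Phi s,
          left_jump Phi t = left_lim F1 t * left_jump f1 t
                            + left_lim F2 t * left_jump f2 t &
          right_jump Phi s = F1 s * right_jump f1 s + F2 s * right_jump f2 s]].

Definition is_RRS {R : realType} (G h : R -> R) (u v I : R) : Prop :=
  forall e : R, 0 < e -> exists2 tau, itv_partition u v tau &
  forall kappa (xi : nat -> R),
    itv_partition u v kappa -> {subset tau <= kappa} ->
    (forall i, (i < size kappa)%N ->
       nth u (u :: kappa) i <= xi i <= nth u (u :: kappa) i.+1) ->
  `|\sum_(0 <= i < size kappa)
      G (xi i) * (h (nth u (u :: kappa) i.+1) - h (nth u (u :: kappa) i)) - I|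
    < e.

Definition left_reg {R : realType} (u : R) (G : R -> R) (x : R) : R :=
  if x == u then G u else left_lim G x.

Definition right_reg {R : realType} (v : R) (h : R -> R) (x : R) : R :=
  if x == v then h v else right_lim h x.

(* [is_LY G h u v I]: the Left Young integral of G with respect to h over
   [u, v] exists and equals I. *)
Definition is_LY {R : realType} (G h : R -> R) (u v I : R) : Prop :=
  (u = v /\ I = 0) \/
  (u < v /\ exists J,
    [/\ regulated u v G /\ regulated u v h,
        is_RRS (left_reg u G) (right_reg v h) u v J,
        abs_summable `]u, v[%classic (fun x => left_jump G x * right_jump h x) &
        I = J + G u * right_jump h u
            + uncond_sum `]u, v[%classic
                (fun x => left_jump G x * right_jump h x)]).

Definition forward_solution {R : realType} (a b : R) (lambda : nat -> seq R)
    (p : R) (f F : R -> R) : Prop :=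
  [/\ in_dualW a b p F /\ in_Q a b lambda F,
      forall g h, in_Dplus a b lambda p f g h ->
        forall psi, in_dualW a b p psi ->
        exists2 Phi,
          is_LC a b lambda psi (fun x => - (psi x * F x)) F g Phi &
          forall y, a <= y <= b ->
            is_LY (fun x => psi x * F x) h a y (Phi y - Phi a),
      has_vector_qvar a b lambda F f &
      forall y, a <= y <= b ->
        is_LY (fun x => F x ^+ 2) (qvar a b lambda f) a y (qvar a b lambda F y)
        /\ is_LY F (qvar a b lambda f) a y (qcov a b lambda F f y)].

Definition doleans {R : realType} (a b : R) (lambda : nat -> seq R)
    (f : R -> R) (x : R) : R :=
  if x == a then 1 else
  expR (f x - f a - 2^-1 * qvar_cont a b lambda f x)
  * uncond_prod `]a, x]%classic
      (fun t => (1 + left_jump f t) * expR (- left_jump f t))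
  * uncond_prod `[a, x[%classic
      (fun t => (1 + right_jump f t) * expR (- right_jump f t)).

(* The bracket, the sums and the products in the formula of [doleans] are
   genuine, not the default values of the total operators used there. *)
Definition doleans_defined {R : realType} (a b : R) (lambda : nat -> seq R)
    (f : R -> R) : Prop :=
  in_Q a b lambda f /\
  forall x, a < x <= b ->
  [/\ abs_summable `]a, x]%classic (fun t => left_jump f t ^+ 2),
      abs_summable `[a, x[%classic (fun t => right_jump f t ^+ 2),
      abs_multipliable `]a, x]%classic
        (fun t => (1 + left_jump f t) * expR (- left_jump f t)) &
      abs_multipliable `[a, x[%classic
        (fun t => (1 + right_jump f t) * expR (- right_jump f t))].

(* Main.v *)
Require Import Defs.
From HB Require Import structures.
From mathcomp Require Import all_boot all_order all_algebra finmap.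
From mathcomp Require Import all_classical all_reals all_analysis.
From mathcomp.analysis.showcase Require summability.
From mathcomp Require Import ring lra.

Set Implicit Arguments.
Unset Strict Implicit.
Unset Printing Implicit Defensive.

Import Order.TTheory GRing.Theory Num.Theory.
Import numFieldNormedType.Exports.

Local Open Scope classical_set_scope.
Local Open Scope ring_scope.

(** Write [B] for the bracket of [f] and, for [x <= y], let [evo x y] be the
    Doléans formula started at [x] with value 1, so that the exponential is
    [E y = evo a y]. The formula is multiplicative over adjacent intervals
    ([evo_mul]), hence [E y = E x * evo x y]. A function [F] is to be compared
    with [E] through the interval functions [F y - F x - F x * (f y - f x)]
    and [F y - F x * evo x y]; everything reduces to sums of such functions of
    partition intervals being negligible.

    The sums are taken along a refining sequence of partitions with dense
    union. By [lsum_split] such a sum over [[s, t]] splits at an inner point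
    [z] when [z] is a partition point, and otherwise up to the one interval
    that contains [z]. Together with the compactness argument [cousin], this
    reduces limits of sums to estimates on short intervals
    ([lsum_null], [lsum_sew]). Absence of right jumps outside the partition
    points makes the exceptional interval harmless; this is the only use of
    the jump condition in the definition of the decompositions.

    The analytic core is an expansion of one step:
    [evo x y - 1 - (f y - f x)] equals half of
    [(f y - f x) ^+ 2 - (B y - B x)] up to a small multiple of
    [(f y - f x) ^+ 2 + (B y - B x)], locally uniformly ([evo_err_local]): in
    the exponent the continuous part of [B] is subtracted, and each factor
    (1 + j) exp (- j) of the products contributes - j ^ 2 / 2. The sums of the
    first term tend to 0 by the definition of [B], even with a regulated
    weight ([quad_err_weighted]); the remainder is negligible in absolute
    value. Hence weighted sums of [evo_err] tend to 0 ([evo_err_weighted]).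

    Existence. The increments [E y - E x = E x * (f y - f x + evo_err x y)]
    are inserted in the sums that define the vector integral and the brackets.
    What remains are left sums against [h] or [B]. These pairs are Young
    pairs, so by the Love-Young inequality ([love_young]) the left sums
    converge, and by [young_integral] their limits are Left Young integrals.

    Uniqueness. Let [F] be a solution and
    [defect x y = F y - F x * evo x y]. The integral equation gives null sums
    of [psi x * defect x y] for each weight [psi] of the dual class. The two
    bracket equations give null sums of the squares of [defect], because
    (dF - F df) ^ 2 = (dF) ^ 2 - F ^ 2 (df) ^ 2 - 2 F (dF - F df) df. On an
    interval [[s, t]] where [evo s x] stays close to 1, the choice
    [psi x = 1 / evo s x] makes the sum of [psi y * defect x y] telescope to
    [psi t * F t - psi s * F s]. It differs from the sum of
    [psi x * defect x y] by the sum of [(psi y - psi x) * defect x y], which is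
    null by the Cauchy-Schwarz inequality. So [F t = F s * evo s t] on short
    intervals ([short_evolution]). The factor [evo] may vanish at a jump of
    [f]; these points are crossed by one-sided limits, and [cousin] concludes
    ([evolution]). *)

(** Bounded search for a chain of hypotheses that joins the two sides of an
    inequality. *)
Ltac le_search n :=
  first
  [ assumption | exact: lexx
  | match goal with H : is_true (@Order.lt _ _ ?x ?y) |- is_true (@Order.le _ _ ?x ?y) => exact: (ltW H) end
  | lazymatch n with
    | S ?m =>
      match goal with
      | H : is_true (@Order.le _ _ ?x _) |- is_true (@Order.le _ _ ?x _) =>
        apply: (le_trans H); le_search m
      | H : is_true (@Order.lt _ _ ?x _) |- is_true (@Order.le _ _ ?x _) =>
        apply: (le_trans (ltW H)); le_search m
      | H : is_true (@Order.le _ _ ?x _) |- is_true (@Order.lt _ _ ?x _) =>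
        apply: (le_lt_trans H); le_search m
      | H : is_true (@Order.lt _ _ ?x _) |- is_true (@Order.lt _ _ ?x _) =>
        apply: (lt_le_trans H); le_search m
      end
    end ].
Ltac order_goal :=
  lazymatch goal with
  | |- is_true (_ && _) => apply/andP; split; order_goal
  | |- is_true (~~ (_ == _)) => by rewrite gt_eqF
  | |- is_true (@Order.le _ _ _ _) => le_search (S (S (S (S O))))
  | |- is_true (@Order.lt _ _ _ _) =>
      first [le_search (S (S (S (S O)))) | by apply: divr_gt0]
  end.
Ltac order_chain :=
  repeat match goal with
  | H : is_true (_ && _) |- _ => case/andP: (H) => ? ?; clear H
  end;
  order_goal.
(** Most side conditions order points of an interval; a chain of hypotheses is
    found much faster than a certificate for linear arithmetic. *)
Ltac olra := first [order_chain | lra].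

Definition hidden (P : Prop) := P.
(** Linear arithmetic from the premises of the goal alone. The cost of [lra]
    is governed by the inequalities in the context, so they are wrapped in
    [hidden]. *)
Ltac glra :=
  repeat match goal with H : is_true ?T |- _ => change (hidden (is_true T)) in H end;
  lra.

(** * Sums over partitions *)

Section Sums.
Variable R : realType.
Implicit Types (K : R -> R -> R) (x y s t : R) (l : seq R).

(** The recursive form of [partition_sum], for inductions along a
    partition. *)
Fixpoint psum K x l : R := if l is y :: l' then K x y + psum K y l' else 0.

Lemma partition_sumE K x l : partition_sum K x l = psum K x l.
Proof.
rewrite /partition_sum; elim: l x => [|y l IH] x /=; first by rewrite big_nil.
rewrite big_nat_recl//= -IH; congr (_ + _).
by apply: eq_big_nat => i il; rewrite /= !(set_nth_default y) ?ltnS// ltnW.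
Qed.

Lemma psum_cat K x l l' : psum K x (l ++ l') = psum K x l + psum K (last x l) l'.
Proof. by elim: l x => [|y l IH] x /=; rewrite ?add0r// IH addrA. Qed.

Lemma psum_rcons K x l y : psum K x (rcons l y) = psum K x l + K (last x l) y.
Proof. by rewrite -cats1 psum_cat /= addr0. Qed.

Lemma psumD K K' x l :
  psum (fun x y => K x y + K' x y) x l = psum K x l + psum K' x l.
Proof. by elim: l x => [|y l IH] x /=; rewrite ?addr0// IH addrACA. Qed.

Lemma psumZ c K x l : psum (fun x y => c * K x y) x l = c * psum K x l.
Proof. by elim: l x => [|y l IH] x /=; rewrite ?mulr0// IH mulrDr. Qed.

Lemma psumB K K' x l :
  psum (fun x y => K x y - K' x y) x l = psum K x l - psum K' x l.
Proof. by elim: l x => [|y l IH] x /=; rewrite ?subr0// IH opprD addrACA. Qed.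

Lemma psum_telescope (f : R -> R) x l :
  psum (fun x y => f y - f x) x l = f (last x l) - f x.
Proof. elim: l x => [|y l IH] x /=; rewrite ?subrr// IH; ring. Qed.

Lemma psum0 x l : psum (fun _ _ => 0) x l = 0.
Proof. by elim: l x => [|y l IH] x //=; rewrite IH addr0. Qed.

Lemma path_le_last x l : path <%R x l -> x <= last x l.
Proof.
elim: l x => [|y l IH] x //= /andP[xy yl].
by rewrite (le_trans (ltW xy))// IH.
Qed.

Lemma ler_psum K K' x l : path <%R x l ->
  (forall u v, x <= u -> u < v -> v <= last x l -> K u v <= K' u v) ->
  psum K x l <= psum K' x l.
Proof.
elim: l x => [|y l IH] x //= /andP[xy yl] KK'.
rewrite lerD//; first by apply: KK' => //; exact: path_le_last.
by apply: IH => // u v yu; apply: KK'; rewrite (le_trans (ltW xy)).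
Qed.

Lemma eq_psum K K' x l : path <%R x l ->
  (forall u v, x <= u -> u < v -> v <= last x l -> K u v = K' u v) ->
  psum K x l = psum K' x l.
Proof.
move=> xl KK'; apply/eqP; rewrite eq_le !ler_psum// => u v xu uv vl;
by rewrite KK'.
Qed.

Lemma ler_norm_psum K x l : `|psum K x l| <= psum (fun x y => `|K x y|) x l.
Proof.
elim: l x => [|y l IH] x /=; rewrite ?normr0//.
by rewrite (le_trans (ler_normD _ _))// lerD.
Qed.

Lemma path_sorted_lt x l y : path <%R x l -> y \in l -> x < y.
Proof. by rewrite lt_path_sortedE => /andP[/allP h _] /h. Qed.

Lemma path_le_mem x l y : path <%R x l -> y \in x :: l -> x <= y <= last x l.
Proof.
elim: l x => [|z l IH] x /=; first by rewrite inE => _ /eqP ->; rewrite lexx.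
move=> /andP[xz zl]; rewrite inE => /orP[/eqP ->|yl].
  by rewrite lexx (le_trans (ltW xz))// path_le_last.
by have /andP[zy ->] := IH _ zl yl; rewrite (le_trans (ltW xz)).
Qed.

End Sums.

(** * Creeping along an interval *)

Section Cousin.
Variables (R : realType) (a b : R).
Implicit Types (P Q : R -> R -> Prop) (f : R -> R).

(** The two sides of [z] are treated separately, so that [P] may fail for
    intervals with [z] in their interior: only one-sided limits at [z] are
    available. *)
Definition locally_good P := forall z, a <= z <= b -> exists2 d, 0 < d &
  (forall s t, a <= s -> z - d < s -> s < t -> t <= z -> P s t) /\
  (forall s t, z <= s -> s < t -> t < z + d -> t <= b -> P s t).

Lemma locally_goodI P Q : locally_good P -> locally_good Q ->
  locally_good (fun s t => P s t /\ Q s t).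
Proof.
move=> HP HQ z zab; have [d d0 [Pl Pr]] := HP z zab.
have [e e0 [Ql Qr]] := HQ z zab.
have md : Num.min d e <= d by rewrite ge_min lexx.
have me : Num.min d e <= e by rewrite ge_min lexx orbT.
exists (Num.min d e); first by rewrite lt_min d0.
split=> s t h1 h2 h3 h4; split.
- by apply: Pl => //; olra.
- by apply: Ql => //; olra.
- by apply: Pr => //; olra.
- by apply: Qr => //; olra.
Qed.

Lemma locally_good_sub P Q : locally_good P ->
  (forall s t, a <= s -> s < t -> t <= b -> P s t -> Q s t) -> locally_good Q.
Proof.
move=> HP PQ z zab; have [d d0 [Pl Pr]] := HP z zab; exists d => //.
move: zab => /andP[az zb]; split=> s t h1 h2 h3 h4; apply: PQ => //; try olra.
- exact: Pl.
- exact: Pr.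
Qed.

(** The supremum of the points that [Q] reaches from [s] is itself reached,
    since intervals ending there are good, and it is passed unless it is [t],
    since intervals starting there are good. *)
Lemma cousin Q :
  (forall s z t, a <= s -> s < z -> z < t -> t <= b -> Q s z -> Q z t -> Q s t) ->
  locally_good Q -> forall s t, a <= s -> s < t -> t <= b -> Q s t.
Proof.
move=> Qadd HQ s t as_ st tb.
(* The points reached from [s]. *)
pose A := [set x | s < x <= t /\ Q s x].
have [d d0 [_ Qr]] := HQ s ltac:(olra).
have A0 : A !=set0.
  exists (Num.min t (s + d / 2)); rewrite /A/=.
  have h : s < Num.min t (s + d / 2) <= t.
    by rewrite lt_min ge_min lexx st /= andbT; olra.
  split => //; apply: Qr => //; first by case/andP: h.
    by rewrite gt_min; apply/orP; right; olra.
  by case/andP: h; olra.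
have ubA : ubound A t by move=> x [/andP[]].
have hsA : has_sup A by split => //; exists t.
set z := sup A.
have zt : z <= t by apply: ge_sup.
have sz : s < z.
  case: A0 => x Ax; apply: (@lt_le_trans _ _ x); first by case: Ax => /andP[].
  exact: ub_le_sup hsA.2 _ Ax.
have [e e0 [Ql' Qr']] := HQ z ltac:(olra).
have Qsz : Q s z.
  have [x Ax zx] := sup_adherent e0 hsA.
  have xz : x <= z by exact: ub_le_sup hsA.2 _ Ax.
  case: (Ax) => /andP[sx xt] Qsx.
  move: xz; rewrite le_eqVlt => /orP[/eqP <- //|xz].
  by apply: (Qadd s x z) => //; [olra|apply: Ql' => //; olra].
move: zt; rewrite le_eqVlt => /orP[/eqP <- //|zt].
pose u := Num.min t (z + e / 2).
have zu : z < u by rewrite lt_min zt/=; olra.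
have ut : u <= t by rewrite ge_min lexx.
have uz : u < z + e by rewrite gt_min; apply/orP; right; olra.
have Au : A u.
  split; first by apply/andP; split => //; olra.
  by apply: (Qadd s z u) => //; [olra|apply: Qr' => //; olra].
by have := ub_le_sup hsA.2 Au; rewrite -/z; olra.
Qed.

Definition flat (e : R) f (s t : R) :=
  forall x y, s < x < t -> s < y < t -> `|f x - f y| <= e.

(** Being regulated, by [regulated_flat] and [flat_regulated]; in this form
    the property combines with other local conditions and passes to dominated
    functions. *)
Definition flat_reg f := forall e, 0 < e -> locally_good (flat e f).

End Cousin.

(** * Regulated functions *)

Section Regulated.
Variable R : realType.
Implicit Types (f g W : R -> R) (a b e d z l : R).

Lemma cvg_leftP f z l : f x @[x --> z^'-] --> l <->
  forall e, 0 < e -> exists2 d, 0 < d & forall x, z - d < x < z -> `|f x - l| <= e.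
Proof.
split=> [/cvgrPdist_le h e e0|h].
  have [d /= d0 hd] := h e e0; exists d => // x /andP[x1 x2].
  by rewrite distrC; apply: hd => //=; rewrite gtr0_norm; olra.
apply/cvgrPdist_le => e e0; have [d d0 hd] := h e e0.
exists d => // x /= xd xz; rewrite distrC; apply: hd; rewrite xz andbT.
by move: xd; rewrite gtr0_norm; olra.
Qed.

Lemma cvg_rightP f z l : f x @[x --> z^'+] --> l <->
  forall e, 0 < e -> exists2 d, 0 < d & forall x, z < x < z + d -> `|f x - l| <= e.
Proof.
split=> [/cvgrPdist_le h e e0|h].
  have [d /= d0 hd] := h e e0; exists d => // x /andP[x1 x2].
  by rewrite distrC; apply: hd => //=; rewrite ltr0_norm; olra.
apply/cvgrPdist_le => e e0; have [d d0 hd] := h e e0.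
exists d => // x /= xd xz; rewrite distrC; apply: hd; rewrite xz /=.
by move: xd; rewrite ltr0_norm; olra.
Qed.

Lemma left_limE f z l : f x @[x --> z^'-] --> l -> left_lim f z = l.
Proof. by move=> h; apply: cvg_lim. Qed.

Lemma right_limE f z l : f x @[x --> z^'+] --> l -> right_lim f z = l.
Proof. by move=> h; apply: cvg_lim. Qed.

Lemma regulated_flat a b f : regulated a b f -> flat_reg a b f.
Proof.
move=> [fl fr] e e0 z /andP[az zb].
have e2 : 0 < e / 2 by olra.
have [d1 d10 h1] : exists2 d, 0 < d & a < z -> forall x y, z - d < x < z ->
    z - d < y < z -> `|f x - f y| <= e.
  case: (ltP a z) => [az'|_]; last by exists 1.
  have /cvg_ex[l /cvg_leftP/(_ _ e2)[d d0 hd]] := fl z ltac:(olra).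
  exists d => // _ x y xz yz; have := hd x xz; have := hd y yz.
  by rewrite !ler_norml; olra.
have [d2 d20 h2] : exists2 d, 0 < d & z < b -> forall x y, z < x < z + d ->
    z < y < z + d -> `|f x - f y| <= e.
  case: (ltP z b) => [zb'|_]; last by exists 1.
  have /cvg_ex[l /cvg_rightP/(_ _ e2)[d d0 hd]] := fr z ltac:(olra).
  exists d => // _ x y xz yz; have := hd x xz; have := hd y yz.
  by rewrite !ler_norml; olra.
have md : Num.min d1 d2 <= d1 by rewrite ge_min lexx.
have me : Num.min d1 d2 <= d2 by rewrite ge_min lexx orbT.
exists (Num.min d1 d2); first by rewrite lt_min d10.
split=> s t ? ? ? ? x y ? ?.
- by apply: h1; olra.
- by apply: h2; olra.
Qed.

Lemma cvg_of_cauchy (T : Type) (F : set_system T) (FF : ProperFilter F)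
    (f : T -> R) :
  (forall e, 0 < e -> exists c, \forall y \near F, `|f y - c| <= e) ->
  cvg (f y @[y --> F]).
Proof.
move=> H; apply: cauchy_cvg; apply: cauchy_exP => e e0.
have [c hc] := H (e / 2) ltac:(olra); exists c.
rewrite -ball_normE.
apply: filterS hc => y h /=.
by rewrite distrC (le_lt_trans h)//; olra.
Qed.

Lemma flat_regulated a b f : flat_reg a b f -> regulated a b f.
Proof.
move=> H; split=> z /andP[az zb]; apply: cvg_of_cauchy => e e0.
- have [d d0 [hl _]] := H e e0 z ltac:(olra).
  pose s := Num.max a (z - d / 2).
  have sz : s < z by rewrite gt_max az/=; olra.
  have sa : a <= s by rewrite le_max lexx.
  have sd : z - d < s by rewrite lt_max; apply/orP; right; olra.
  exists (f ((s + z) / 2)); near=> x.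
  have sx : s < x by near: x; exact: nbhs_left_gt.
  have xz : x < z by near: x; exact: nbhs_left_lt.
  by apply: (hl s z) => //; olra.
- have [d d0 [_ hr]] := H e e0 z ltac:(olra).
  pose s := Num.min b (z + d / 2).
  have sz : z < s by rewrite lt_min zb/=; olra.
  have sa : s <= b by rewrite ge_min lexx.
  have sd : s < z + d by rewrite gt_min; apply/orP; right; olra.
  exists (f ((s + z) / 2)); near=> x.
  have sx : x < s by near: x; exact: nbhs_right_lt.
  have xz : z < x by near: x; exact: nbhs_right_gt.
  by apply: (hr z s) => //; olra.
Unshelve. all: by end_near. Qed.

(** This gives regularity of functions built from [f] and its bracket, such as
    the exponential, without computing one-sided limits. *)
Lemma flat_reg_dom a b C f g W : flat_reg a b g -> flat_reg a b W ->
  (forall x y, a <= x -> x < y -> y <= b ->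
     `|f y - f x| <= C * (`|g y - g x| + `|W y - W x|)) ->
  flat_reg a b f.
Proof.
move=> Hg HW H e e0; have C0 : 0 < `|C| + 1 by have := normr_ge0 C; olra.
have e1 : 0 < e / (2 * (`|C| + 1)) by apply: divr_gt0 => //; olra.
apply: locally_good_sub (locally_goodI (Hg _ e1) (HW _ e1)) _.
move=> s t as_ st tb [h1 h2].
have key x y : s < x < t -> s < y < t -> x < y -> `|f y - f x| <= e.
  move=> xs ys xy; apply: (le_trans (H x y _ xy _)); [olra|olra|].
  have B1 := h1 _ _ ys xs; have B2 := h2 _ _ ys xs.
  have -> : e = (`|C| + 1) * (e / (2 * (`|C| + 1)) + e / (2 * (`|C| + 1))).
    by field; olra.
  set X := _ + _.
  have X0 : 0 <= X by rewrite addr_ge0.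
  apply: (@le_trans _ _ ((`|C| + 1) * X)).
    by rewrite ler_wpM2r//; have := ler_norm C; olra.
  by apply: ler_wpM2l; [olra|exact: lerD].
move=> x y xs ys; case: (ltgtP x y) => [xy|xy|->].
- by rewrite distrC; apply: key.
- exact: key.
- by rewrite subrr normr0 ltW.
Qed.

Lemma flat_reg_bounded a b f : a < b -> flat_reg a b f ->
  exists2 M, 0 < M & forall x, a <= x <= b -> `|f x| <= M.
Proof.
move=> ab Hf.
suff [M h] : exists M, forall x, a <= x <= b -> `|f x| <= M.
  exists (`|M| + 1); first by have := normr_ge0 M; olra.
  by move=> x /h; have := ler_norm M; olra.
apply: (@cousin _ a b (fun s t => exists M, forall x, s <= x <= t -> `|f x| <= M))
  => //.
- move=> s z t _ _ _ _ [M HM] [N HN]; exists (Num.max M N) => x /andP[sx xt].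
  by rewrite le_max; case: (leP x z) => xz; [rewrite HM// sx|rewrite HN ?orbT// ltW].
- apply: locally_good_sub (Hf 1 ltr01) _ => s t as_ st tb h.
  exists (`|f s| + `|f t| + `|f ((s + t) / 2)| + 1) => x /andP[].
  have := normr_ge0 (f s); have := normr_ge0 (f t).
  have := normr_ge0 (f ((s + t) / 2)) => h1 h2 h3.
  rewrite le_eqVlt => /orP[/eqP <-|sx]; first olra.
  rewrite le_eqVlt => /orP[/eqP ->|xt]; first olra.
  have := h x ((s + t) / 2) ltac:(olra) ltac:(olra).
  have := ler_distD (f ((s + t) / 2)) (f x) 0; rewrite !subr0; olra.
Qed.

Definition nondec a b W := forall x y, a <= x -> x <= y -> y <= b -> W x <= W y.

(** Near [z] from the left a nondecreasing function is within [e] of its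
    supremum over the points smaller than [z]; similarly from the right. *)
Lemma nd_flat a b W : nondec a b W -> flat_reg a b W.
Proof.
move=> H e e0 z /andP[az zb].
have [d1 d10 h1] : exists2 d, 0 < d & forall x y, a <= x -> a <= y ->
    z - d < x < z -> z - d < y < z -> `|W x - W y| <= e.
  case: (ltP a z) => [az'|za]; last by exists 1 => // x y; olra.
  pose A := [set W x | x in [set x | a <= x < z]].
  have hA : has_sup A.
    split; first by exists (W a); exists a => //=; rewrite lexx.
    by exists (W z) => _ [x /= xz <-]; apply: H => //; olra.
  have [_ [x0 /= x0z <-] h0] := sup_adherent e0 hA.
  exists (z - x0) => [|x y ax ay xz yz]; first olra.
  have hx u : a <= u -> x0 < u < z -> sup A - e < W u <= sup A.
    move=> au uz; apply/andP; split.
      by apply: (lt_le_trans h0); apply: H; olra.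
    by apply: ub_le_sup hA.2 _ _; exists u => //=; olra.
  have := hx x ax ltac:(olra); have := hx y ay ltac:(olra).
  by rewrite ler_norml; olra.
have [d2 d20 h2] : exists2 d, 0 < d & forall x y, x <= b -> y <= b ->
    z < x < z + d -> z < y < z + d -> `|W x - W y| <= e.
  case: (ltP z b) => [zb'|bz]; last by exists 1 => // x y; olra.
  pose A := [set W x | x in [set x | z < x <= b]].
  have hA : has_inf A.
    split; first by exists (W b); exists b => //=; rewrite lexx andbT.
    by exists (W z) => _ [x /= xz <-]; apply: H => //; olra.
  have [_ [x0 /= x0z <-] h0] := inf_adherent e0 hA.
  exists (x0 - z) => [|x y ax ay xz yz]; first olra.
  have hx u : u <= b -> z < u < x0 -> inf A <= W u < inf A + e.
    move=> au uz; apply/andP; split; last first.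
      by apply: (le_lt_trans _ h0); apply: H; olra.
    by apply: ge_inf hA.2 _ _; exists u => //=; olra.
  have := hx x ax ltac:(olra); have := hx y ay ltac:(olra).
  by rewrite ler_norml; olra.
have md : Num.min d1 d2 <= d1 by rewrite ge_min lexx.
have me : Num.min d1 d2 <= d2 by rewrite ge_min lexx orbT.
exists (Num.min d1 d2); first by rewrite lt_min d10.
split=> s t ? ? ? ? x y ? ?.
- by apply: h1; olra.
- by apply: h2; olra.
Qed.

Lemma regulated_left a b f z : flat_reg a b f -> a < z <= b ->
  f x @[x --> z^'-] --> left_lim f z.
Proof. by move=> /flat_regulated[h _] /h. Qed.

Lemma regulated_right a b f z : flat_reg a b f -> a <= z < b ->
  f x @[x --> z^'+] --> right_lim f z.
Proof. by move=> /flat_regulated[_ h] /h. Qed.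

Lemma left_lim_le (F : R -> R) z c l L : c < z -> F x @[x --> z^'-] --> l ->
  (forall x, c < x < z -> F x <= L) -> l <= L.
Proof.
move=> cz Fl h; apply: (cvgr_to_le Fl).
near=> x; apply: h; apply/andP; split; near: x; [exact: nbhs_left_gt|].
exact: nbhs_left_lt.
Unshelve. all: by end_near. Qed.

Lemma right_lim_le (F : R -> R) z c l L : z < c -> F x @[x --> z^'+] --> l ->
  (forall x, z < x < c -> F x <= L) -> l <= L.
Proof.
move=> cz Fl h; apply: (cvgr_to_le Fl).
near=> x; apply: h; apply/andP; split; near: x; last exact: nbhs_right_lt.
exact: nbhs_right_gt.
Unshelve. all: by end_near. Qed.

Lemma left_lim_mul a b f g z : flat_reg a b f -> flat_reg a b g -> a < z <= b ->
  left_lim (fun x => f x * g x) z = left_lim f z * left_lim g z.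
Proof.
move=> fr gr zab; apply: left_limE.
exact: cvgM (regulated_left fr zab) (regulated_left gr zab).
Qed.

Lemma mul_increment_bound M N (u u' v v' : R) : `|u'| <= M -> `|v| <= N ->
  `|u' * v' - u * v| <= (M + N) * (`|u' - u| + `|v' - v|).
Proof.
move=> uM vN; have M0 : 0 <= M by exact: le_trans uM.
have N0 : 0 <= N by exact: le_trans vN.
have -> : u' * v' - u * v = u' * (v' - v) + (u' - u) * v by ring.
apply: (le_trans (ler_normD _ _)); rewrite !normrM.
have h1 : `|u'| * `|v' - v| <= M * `|v' - v| by rewrite ler_wpM2r.
have h2 : `|u' - u| * `|v| <= `|u' - u| * N by rewrite ler_wpM2l.
have := mulr_ge0 M0 (normr_ge0 (u' - u)); have := mulr_ge0 N0 (normr_ge0 (v' - v)).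
lra.
Qed.

Lemma flat_mul a b f g : a < b -> flat_reg a b f -> flat_reg a b g ->
  flat_reg a b (fun x => f x * g x).
Proof.
move=> ab fr gr; have [M M0 fM] := flat_reg_bounded ab fr.
have [N N0 gN] := flat_reg_bounded ab gr.
apply: (flat_reg_dom (C := M + N) fr gr) => x y ax xy yb.
by apply: mul_increment_bound; [apply: fM; olra|apply: gN; olra].
Qed.

End Regulated.

(** * A refining sequence of partitions *)

Section Refining.
Variables (R : realType) (a b : R) (lambda : nat -> seq R).
Hypothesis ab : a < b.
Hypothesis lamP : in_Lambda a b lambda.
Implicit Types (K : R -> R -> R) (s t z : R).

Definition ulam : set R := \bigcup_m [set` a :: lambda m].

Definition lsum K s t m := psum K s (partition_restr s t (lambda m)).

Lemma lam_path m : path <%R a (lambda m).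
Proof. by case: lamP => /(_ m)[]. Qed.

Lemma lam_sorted m : sorted <%R (lambda m).
Proof. exact: path_sorted (lam_path m). Qed.

Lemma lam_sub m n : (m <= n)%N -> {subset a :: lambda m <= a :: lambda n}.
Proof.
move=> /subnK <-; elim: (n - m)%N => [|k IH] x xm; first by rewrite add0n.
by case: lamP => _ sub _; rewrite addSn; apply: sub; apply: IH.
Qed.

Lemma lam_dense s t : a <= s -> s < t -> t <= b ->
  \forall m \near \oo, exists2 x, x \in lambda m & s < x < t.
Proof.
move=> as_ st tb; case: lamP => _ _ dense.
have := dense ((s + t) / 2) ltac:(rewrite /= in_itv /=; olra).
move=> /(_ (ball ((s + t) / 2) ((t - s) / 2))) [].
  by apply: nbhsx_ballx; olra.
move=> x [[m0 _ /= xm] xb]; exists m0 => // m /= m0m.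
have sx : s < x < t.
  by move: xb; rewrite -ball_normE /= ltr_norml; olra.
exists x => //; have := lam_sub m0m xm; rewrite inE => /orP[/eqP xa|//]; olra.
Qed.

Lemma restr_path s t m : s < t -> path <%R s (partition_restr s t (lambda m)).
Proof.
move=> st; rewrite rcons_path lt_path_sortedE; apply/andP; split.
  apply/andP; split; last exact: (sorted_filter lt_trans) (lam_sorted m).
  by apply/allP => x; rewrite mem_filter => /andP[/andP[]].
have := mem_last s [seq x <- lambda m | s < x < t].
by rewrite inE => /orP[/eqP ->//|]; rewrite mem_filter => /andP[/andP[]].
Qed.

(** By density of the union, late partitions have points close to both ends of
    [[s, t]]. *)
Lemma restr_ends s t c c' : a <= s -> s < t -> t <= b -> s < c -> c' < t ->
  \forall m \near \oo, exists x1 l,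
   [/\ partition_restr s t (lambda m) = x1 :: rcons l t,
      s < x1 < c, c' < last x1 l < t & path <%R x1 l].
Proof.
move=> as_ st tb sc ct.
have h1 := @lam_dense s (Num.min c t) as_ ltac:(by rewrite lt_min sc).
have h1' := h1 ltac:(by rewrite ge_min tb orbT).
have h2 := @lam_dense (Num.max c' s) t ltac:(by rewrite le_max as_ orbT).
have h2' := h2 ltac:(by rewrite gt_max ct) tb.
near=> m.
have [x xm] : exists2 x, x \in lambda m & s < x < Num.min c t by near: m.
rewrite lt_min => /andP[sx /andP[xc xt]].
have [y ym] : exists2 x, x \in lambda m & Num.max c' s < x < t by near: m.
rewrite gt_max => /andP[/andP[cy sy] yt].
have := restr_path m st; rewrite /partition_restr.
have xl : x \in [seq x <- lambda m | s < x < t] by rewrite mem_filter sx xt.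
have yl : y \in [seq x <- lambda m | s < x < t] by rewrite mem_filter sy yt.
case: [seq x <- lambda m | s < x < t] xl yl => [//|x1 l] xl yl /= /andP[sx1].
rewrite rcons_path => /andP[pl lt]; exists x1, l; split => //.
- by rewrite sx1 /=; have /andP[] := path_le_mem pl xl; olra.
- by rewrite lt andbT; have /andP[] := path_le_mem pl yl; olra.
Unshelve. all: by end_near. Qed.

Lemma filter_split s z t m : s < z -> z < t ->
  [seq x <- lambda m | s < x < t] =
  [seq x <- lambda m | s < x < z] ++
  (if z \in lambda m then [:: z] else [::]) ++ [seq x <- lambda m | z < x < t].
Proof.
move=> sz zt; apply: lt_sorted_eq.
- exact: (sorted_filter lt_trans) (lam_sorted m).
- have h u v : pairwise <%R [seq x <- lambda m | u < x < v].
    rewrite -(sorted_pairwise lt_trans).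
    exact: (sorted_filter lt_trans) (lam_sorted m).
  rewrite sorted_pairwise; last exact: lt_trans.
  rewrite !pairwise_cat !h /= !andbT; apply/and3P; split.
  + rewrite allrel_catr; apply/andP; split; apply/allrelP => x y.
      rewrite mem_filter => /andP[/andP[_ xz] _].
      by case: ifP => //= _; rewrite inE => /eqP ->.
    by rewrite !mem_filter => /andP[/andP[_ xz] _] /andP[/andP[zy _] _]; olra.
  + apply/allrelP => x y; rewrite mem_filter.
    by case: ifP => //= _; rewrite inE => /eqP -> /andP[/andP[]].
  + by case: ifP.
- move=> x; rewrite !mem_cat !mem_filter.
  case: (ltgtP x z) => [xz|zx|->].
  + have -> : (x \in (if z \in lambda m then [:: z] else [::])) = false.
      by case: ifP => //= _; rewrite inE lt_eqF.
    by rewrite (lt_trans xz zt) /= !andbT !orbF.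
  + have -> : (x \in (if z \in lambda m then [:: z] else [::])) = false.
      by case: ifP => //= _; rewrite inE gt_eqF.
    by rewrite (lt_trans sz zx).
  + rewrite sz zt /= ?orbF.
    by case: ifP => //= _; rewrite inE eqxx.
Qed.

(** A point [z] of the union belongs to all late partitions, and the sum
    splits there. Otherwise [z] lies in a partition interval from [p] to [n],
    both close to [z], and splitting at [z] replaces [K p n] by [K p z + K z
    n]. *)
Lemma lsum_split K s z t c d : a <= s -> s < z -> z < t -> t <= b ->
  c < z -> z < d ->
  \forall m \near \oo, lsum K s t m = lsum K s z m + lsum K z t m \/
    (~ ulam z /\ exists p n, [/\ c < p < z, z < n < d &
       lsum K s t m = lsum K s z m + lsum K z t m + (K p n - K p z - K z n)]).
Proof.
move=> as_ sz zt tb cz zd.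
have h1 := @restr_ends s z z c as_ sz ltac:(olra) sz cz.
have h2 := @restr_ends z t d z ltac:(olra) zt tb zd zt.
have [uz|uz] := pselect (ulam z).
- case: uz => m0 _ /= zm0; near=> m; left.
  have zm : z \in lambda m.
    have /lam_sub : (m0 <= m)%N by near: m; exists m0.
    by move=> /(_ z zm0); rewrite inE => /orP[/eqP|//]; olra.
  rewrite /lsum /partition_restr (filter_split m sz zt) zm rcons_cat psum_cat.
  by rewrite (psum_rcons K s) /= addrA.
- near=> m; right; split => //.
  have zm : z \notin lambda m.
    by apply/negP => zm; apply: uz; exists m => //=; rewrite inE zm orbT.
  have [x1 [l1 [e1 sx1 cl1 p1]]] : exists x1 l,
    [/\ partition_restr s z (lambda m) = x1 :: rcons l z,
      s < x1 < z, c < last x1 l < z & path <%R x1 l] by near: m.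
  have [x2 [l2 [e2 sx2 cl2 p2]]] : exists x1 l,
    [/\ partition_restr z t (lambda m) = x1 :: rcons l t,
      z < x1 < d, z < last x1 l < t & path <%R x1 l] by near: m.
  exists (last x1 l1), x2; split => //.
  have e3 : partition_restr s t (lambda m) = x1 :: l1 ++ x2 :: rcons l2 t.
    rewrite /partition_restr (filter_split m sz zt) (negbTE zm) /=.
    move: e1 e2; rewrite /partition_restr -!rcons_cons.
    move=> /rcons_inj[->] /rcons_inj[->].
    by rewrite rcons_cat.
  rewrite /lsum e1 e2 e3 /= psum_cat psum_rcons /=; ring.
Unshelve. all: by end_near. Qed.

End Refining.

(** * Limits of sums along the sequence *)

Section LimitSums.
Variables (R : realType) (a b : R) (lambda : nat -> seq R).
Hypothesis ab : a < b.
Hypothesis lamP : in_Lambda a b lambda.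
Implicit Types (K U : R -> R -> R) (V G : R -> R) (s t z e : R).
Local Notation lsum := (lsum lambda).
Local Notation ulam := (ulam a lambda).
Local Notation locally_good := (locally_good a b).

Lemma seq_cvgP (u : nat -> R) (l : R) : u @ \oo --> l <->
  forall e, 0 < e -> \forall m \near \oo, `|u m - l| <= e.
Proof.
split=> [/cvgrPdist_le h e /h|h].
  by apply: filterS => m /=; rewrite distrC.
by apply/cvgrPdist_le => e /h; apply: filterS => m /=; rewrite distrC.
Qed.

Lemma seq_cvg_le (u : nat -> R) (l L c : R) : u @ \oo --> l ->
  (\forall m \near \oo, `|u m - c| <= L) -> `|l - c| <= L.
Proof.
move=> ul h; apply/ler_addgt0Pr => e e0.
have /seq_cvgP/(_ e e0) h' := ul.
have : \forall m \near \oo, `|l - c| <= L + e.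
  near=> m; have h1 : `|u m - c| <= L by near: m.
  have h2 : `|u m - l| <= e by near: m.
  by move: h1 h2; rewrite !ler_norml; olra.
by move=> [m _ /(_ m)]; apply => /=.
Unshelve. all: by end_near. Qed.

(** What remains to be controlled in [lsum_split] for the sums of [K] to be
    additive in the limit. *)
Definition asym_add K := forall z, a < z < b -> ~ ulam z ->
  forall e, 0 < e -> exists2 d, 0 < d & forall p n, a <= p -> n <= b ->
    z - d < p < z -> z < n < z + d -> `|K p n - K p z - K z n| <= e.

(** No single partition interval contributes to the limit of the sums of [K]:
    neither the first and the last one, nor the one around a point outside the
    partitions. *)
Definition vanish K :=
  [/\ forall z, a < z <= b -> K x z @[x --> z^'-] --> (0 : R),
      forall z, a <= z < b -> K z y @[y --> z^'+] --> (0 : R) &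
      forall z, a < z < b -> ~ ulam z ->
        forall e, 0 < e -> exists2 d, 0 < d & forall p n, a <= p -> n <= b ->
        z - d < p < z -> z < n < z + d -> `|K p n| <= e].

(** A bound on sums only, since [U] will involve squared increments of a
    function, which are not dominated by the increments of its bracket. *)
Definition ctrl U V := forall s t, a <= s -> s < t -> t <= b ->
  forall e, 0 < e -> \forall m \near \oo, lsum U s t m <= V t - V s + e.

Lemma vanish_asym K : vanish K -> asym_add K.
Proof.
move=> [v1 v2 v3] z zab uz e e0; have e3 : 0 < e / 3 by olra.
have /cvg_leftP/(_ _ e3)[d1 d10 h1] := v1 z ltac:(olra).
have /cvg_rightP/(_ _ e3)[d2 d20 h2] := v2 z ltac:(olra).
have [d3 d30 h3] := v3 z zab uz _ e3.
exists (Num.min d1 (Num.min d2 d3)); first by rewrite !lt_min d10 d20.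
move=> p n ap nb /andP[zp pz] /andP[zn nz].
have m1 : Num.min d1 (Num.min d2 d3) <= d1 by rewrite ge_min lexx.
have m2 : Num.min d1 (Num.min d2 d3) <= d2 by rewrite !ge_min lexx !orbT.
have m3 : Num.min d1 (Num.min d2 d3) <= d3 by rewrite !ge_min lexx !orbT.
have := h1 p ltac:(olra); have := h2 n ltac:(olra).
have := h3 p n ap nb ltac:(olra) ltac:(olra).
by rewrite !subr0 !ler_norml; olra.
Qed.

Lemma vanish_dom K K' M : vanish K ->
  (forall x y, a <= x -> x < y -> y <= b -> `|K' x y| <= M * `|K x y|) ->
  vanish K'.
Proof.
move=> [v1 v2 v3] H; have M0 : 0 < `|M| + 1 by have := normr_ge0 M; olra.
have H' x y e : a <= x -> x < y -> y <= b -> `|K x y| <= e / (`|M| + 1) ->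
    `|K' x y| <= e.
  move=> ax xy yb Ke; apply: (le_trans (H x y ax xy yb)).
  have -> : e = (`|M| + 1) * (e / (`|M| + 1)) by field; olra.
  apply: (@le_trans _ _ ((`|M| + 1) * `|K x y|)).
    by rewrite ler_wpM2r//; have := ler_norm M; olra.
  by apply: ler_wpM2l => //; olra.
split=> [z zab|z zab|z zab uz e e0].
- apply/cvg_leftP => e e0; have e1 : 0 < e / (`|M| + 1) by exact: divr_gt0.
  have /cvg_leftP/(_ _ e1)[d d0 hd] := v1 z zab.
  have mi1 : Num.min d (z - a) <= d by rewrite ge_min lexx.
  have mi2 : Num.min d (z - a) <= z - a by rewrite ge_min lexx orbT.
  exists (Num.min d (z - a)); first by rewrite lt_min d0 /=; olra.
  move=> x xz; rewrite subr0; apply: H'; try olra.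
  by rewrite -[K x z]subr0; apply: hd; olra.
- apply/cvg_rightP => e e0; have e1 : 0 < e / (`|M| + 1) by exact: divr_gt0.
  have /cvg_rightP/(_ _ e1)[d d0 hd] := v2 z zab.
  have mi1 : Num.min d (b - z) <= d by rewrite ge_min lexx.
  have mi2 : Num.min d (b - z) <= b - z by rewrite ge_min lexx orbT.
  exists (Num.min d (b - z)); first by rewrite lt_min d0 /=; olra.
  move=> x xz; rewrite subr0; apply: H'; try olra.
  by rewrite -[K z x]subr0; apply: hd; olra.
- have e1 : 0 < e / (`|M| + 1) by exact: divr_gt0.
  have [d d0 hd] := v3 z zab uz _ e1; exists d => // p n ap nb zp zn.
  by apply: H' => //; [olra|exact: hd].
Qed.

Lemma vanishD K K' : vanish K -> vanish K' -> vanish (fun x y => K x y + K' x y).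
Proof.
move=> [v1 v2 v3] [w1 w2 w3]; split=> [z zab|z zab|z zab uz e e0].
- by rewrite -[X in _ --> X](addr0 0); apply: cvgD; [exact: v1|exact: w1].
- by rewrite -[X in _ --> X](addr0 0); apply: cvgD; [exact: v2|exact: w2].
- have e2 : 0 < e / 2 by olra.
  have [d d0 hd] := v3 z zab uz _ e2; have [d' d'0 hd'] := w3 z zab uz _ e2.
  have mi1 : Num.min d d' <= d by rewrite ge_min lexx.
  have mi2 : Num.min d d' <= d' by rewrite ge_min lexx orbT.
  exists (Num.min d d') => [|p n ap nb zp zn]; first by rewrite lt_min d0.
  have := hd p n ap nb ltac:(olra) ltac:(olra).
  have := hd' p n ap nb ltac:(olra) ltac:(olra).
  by rewrite !ler_norml; olra.
Qed.

Lemma lsum_asym K s z t e : asym_add K -> a <= s -> s < z -> z < t -> t <= b ->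
  0 < e -> \forall m \near \oo,
    `|lsum K s t m - (lsum K s z m + lsum K z t m)| <= e.
Proof.
move=> aK as_ sz zt tb e0.
have [uz|uz] := pselect (ulam z).
  have := lsum_split lamP K as_ sz zt tb sz zt; apply: filterS => m [->|[]//].
  by rewrite subrr normr0 ltW.
have [d d0 hd] := aK z ltac:(olra) uz e e0.
have c1 : Num.max s (z - d) < z by rewrite gt_max sz /=; olra.
have c2 : z < Num.min t (z + d) by rewrite lt_min zt /=; olra.
have := lsum_split lamP K as_ sz zt tb c1 c2.
apply: filterS => m [->|[_ [p [n]]]]; first by rewrite subrr normr0 ltW.
rewrite gt_max lt_min => -[/andP[/andP[sp dp] pz] /andP[zn /andP[nt nondec]] ->].
rewrite [X in `|X|](_ : _ = K p n - K p z - K z n); last ring.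
by apply: hd; olra.
Qed.

(** The first and the last term have limits, and the other terms belong to the
    open interval, where a condition on short intervals applies. *)
Lemma lsum_ends K s t (k k' : R) c c' e : a <= s -> s < t -> t <= b ->
  K s y @[y --> s^'+] --> k -> K x t @[x --> t^'-] --> k' ->
  0 < e -> s < c -> c' < t ->
  \forall m \near \oo, exists x1 l,
   [/\ partition_restr s t (lambda m) = x1 :: rcons l t,
      s < x1 < c, c' < last x1 l < t, path <%R x1 l &
      `|lsum K s t m - (k + psum K x1 l + k')| <= e].
Proof.
move=> as_ st tb /cvg_rightP ks /cvg_leftP kt e0 sc ct.
have e2 : 0 < e / 2 by olra.
have [d d0 hd] := ks _ e2; have [d' d'0 hd'] := kt _ e2.
have c1 : s < Num.min c (s + d) by rewrite lt_min sc /=; olra.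
have c2 : Num.max c' (t - d') < t by rewrite gt_max ct /=; olra.
have := restr_ends lamP as_ st tb c1 c2.
apply: filterS => m [x1 [l [E]]].
rewrite lt_min gt_max => /andP[sx1 /andP[x1c x1d]] /andP[/andP[cl dl] lt] pl.
exists x1, l; split => //; rewrite ?sx1 ?cl//.
rewrite /lsum E /= psum_rcons.
have := hd x1 ltac:(olra); have := hd' (last x1 l) ltac:(olra).
by rewrite !ler_norml; olra.
Qed.

(** By [lsum_asym] the bound is additive in the limit, so [cousin] extends it
    from short intervals to all of them; then [e] tends to 0. *)
Lemma lsum_null K V : asym_add K ->
  (forall e, 0 < e -> locally_good (fun s t => forall e', 0 < e' ->
     \forall m \near \oo, `|lsum K s t m| <= e * (V t - V s) + e')) ->
  forall s t, a <= s -> s < t -> t <= b -> lsum K s t @ \oo --> (0 : R).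
Proof.
move=> aK H s t as_ st tb; apply/seq_cvgP => e e0.
have key e1 : 0 < e1 -> forall e', 0 < e' ->
     \forall m \near \oo, `|lsum K s t m| <= e1 * (V t - V s) + e'.
  move=> e10; move: s t as_ st tb; apply: cousin (H e1 e10) => //.
  move=> s z t as_ sz zt tb h1 h2 e' e'0; have e3 : 0 < e' / 3 by olra.
  near=> m.
  have : `|lsum K s z m| <= e1 * (V z - V s) + e' / 3 by near: m; exact: h1.
  have : `|lsum K z t m| <= e1 * (V t - V z) + e' / 3 by near: m; exact: h2.
  have : `|lsum K s t m - (lsum K s z m + lsum K z t m)| <= e' / 3.
    by near: m; exact: lsum_asym.
  by rewrite !ler_norml; olra.
have V0 := normr_ge0 (V t - V s).
have e10 : 0 < e / (2 * (`|V t - V s| + 1)) by apply: divr_gt0 => //; olra.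
have := key _ e10 (e / 2) ltac:(olra); apply: filterS => m; rewrite subr0 => h.
apply: (le_trans h).
have : e / (2 * (`|V t - V s| + 1)) * (`|V t - V s| + 1) = e / 2 by field; olra.
have := ler_norm (V t - V s); nra.
Unshelve. all: by end_near. Qed.

(** Approximate limits on short intervals add up to approximate limits, with
    errors bounded by the total increment of [V]; so the sums are Cauchy. *)
Lemma lsum_sew K V : asym_add K ->
  (forall e, 0 < e -> locally_good (fun s t => exists J, forall e', 0 < e' ->
     \forall m \near \oo, `|lsum K s t m - J| <= e * (V t - V s) + e')) ->
  exists Phi : R -> R, Phi a = 0 /\ forall s t, a <= s -> s < t -> t <= b ->
    lsum K s t @ \oo --> Phi t - Phi s.
Proof.
move=> aK H.
have key e1 : 0 < e1 -> forall s t, a <= s -> s < t -> t <= b ->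
    exists J, forall e', 0 < e' ->
     \forall m \near \oo, `|lsum K s t m - J| <= e1 * (V t - V s) + e'.
  move=> e10; apply: cousin (H e1 e10) => //.
  move=> s z t as_ sz zt tb [J1 h1] [J2 h2]; exists (J1 + J2) => e' e'0.
  have e3 : 0 < e' / 3 by olra.
  near=> m.
  have : `|lsum K s z m - J1| <= e1 * (V z - V s) + e' / 3.
    by near: m; exact: h1.
  have : `|lsum K z t m - J2| <= e1 * (V t - V z) + e' / 3.
    by near: m; exact: h2.
  have : `|lsum K s t m - (lsum K s z m + lsum K z t m)| <= e' / 3.
    by near: m; exact: lsum_asym.
  by rewrite !ler_norml; olra.
have cv s t : a <= s -> s < t -> t <= b -> cvg (lsum K s t @ \oo).
  move=> as_ st tb; apply: cvg_of_cauchy => e e0.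
  have V0 := normr_ge0 (V t - V s).
  have e10 : 0 < e / (2 * (`|V t - V s| + 1)) by apply: divr_gt0 => //; olra.
  have [J hJ] := key _ e10 s t as_ st tb; exists J.
  have := hJ (e / 2) ltac:(olra); apply: filterS => m h; apply: (le_trans h).
  have : e / (2 * (`|V t - V s| + 1)) * (`|V t - V s| + 1) = e / 2.
    by field; olra.
  have := ler_norm (V t - V s); nra.
(* On the degenerate interval the sum has one spurious term [K a a]. *)
exists (fun x => if x == a then 0 else lim (lsum K a x @ \oo)).
split=> [|s t as_ st tb]; first by rewrite eqxx.
rewrite gt_eqF ?(le_lt_trans as_)//.
move: as_; rewrite le_eqVlt => /orP[/eqP sa|as_].
  by rewrite -sa eqxx subr0; apply: cv => //; olra.
rewrite gt_eqF//; apply/seq_cvgP => e e0; have e3 : 0 < e / 3 by olra.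
have /seq_cvgP/(_ _ e3) h1 := cv a s (lexx a) as_ ltac:(olra).
have /seq_cvgP/(_ _ e3) h2 := cv a t (lexx a) ltac:(olra) tb.
have h3 := lsum_asym aK (lexx a) as_ st tb e3.
near=> m.
have : `|lsum K a s m - lim (lsum K a s @ \oo)| <= e / 3 by near: m.
have : `|lsum K a t m - lim (lsum K a t @ \oo)| <= e / 3 by near: m.
have : `|lsum K a t m - (lsum K a s m + lsum K s t m)| <= e / 3 by near: m.
by rewrite !ler_norml; olra.
Unshelve. all: by end_near. Qed.

(** Inside a short interval [K] is a small multiple of [U], whose sums are
    bounded, and the two end terms vanish in the limit. *)
Lemma lsum_dominated K U V : vanish K -> ctrl U V ->
  (forall x y, a <= x -> x < y -> y <= b -> 0 <= U x y) ->
  (forall e, 0 < e -> locally_good (fun s t =>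
     forall x y, s < x -> x < y -> y < t -> `|K x y| <= e * U x y)) ->
  forall s t, a <= s -> s < t -> t <= b ->
    lsum (fun x y => `|K x y|) s t @ \oo --> (0 : R).
Proof.
move=> vK cU U0 H.
have vK' : vanish (fun x y => `|K x y|).
  by apply: (@vanish_dom K _ 1) => // x y; rewrite normr_id mul1r.
apply: (@lsum_null _ V); first exact: vanish_asym.
move=> e e0; apply: locally_good_sub (H e e0) _ => s t as_ st tb h e' e'0.
have e2 : 0 < e' / 2 by olra.
have e1 : 0 < e' / (2 * e) by apply: divr_gt0 => //; olra.
have [v1 v2 _] := vK'.
have ends := @lsum_ends (fun x y => `|K x y|) s t _ _ _ _ _ as_ st tb
  (v2 s ltac:(olra)) (v1 t ltac:(olra)) e2 st st.
near=> m.
have [x1 [l [E x1s lt pl]]] : exists x1 l,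
   [/\ partition_restr s t (lambda m) = x1 :: rcons l t,
      s < x1 < t, s < last x1 l < t, path <%R x1 l &
      `|lsum (fun x y => `|K x y|) s t m
         - (0 + psum (fun x y => `|K x y|) x1 l + 0)| <= e' / 2] by near: m.
have hU : lsum U s t m <= V t - V s + e' / (2 * e) by near: m; exact: cU.
have : psum (fun x y => `|K x y|) x1 l <= e * psum U x1 l.
  by rewrite -psumZ; apply: ler_psum => // x y ? ? ?; apply: h; olra.
have : 0 <= psum (fun x y => `|K x y|) x1 l.
  by rewrite -(psum0 x1 l); apply: ler_psum.
have hU1 : psum U x1 l <= lsum U s t m.
  rewrite /lsum E /= psum_rcons.
  have := U0 s x1 as_ ltac:(olra) ltac:(olra).
  have := U0 (last x1 l) t ltac:(olra) ltac:(olra) tb; olra.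
have : e * psum U x1 l <= e * (V t - V s) + e' / 2.
  have -> : e' / 2 = e * (e' / (2 * e)) by field; olra.
  by rewrite -mulrDr ler_wpM2l ?(ltW e0)//; olra.
by rewrite !ler_norml; olra.
Unshelve. all: by end_near. Qed.

Lemma lsum_norm_null K K' M :
  (forall x y, a <= x -> x < y -> y <= b -> `|K' x y| <= M * `|K x y|) ->
  forall s t, a <= s -> s < t -> t <= b ->
  lsum (fun x y => `|K x y|) s t @ \oo --> (0 : R) ->
  lsum K' s t @ \oo --> (0 : R).
Proof.
move=> H s t as_ st tb /seq_cvgP h; apply/seq_cvgP => e e0.
have M0 := normr_ge0 M.
have e1 : 0 < e / (`|M| + 1) by apply: divr_gt0 => //; olra.
apply: filterS (h _ e1) => m; rewrite !subr0 => hm.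
have := ler_norm_psum K' s (partition_restr s t (lambda m)).
rewrite -/(lsum K' s t m) => /le_trans; apply.
have pth := restr_path lamP m st.
have lst : last s (partition_restr s t (lambda m)) = t by rewrite last_rcons.
apply: (@le_trans _ _ ((`|M| + 1) * lsum (fun x y => `|K x y|) s t m)).
  rewrite /lsum -psumZ; apply: ler_psum => // x y sx xy; rewrite lst => yt.
  apply: (le_trans (H x y _ xy _)); [olra|olra|].
  by rewrite ler_wpM2r//; have := ler_norm M; olra.
have -> : e = (`|M| + 1) * (e / (`|M| + 1)) by field; olra.
apply: ler_wpM2l; first olra.
by apply: le_trans hm; exact: ler_norm.
Qed.

(** The sums of [K] may tend to 0 by cancellation, which a weight could
    destroy. On a short interval, however, a regulated [G] is nearly constant:
    the weighted sum is [G x1] times a sum of [K], up to a small multiple of a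
    sum of [U]. *)
Lemma lsum_weighted K U V G : vanish K -> ctrl U V ->
  (forall x y, a <= x -> x < y -> y <= b -> `|K x y| <= U x y) ->
  (forall s t, a <= s -> s < t -> t <= b -> lsum K s t @ \oo --> (0 : R)) ->
  flat_reg a b G ->
  forall s t, a <= s -> s < t -> t <= b ->
    lsum (fun x y => G x * K x y) s t @ \oo --> (0 : R).
Proof.
move=> vK cU KU K0 Gr; have [M M0 GM] := flat_reg_bounded ab Gr.
have vGK : vanish (fun x y => G x * K x y).
  apply: (@vanish_dom K _ M) => // x y ? ? ?; rewrite normrM ler_wpM2r//.
  by apply: GM; olra.
apply: (@lsum_null _ V); first exact: vanish_asym.
move=> e e0; apply: locally_good_sub (Gr e e0) _ => s t as_ st tb h e' e'0.
have e4 : 0 < e' / 4 by olra.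
have e1 : 0 < e' / (4 * e) by apply: divr_gt0 => //; olra.
have e2 : 0 < e' / (8 * M) by apply: divr_gt0 => //; olra.
have [v1 v2 _] := vGK; have [w1 w2 _] := vK.
have ends := @lsum_ends (fun x y => G x * K x y) s t _ _ _ _ _ as_ st tb
  (v2 s ltac:(olra)) (v1 t ltac:(olra)) e4 st st.
have ends' := lsum_ends as_ st tb (w2 s ltac:(olra)) (w1 t ltac:(olra)) e2 st st.
have /seq_cvgP/(_ _ e2) K00 := K0 s t as_ st tb.
near=> m.
have [x1 [l [E x1s lt pl hGK]]] : exists x1 l,
   [/\ partition_restr s t (lambda m) = x1 :: rcons l t,
      s < x1 < t, s < last x1 l < t, path <%R x1 l &
      `|lsum (fun x y => G x * K x y) s t m
         - (0 + psum (fun x y => G x * K x y) x1 l + 0)| <= e' / 4] by near: m.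
have [x1' [l' [E' _ _ _ hK]]] : exists x1 l,
   [/\ partition_restr s t (lambda m) = x1 :: rcons l t,
      s < x1 < t, s < last x1 l < t, path <%R x1 l &
      `|lsum K s t m - (0 + psum K x1 l + 0)| <= e' / (8 * M)] by near: m.
have hK0 : `|lsum K s t m - 0| <= e' / (8 * M) by near: m.
move: E'; rewrite E -!rcons_cons => /rcons_inj[ex el]; rewrite -ex -el in hK.
have hU : lsum U s t m <= V t - V s + e' / (4 * e) by near: m; exact: cU.
have U0 x y : a <= x -> x < y -> y <= b -> 0 <= U x y.
  by move=> ? ? ?; apply: le_trans (KU x y _ _ _).
have hU1 : psum U x1 l <= lsum U s t m.
  rewrite /lsum E /= psum_rcons.
  have := U0 s x1 as_ ltac:(olra) ltac:(olra).
  have := U0 (last x1 l) t ltac:(olra) ltac:(olra) tb; olra.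
have hK1 : `|psum K x1 l| <= e' / (4 * M).
  have : e' / (4 * M) = e' / (8 * M) + e' / (8 * M) by field; olra.
  by move: hK hK0; rewrite !ler_norml; glra.
have hGK1 : `|G x1 * psum K x1 l| <= e' / 4.
  have -> : e' / 4 = M * (e' / (4 * M)) by field; olra.
  by rewrite normrM ler_pM//; apply: GM; olra.
have : `|psum (fun x y => (G x - G x1) * K x y) x1 l| <= e * psum U x1 l.
  apply: (le_trans (ler_norm_psum _ _ _)).
  rewrite -psumZ; apply: ler_psum => // x y ? ? ?; rewrite normrM.
  by apply: ler_pM => //; [apply: h; olra|apply: KU; olra].
have -> : psum (fun x y => (G x - G x1) * K x y) x1 l =
    psum (fun x y => G x * K x y) x1 l - G x1 * psum K x1 l.
  by rewrite -psumZ -psumB; apply: eq_psum => // *; ring.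
have : e * psum U x1 l <= e * (V t - V s) + e' / 4.
  have -> : e' / 4 = e * (e' / (4 * e)) by field; olra.
  by rewrite -mulrDr ler_wpM2l ?(ltW e0)//; olra.
by move: hGK hGK1; rewrite !ler_norml; glra.
Unshelve. all: by end_near. Qed.

(** The limit over [[s, z]] with [s] close to [z] is the limit of the last
    term, up to sums over short open intervals, which are small by
    assumption. *)
Lemma lsum_jumps K (Phi kl kr : R -> R) :
  (forall s t, a <= s -> s < t -> t <= b -> lsum K s t @ \oo --> Phi t - Phi s) ->
  (forall z, a < z <= b -> K x z @[x --> z^'-] --> kl z) ->
  (forall z, a <= z < b -> K z y @[y --> z^'+] --> kr z) ->
  (forall e, 0 < e -> locally_good (fun s t => forall x l, s < x ->
     path <%R x l -> last x l < t -> `|psum K x l| <= e)) ->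
  (forall z, a < z <= b -> Phi x @[x --> z^'-] --> Phi z - kl z) /\
  (forall z, a <= z < b -> Phi y @[y --> z^'+] --> Phi z + kr z).
Proof.
move=> KPhi Kl Kr H; split=> z zab.
- apply/cvg_leftP => e e0; have e2 : 0 < e / 2 by olra.
  have [d d0 [hl _]] := H _ e2 z ltac:(olra).
  have /cvg_leftP/(_ _ e2)[d' d'0 hd'] := Kl z zab.
  have mi1 : Num.min d (z - a) <= d by rewrite ge_min lexx.
  have mi2 : Num.min d (z - a) <= z - a by rewrite ge_min lexx orbT.
  have mi0 : 0 < Num.min d (z - a) by rewrite lt_min d0 /=; olra.
  exists (Num.min d (z - a)) => // s sz.
  have as_ : a <= s by olra.
  rewrite [X in `|X|](_ : _ = - (Phi z - Phi s - kl z)); last ring.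
  rewrite normrN; apply: seq_cvg_le (KPhi s z as_ ltac:(olra) ltac:(olra)) _.
  have c1 : Num.max s (z - d') < z by rewrite gt_max; olra.
  have := restr_ends lamP as_ (andP sz).2 (andP zab).2 (andP sz).2 c1.
  apply: filterS => m [x1 [l [E sx1]]].
  rewrite gt_max => /andP[/andP[sl dl] lz] pl.
  have : `|psum K s (x1 :: l)| <= e / 2.
    have mm1 : Num.max a (z - d) < s by rewrite gt_max; olra.
    have mm2 : a <= Num.max a (z - d) by rewrite le_max lexx.
    have mm3 : z - d <= Num.max a (z - d) by rewrite le_max lexx orbT.
    (* The sum includes the first term, from [s]; it is inner for a slightly
       larger interval. *)
    pose c := (Num.max a (z - d) + s) / 2.
    have [q1 q2 q3] : [/\ a <= c, z - d < c & c < s] by rewrite /c; split; olra.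
    apply: (hl c z q1 q2 (lt_trans q3 (andP sz).2) (lexx z) s (x1 :: l) q3) => //.
    by rewrite /= (andP sx1).1.
  have := hd' (last x1 l) ltac:(olra).
  by rewrite /lsum E -rcons_cons psum_rcons /= !ler_norml; olra.
- apply/cvg_rightP => e e0; have e2 : 0 < e / 2 by olra.
  have [d d0 [_ hr]] := H _ e2 z ltac:(olra).
  have /cvg_rightP/(_ _ e2)[d' d'0 hd'] := Kr z zab.
  have mi1 : Num.min d (b - z) <= d by rewrite ge_min lexx.
  have mi2 : Num.min d (b - z) <= b - z by rewrite ge_min lexx orbT.
  have mi0 : 0 < Num.min d (b - z) by rewrite lt_min d0 /=; olra.
  exists (Num.min d (b - z)) => // t zt.
  have tb : t <= b by olra.
  rewrite [X in `|X|](_ : _ = Phi t - Phi z - kr z); last ring.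
  apply: seq_cvg_le (KPhi z t (andP zab).1 ltac:(olra) tb) _.
  have c1 : z < Num.min t (z + d') by rewrite lt_min; olra.
  have := restr_ends lamP (andP zab).1 (andP zt).1 tb c1 (andP zt).1.
  apply: filterS => m [x1 [l [E]]].
  rewrite lt_min => /andP[zx1 /andP[x1t x1d]] sl pl.
  have : `|psum K x1 (rcons l t)| <= e / 2.
    have mm1 : t < Num.min b (z + d) by rewrite lt_min; olra.
    have mm2 : Num.min b (z + d) <= b by rewrite ge_min lexx.
    have mm3 : Num.min b (z + d) <= z + d by rewrite ge_min lexx orbT.
    pose c := (Num.min b (z + d) + t) / 2.
    have [q1 q2 q3] : [/\ t < c, c < z + d & c <= b] by rewrite /c; split; olra.
    apply: (hr z c (lexx z) (lt_trans (andP zt).1 q1) q2 q3 x1 (rcons l t)) => //.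
      by rewrite rcons_path pl; case/andP: sl.
    by rewrite last_rcons.
  have := hd' x1 ltac:(olra).
  by rewrite /lsum E /= !ler_norml; olra.
Qed.

End LimitSums.

(** * The Love-Young inequality *)

Section Young.
Variables (R : realType) (a b : R).
Implicit Types (W G h : R -> R) (x y : R) (l : seq R).
Local Notation locally_good := (locally_good a b).

(** Tags are a function of the endpoints, so that a tagged sum restricts to
    sublists of the partition. *)
Definition tag (tau : R -> R -> R) := forall x y, x <= y -> x <= tau x y <= y.

Definition rsum_term (G h : R -> R) tau x y : R := G (tau x y) * (h y - h x).

(** On short intervals Riemann-Stieltjes sums with arbitrary tags agree with
    the one-term sum, up to a small multiple of the increment of [W]. Both the
    case of an integrator of bounded variation and the case of the Love-Young
    inequality lead to this property, and the integration theory below uses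
    nothing else. *)
Definition young W G h := forall e, 0 < e -> locally_good (fun s t =>
  forall x l tau, s < x -> path <%R x l -> last x l < t -> tag tau ->
  `|psum (rsum_term G h tau) x l - G x * (h (last x l) - h x)|
    <= e * (W (last x l) - W x)).

(** Used with the half of the increment of the control, to halve it on both
    sides of one interval. *)
Lemma threshold_split W c x l : l != [::] -> W x <= c ->
  exists l1 y l2, [/\ l = l1 ++ y :: l2, W (last x l1) <= c &
     c <= W y \/ l2 = [::]].
Proof.
elim: l x => [//|y l IH] x _ xc.
have [cy|yc] := leP c (W y); first by exists [::], y, l; split=> //; left.
case: l IH => [|z l] IH; first by exists [::], y, [::]; split=> //; right.
have [l1 [u [l2 [-> h1 h2]]]] := IH y isT (ltW yc).
by exists (y :: l1), u, l2.
Qed.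

(** Induction on the number of points. The control [W] crosses half of its
    increment [w] in one partition interval from [u] to [y]; to the left of
    [u] and to the right of [y] it grows by at most [w / 2]. Joining the two
    parts and that interval costs two products of increments, each at most [w
    `^ th] for [th = al + be]. The constant solves C = 2 C 2^(- th) + 2. *)
Lemma love_young W G h al be tau x l : nondec a b W -> 0 < al -> 0 < be ->
  1 < al + be ->
  (forall x y, a <= x -> x <= y -> y <= b -> `|G y - G x| <= (W y - W x) `^ al) ->
  (forall x y, a <= x -> x <= y -> y <= b -> `|h y - h x| <= (W y - W x) `^ be) ->
  tag tau -> a <= x -> path <%R x l -> last x l <= b ->
  `|psum (rsum_term G h tau) x l - G x * (h (last x l) - h x)|
    <= 2 / (1 - 2^-1 `^ (al + be - 1)) * (W (last x l) - W x) `^ (al + be).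
Proof.
move=> Wnd al0 be0 th1 HG Hh tg.
set th := al + be; set k := 2^-1 `^ (th - 1); set C := 2 / (1 - k).
have k1 : k < 1.
  have := @gt0_ltr_powR _ (th - 1) _ 2^-1 1; rewrite powR1; apply; rewrite ?nnegrE//; rewrite ?invf_lt1 ?ltr1n//.
  by rewrite /th; olra.
have C0 : 0 < C by apply: divr_gt0 => //; olra.
have Ck : C * k + 2 = C by rewrite /C; field; olra.
have [n] := ubnP (size l); elim: n x l => // n IH x l ln ax pl lb.
have [->|l0] := eqVneq l [::].
  by rewrite /= subrr mulr0 subrr normr0 mulr_ge0 ?powR_ge0// ltW.
pose w := W (last x l) - W x.
have xlast := path_le_last pl.
have w0 : 0 <= w by rewrite subr_ge0; apply: Wnd.
have wE : w = W (last x l) - W x by [].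
have wc : W x <= W x + w / 2 by olra.
have [l1 [y [l2 [El h1 h2]]]] := threshold_split l0 wc; clear wc.
(* The increment of [W] is a variable from here on, related to [W] by [wE]. *)
clearbody w; move: pl lb ln wE w0 h1 h2 xlast; rewrite El cat_path /= last_cat /= size_cat /=.
set u := last x l1; set v := last y l2.
move=> /and3P[p1 uy p2] vb ln wE w0 h1 h2 xv.
have xu := path_le_last p1; have yv := path_le_last p2; rewrite -/u -/v in xu yv.
have s1 : (size l1 < n)%N.
  by move: ln; rewrite addnS ltnS; apply: leq_ltn_trans; rewrite leq_addr.
have s2 : (size l2 < n)%N.
  by move: ln; rewrite addnS ltnS; apply: leq_ltn_trans; rewrite leq_addl.
rewrite psum_cat /= -/u.
have Wxu := Wnd x u ax xu ltac:(olra).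
have Wuy := Wnd u y ltac:(olra) (ltW uy) ltac:(olra).
have Wyv := Wnd y v ltac:(olra) yv vb.
have h2' : W v - W y <= w / 2.
  case: h2 => [h2|l20]; first olra.
  by rewrite /v l20 /=; olra.
have pw q q' : 0 <= q -> q <= q' -> q `^ th <= q' `^ th.
  by move=> q0 qq; apply: ge0_ler_powR; rewrite ?nnegrE//; rewrite /th; olra.
have pw2 : (w / 2) `^ th + (w / 2) `^ th = k * w `^ th.
  have th0 : 0 < th by rewrite /th; olra.
  have w20 : 0 <= w / 2 by olra.
  rewrite -(mulr_powRB1 w20 th0) -(mulr_powRB1 w0 th0) powRM//.
  by rewrite -/k; field.
have prodle q r : 0 <= q -> q <= w -> 0 <= r -> r <= w ->
    q `^ al * r `^ be <= w `^ th.
  move=> q0 qw r0 rw; rewrite /th powRD; last first.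
    by apply/implyP => /eqP; olra.
  by apply: ler_pM; rewrite ?powR_ge0//; apply: ge0_ler_powR; rewrite ?nnegrE//;
    olra.
have /andP[tu ty] := tg u y (ltW uy).
have R1 : `|(G (tau u y) - G x) * (h y - h u)| <= w `^ th.
  rewrite normrM; apply: le_trans (prodle (W (tau u y) - W x) (W y - W u) _ _ _ _).
  - by apply: ler_pM => //; [apply: HG|apply: Hh]; olra.
  - by have := Wnd x (tau u y) ax; olra.
  - by have := Wnd (tau u y) y; olra.
  - olra.
  - by olra.
have R2 : `|(G y - G x) * (h v - h y)| <= w `^ th.
  rewrite normrM; apply: le_trans (prodle (W y - W x) (W v - W y) _ _ _ _).
  - by apply: ler_pM => //; [apply: HG|apply: Hh]; olra.
  - by olra.
  - by olra.
  - by olra.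
  - by olra.
have P1 := pw (W u - W x) (w / 2) ltac:(olra) ltac:(olra).
have P2 := pw (W v - W y) (w / 2) ltac:(olra) ltac:(olra).
have J1 : C * (W u - W x) `^ th <= C * (w / 2) `^ th.
  by rewrite ler_wpM2l// ltW.
have J2 : C * (W v - W y) `^ th <= C * (w / 2) `^ th.
  by rewrite ler_wpM2l// ltW.
have CC : C * w `^ th = C * (w / 2) `^ th + C * (w / 2) `^ th
    + w `^ th + w `^ th by rewrite -{1}Ck -mulrDr pw2; ring.
have I1 := IH x l1 s1 ax p1 ltac:(rewrite -/u; olra).
have I2 := IH y l2 s2 ltac:(olra) p2 vb.
rewrite -/u -/v in I1 I2.
rewrite -wE CC.
rewrite [X in `|X|](_ : _ = (psum (rsum_term G h tau) x l1 - G x * (h u - h x))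
   + (psum (rsum_term G h tau) y l2 - G y * (h v - h y))
   + (G (tau u y) - G x) * (h y - h u) + (G y - G x) * (h v - h y)).
  apply: le_trans (ler_normD _ _) _; apply: lerD => //.
  apply: le_trans (ler_normD _ _) _; apply: lerD => //.
  apply: le_trans (ler_normD _ _) _; apply: lerD.
    exact: le_trans I1 J1.
  exact: le_trans I2 J2.
rewrite /rsum_term; ring.
Qed.

(** Two sufficient conditions for the existence of Young integrals. In the
    second one a single control bounds both functions, with exponents of sum
    larger than 1. *)
Definition ypair G h := [/\ flat_reg a b G, flat_reg a b h &
  (exists2 W, nondec a b W & forall x y, a <= x -> x <= y -> y <= b ->
      `|h y - h x| <= W y - W x) \/
  (exists W al be, [/\ nondec a b W, [/\ 0 < al, 0 < be & 1 < al + be],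
    forall x y, a <= x -> x <= y -> y <= b -> `|G y - G x| <= (W y - W x) `^ al &
    forall x y, a <= x -> x <= y -> y <= b -> `|h y - h x| <= (W y - W x) `^ be])].

(** If [h] has bounded variation, the flatness of [G] on short intervals
    suffices. Otherwise the bound [w `^ th] of [love_young] equals [w * w `^
    (th - 1)], and the second factor is small on short intervals. *)
Lemma ypair_young G h : ypair G h -> exists2 W, nondec a b W & young W G h.
Proof.
move=> [Gr hr [[W Wnd hW]|[W [al [be [Wnd [al0 be0 th1] HG Hh]]]]]];
  exists W => // e e0.
- apply: locally_good_sub (Gr e e0) _ => s t as_ st tb fl x l tau sx pl lt tg.
  have xl := path_le_last pl.
  rewrite -psum_telescope -psumZ -psumB -psum_telescope -psumZ.
  apply: (le_trans (ler_norm_psum _ _ _)); apply: ler_psum => // u v xu uv vl.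
  have /andP[tu tv] := tg u v (ltW uv).
  rewrite /rsum_term -mulrBl normrM; apply: ler_pM => //; last by apply: hW; olra.
  by apply: fl; olra.
- set th := al + be in th1 *; set C := 2 / (1 - 2^-1 `^ (th - 1)).
  have C0 : 0 < C.
    apply: divr_gt0 => //; rewrite subr_gt0.
    have := @gt0_ltr_powR _ (th - 1) _ 2^-1 1; rewrite powR1.
    by apply; rewrite ?nnegrE// ?invf_lt1 ?ltr1n//; olra.
  (* The threshold for [w] below which [C * w `^ th <= e * w]. *)
  pose eta := (e / C) `^ (th - 1)^-1.
  have eta0 : 0 < eta by rewrite powR_gt0// divr_gt0.
  apply: locally_good_sub (nd_flat Wnd eta0) _.
  move=> s t as_ st tb fl x l tau sx pl lt tg.
  have xl := path_le_last pl.
  apply: (le_trans (love_young Wnd al0 be0 th1 HG Hh tg _ pl _)); try olra.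
  rewrite -/th -/C; set w := W _ - W x.
  have w0 : 0 <= w by rewrite subr_ge0; apply: Wnd; olra.
  have we : w <= eta by apply: le_trans (ler_norm _) _; apply: fl; olra.
  rewrite -(@mulr_powRB1 _ w th) //; last olra.
  have : w `^ (th - 1) <= eta `^ (th - 1).
    by apply: ge0_ler_powR; rewrite ?nnegrE//; olra.
  have -> : eta `^ (th - 1) = e / C.
    rewrite /eta -powRrM mulVf ?powRr1//; last olra.
    by rewrite divr_ge0// ltW.
  move=> hw; have : C * w `^ (th - 1) <= e.
    have -> : e = C * (e / C) by field; olra.
    by rewrite ler_wpM2l// ltW.
  by move=> /(ler_wpM2l w0); rewrite mulrCA [e * w]mulrC.
Qed.

End Young.

(** * One-sided regularizations *)

Section OneSided.
Variables (R : realType) (a b : R).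
Hypothesis ab : a < b.
Implicit Types (W G h f : R -> R) (x y z c l L k : R).

Lemma left_lim_ge f z c l L : c < z -> f x @[x --> z^'-] --> l ->
  (forall x, c < x < z -> L <= f x) -> L <= l.
Proof.
move=> cz Fl h; apply: (cvgr_to_ge Fl).
near=> x; apply: h; apply/andP; split; near: x; [exact: nbhs_left_gt|].
exact: nbhs_left_lt.
Unshelve. all: by end_near. Qed.

Lemma right_lim_ge f z c l L : z < c -> f x @[x --> z^'+] --> l ->
  (forall x, z < x < c -> L <= f x) -> L <= l.
Proof.
move=> cz Fl h; apply: (cvgr_to_ge Fl).
near=> x; apply: h; apply/andP; split; near: x; last exact: nbhs_right_lt.
exact: nbhs_right_gt.
Unshelve. all: by end_near. Qed.

Lemma left_lim_dist f z c l L k : c < z -> f x @[x --> z^'-] --> l ->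
  (forall x, c < x < z -> `|f x - k| <= L) -> `|l - k| <= L.
Proof.
move=> cz fl h; have h1 : l <= L + k.
  by apply: left_lim_le cz fl _ => x /h; rewrite ler_norml; olra.
have h2 : k - L <= l.
  by apply: left_lim_ge cz fl _ => x /h; rewrite ler_norml; olra.
by rewrite ler_norml; olra.
Qed.

Lemma right_lim_dist f z c l L k : z < c -> f x @[x --> z^'+] --> l ->
  (forall x, z < x < c -> `|f x - k| <= L) -> `|l - k| <= L.
Proof.
move=> cz fl h; have h1 : l <= L + k.
  by apply: right_lim_le cz fl _ => x /h; rewrite ler_norml; olra.
have h2 : k - L <= l.
  by apply: right_lim_ge cz fl _ => x /h; rewrite ler_norml; olra.
by rewrite ler_norml; olra.
Qed.

Lemma left_reg_flat f : flat_reg a b f -> flat_reg a b (left_reg a f).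
Proof.
move=> fr e e0; apply: locally_good_sub (fr e e0) _ => s t as_ st tb fl x y xs ys.
rewrite /left_reg !gt_eqF; try olra.
apply: (@left_lim_dist f x s) => //; [olra|by apply: regulated_left fr _; olra|].
move=> u us; rewrite distrC; apply: (@left_lim_dist f y s) => //; [olra|..].
  by apply: regulated_left fr _; olra.
by move=> v vs; apply: fl; olra.
Qed.

Lemma right_reg_flat f : flat_reg a b f -> flat_reg a b (right_reg b f).
Proof.
move=> fr e e0; apply: locally_good_sub (fr e e0) _ => s t as_ st tb fl x y xs ys.
rewrite /right_reg !lt_eqF; try olra.
apply: (@right_lim_dist f x t) => //; [olra|by apply: regulated_right fr _; olra|].
move=> u us; rewrite distrC; apply: (@right_lim_dist f y t) => //; [olra|..].
  by apply: regulated_right fr _; olra.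
by move=> v vs; apply: fl; olra.
Qed.

Lemma nd_left_lim W x y : nondec a b W -> a <= x -> x < y -> y <= b ->
  W x <= left_lim W y.
Proof.
move=> Wn ax xy yb.
apply: (left_lim_ge xy (regulated_left (nd_flat Wn) _)); first olra.
by move=> z xz; apply: Wn; olra.
Qed.

Lemma nd_right_lim W x y : nondec a b W -> a <= x -> x < y -> y <= b ->
  right_lim W x <= W y.
Proof.
move=> Wn ax xy yb.
apply: (right_lim_le xy (regulated_right (nd_flat Wn) _)); first olra.
by move=> z xz; apply: Wn; olra.
Qed.

Lemma powR_root (al r w : R) : 0 < al -> 0 <= r -> 0 <= w ->
  (r <= w `^ al) = (r `^ al^-1 <= w).
Proof.
move=> al0 r0 w0.
have K u : 0 <= u -> (u `^ al) `^ al^-1 = u.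
  by move=> u0; rewrite -powRrM divff ?powRr1//; olra.
have K' u : 0 <= u -> (u `^ al^-1) `^ al = u.
  by move=> u0; rewrite -powRrM mulVf ?powRr1//; olra.
have ali : 0 < al^-1 by rewrite invr_gt0.
apply/idP/idP => h.
  by rewrite -(K w)//; apply: ge0_ler_powR; rewrite ?nnegrE ?powR_ge0// ltW.
by rewrite -(K' r)//; apply: ge0_ler_powR; rewrite ?nnegrE ?powR_ge0// ltW.
Qed.

Lemma left_reg_nd W : nondec a b W -> nondec a b (left_reg a W).
Proof.
move=> Wn x y ax; rewrite le_eqVlt => /orP[/eqP ->//|xy] yb.
rewrite /left_reg [y == a]gt_eqF; last olra.
case: eqP => [xa|/eqP xa]; first by apply: nd_left_lim => //; olra.
have ax' : a < x by rewrite lt_neqAle eq_sym xa.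
apply: (left_lim_le ax' (regulated_left (nd_flat Wn) _)); first olra.
by move=> z zx; apply: nd_left_lim => //; olra.
Qed.

Lemma right_reg_nd W : nondec a b W -> nondec a b (right_reg b W).
Proof.
move=> Wn x y ax; rewrite le_eqVlt => /orP[/eqP ->//|xy] yb.
rewrite /right_reg [x == b]lt_eqF; last olra.
case: eqP => [xa|/eqP xa]; first by apply: nd_right_lim => //; olra.
have ax' : y < b by rewrite lt_neqAle xa.
apply: (right_lim_ge ax' (regulated_right (nd_flat Wn) _)); first olra.
by move=> z zx; apply: nd_right_lim => //; olra.
Qed.

(** The bound is inverted by [powR_root] so that the control appears outside
    the power, and one-sided limits are taken in weak inequalities only. *)
Lemma left_reg_pow G W al : flat_reg a b G -> nondec a b W -> 0 < al ->
  (forall x y, a <= x -> x <= y -> y <= b -> `|G y - G x| <= (W y - W x) `^ al) ->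
  forall x y, a <= x -> x <= y -> y <= b ->
  `|left_reg a G y - left_reg a G x| <= (left_reg a W y - left_reg a W x) `^ al.
Proof.
move=> Gr Wn al0 H x y ax xy yb.
move: xy; rewrite le_eqVlt => /orP[/eqP ->|xy].
  by rewrite subrr normr0 powR_ge0.
have Wn' := left_reg_nd Wn; have := Wn' x y ax (ltW xy) yb.
rewrite /left_reg [y == a]gt_eqF; last olra.
have pw w w' : 0 <= w -> w <= w' -> w `^ al <= w' `^ al.
  by move=> ? ?; apply: ge0_ler_powR; rewrite ?nnegrE; olra.
have A x' : a <= x' -> x' < y ->
    `|left_lim G y - G x'| <= (left_lim W y - W x') `^ al.
  move=> ax' x'y; apply: (left_lim_dist x'y (regulated_left Gr _)); first olra.
  move=> y' y'x; apply: le_trans (H x' y' ax' _ _) (pw _ _ _ _); try olra.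
  - by have := Wn x' y' ax'; olra.
  - by have := @nd_left_lim W y' y Wn; olra.
case: eqP => [xa|/eqP xa] Wle; first by rewrite -xa; apply: A.
have ax' : a < x by rewrite lt_neqAle eq_sym xa.
rewrite powR_root ?subr_ge0//.
rewrite lerBrDl -lerBrDr.
apply: (left_lim_le ax' (regulated_left (nd_flat Wn) _)); first olra.
move=> x' x'x; rewrite lerBrDr -lerBrDl -powR_root//; last first.
  by have := @nd_left_lim W x' y Wn; olra.
rewrite distrC.
have x'x' : x' < x by olra.
apply: (left_lim_dist x'x' (regulated_left Gr _)); first olra.
move=> u ux; rewrite distrC; apply: le_trans (A u _ _) (pw _ _ _ _); try olra.
- by have := @nd_left_lim W u y Wn; olra.
- by have := Wn x' u; olra.
Qed.

Lemma right_reg_pow G W al : flat_reg a b G -> nondec a b W -> 0 < al ->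
  (forall x y, a <= x -> x <= y -> y <= b -> `|G y - G x| <= (W y - W x) `^ al) ->
  forall x y, a <= x -> x <= y -> y <= b ->
  `|right_reg b G y - right_reg b G x| <= (right_reg b W y - right_reg b W x) `^ al.
Proof.
move=> Gr Wn al0 H x y ax xy yb.
move: xy; rewrite le_eqVlt => /orP[/eqP ->|xy].
  by rewrite subrr normr0 powR_ge0.
have Wn' := right_reg_nd Wn; have := Wn' x y ax (ltW xy) yb.
rewrite /right_reg [x == b]lt_eqF; last olra.
have pw w w' : 0 <= w -> w <= w' -> w `^ al <= w' `^ al.
  by move=> ? ?; apply: ge0_ler_powR; rewrite ?nnegrE; olra.
have A y' : x < y' -> y' <= b ->
    `|G y' - right_lim G x| <= (W y' - right_lim W x) `^ al.
  move=> ax' x'y; rewrite distrC.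
  apply: (right_lim_dist ax' (regulated_right Gr _)); first olra.
  move=> x' y'x; rewrite distrC.
  apply: le_trans (H x' y' _ _ _) (pw _ _ _ _); try olra.
  - by have := Wn x' y'; olra.
  - by have := @nd_right_lim W x x' Wn; olra.
case: eqP => [yb'|/eqP xa] Wle; first by rewrite -yb'; apply: A => //; olra.
have yb' : y < b by rewrite lt_neqAle xa.
rewrite powR_root ?subr_ge0//.
rewrite lerBrDl.
apply: (right_lim_ge yb' (regulated_right (nd_flat Wn) _)); first olra.
move=> y' yy'; rewrite -lerBrDl -powR_root//; last first.
  by have := @nd_right_lim W x y' Wn; olra.
have y'y' : y < y' by olra.
apply: (right_lim_dist y'y' (regulated_right Gr _)); first olra.
move=> u ux; apply: le_trans (A u _ _) (pw _ _ _ _); try olra.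
- by have := @nd_right_lim W x u Wn; olra.
- by have := Wn u y'; olra.
Qed.

(** The Left Young integral is defined from regularized functions; this makes
    the Love-Young inequality available for them. *)
Lemma ypair_reg G h : ypair a b G h -> ypair a b (left_reg a G) (right_reg b h).
Proof.
move=> [Gr hr H]; split; [exact: left_reg_flat|exact: right_reg_flat|].
case: H => [[W Wn hW]|[W [al [be [Wn [al0 be0 th1] HG Hh]]]]].
- left; exists (right_reg b W); first exact: right_reg_nd.
  move=> x y ax xy yb; have Wr := right_reg_nd Wn.
  rewrite -[leRHS]powRr1 ?subr_ge0; last exact: Wr.
  apply: right_reg_pow => // x' y' ? ? ?; rewrite powRr1 ?subr_ge0.
    exact: hW.
  exact: Wn.
- right; exists (fun x => left_reg a W x + right_reg b W x), al, be.
  have Wl := left_reg_nd Wn; have Wr := right_reg_nd Wn.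
  split=> // [x y ax xy yb|x y ax xy yb|x y ax xy yb].
  + by rewrite lerD ?Wl ?Wr.
  + apply: le_trans (left_reg_pow Gr Wn al0 HG ax xy yb) _.
    have := Wl x y ax xy yb; have := Wr x y ax xy yb => h1 h2.
    apply: ge0_ler_powR; rewrite ?nnegrE ?(ltW al0)//; move: h1 h2; glra.
  + apply: le_trans (right_reg_pow hr Wn be0 Hh ax xy yb) _.
    have := Wl x y ax xy yb; have := Wr x y ax xy yb => h1 h2.
    apply: ge0_ler_powR; rewrite ?nnegrE ?(ltW be0)//; move: h1 h2; glra.
Qed.

End OneSided.

(** * Unconditional sums and products *)

Section Unconditional.
Variable R : realType.
Implicit Types (D : set R) (u v w : R -> R) (A : {fset R}) (M m e : R).
Local Notation totally := (@summability.totally R).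
Local Existing Instance summability.totally_filter.

(** Absolute summability with an explicit bound on the finite sums, from which
    unconditional convergence and all estimates follow. *)
Definition bsum D u M := forall A, (forall x, x \in A -> D x) ->
  \sum_(t <- A) `|u t| <= M.

Lemma big_fset_sub (T : Type) (idx : T) (op : Monoid.com_law idx) (A0 A : {fset R})
    (P : pred R) (F : R -> T) : (A0 `<=` A)%fset ->
  \big[op/idx]_(t <- A | P t) F t =
  op (\big[op/idx]_(t <- A0 | P t) F t)
     (\big[op/idx]_(t <- (A `\` A0)%fset | P t) F t).
Proof.
move=> sub; rewrite -big_cat; apply: perm_big; apply: uniq_perm.
- exact: fset_uniq.
- rewrite cat_uniq !fset_uniq /= andbT; apply/hasPn => x.
  by rewrite in_fsetD => /andP[].
- move=> x; rewrite mem_cat in_fsetD; case: (boolP (x \in A0)) => //= xA0.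
  by rewrite (fsubsetP sub).
Qed.

Lemma near_totally (P : {fset R} -> Prop) :
  (exists A0, forall A, (A0 `<=` A)%fset -> P A) <-> \forall A \near totally, P A.
Proof.
split=> [[A0 h]|[A0 _ h]]; first by exists A0.
by exists A0.
Qed.

Lemma big_restrict (T : Type) (idx : T) (op : Monoid.com_law idx) D A
    (F : R -> T) : exists2 B : {fset R},
  (forall x, (x \in B) = (x \in A) && (x \in D)) &
  \big[op/idx]_(t <- A | t \in D) F t = \big[op/idx]_(t <- B) F t.
Proof.
exists [fset i in A | i \in D]%fset; first by move=> x; rewrite !inE.
exact: big_fset_condE.
Qed.

(** A finite set whose sum nearly attains the supremum leaves little to any
    disjoint set. *)
Lemma bsum_tail D u M : bsum D u M -> forall e, 0 < e -> exists A0,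
  forall A, (forall x, x \in A -> D x) -> [disjoint A & A0]%fset ->
    \sum_(t <- A) `|u t| <= e.
Proof.
move=> h e e0.
pose S : set R := [set x | exists2 A : {fset R},
  (forall x, x \in A -> D x) & x = \sum_(t <- A) `|u t|].
have hS : has_sup S.
  split; first by exists 0, fset0 => //; rewrite big_seq_fset0.
  by exists M => _ [A hA ->]; apply: h.
have [_ [A0 hA0 ->] hs] := sup_adherent e0 hS.
exists A0 => A hA dis.
have : S (\sum_(t <- (A0 `|` A)%fset) `|u t|).
  by exists (A0 `|` A)%fset => // x; rewrite in_fsetU => /orP[/hA0|/hA].
move=> /(ub_le_sup hS.2).
rewrite (big_fset_sub _ _ _ (fsubsetUl A0 A)).
rewrite fsetDUl fsetDv fset0U.
have -> : (A `\` A0 = A)%fset by apply/fsetDidPl.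
rewrite /=; olra.
Qed.

Lemma usum_cvg D u M : bsum D u M ->
  (\sum_(t <- A | t \in D) u t) @[A --> totally] --> uncond_sum D u.
Proof.
move=> h; apply: cvg_of_cauchy => e e0.
have [A0 hA0] := bsum_tail h e0.
exists (\sum_(t <- A0 | t \in D) u t); apply/near_totally; exists A0 => A sub.
rewrite (big_fset_sub _ _ _ sub) /= [X in `|X|]addrAC subrr add0r.
have [B hB ->] := big_restrict +%R D (A `\` A0)%fset u.
apply: (le_trans (ler_norm_sum _ _ _)); apply: hA0.
  by move=> x; rewrite hB => /andP[_ /set_mem].
by apply/fdisjointP => x; rewrite hB in_fsetD => /andP[/andP[]].
Qed.

Lemma usum_near D u M : bsum D u M -> forall e, 0 < e -> exists A0 : {fset R},
  forall A : {fset R}, (A0 `<=` A)%fset ->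
  `|\sum_(t <- A | t \in D) u t - uncond_sum D u| <= e.
Proof.
move=> h e e0; move/cvgrPdist_le: (usum_cvg h) => /(_ e e0)[A0 _ hA0].
by exists A0 => A sub; rewrite distrC; exact: hA0.
Qed.

Lemma bsum_abs_summable D u M : bsum D u M -> abs_summable D u.
Proof.
move=> h; rewrite /abs_summable /summable; apply: (@le_lt_trans _ _ M%:E).
  apply: ge_ereal_sup => _ [A [fA AD] <-].
  rewrite fsbig_finite//= sumEFin lee_fin; apply: h => x.
  by rewrite in_fset_set// => /set_mem/AD.
by rewrite ltry.
Qed.

Lemma usum_le D u M : bsum D u M -> `|uncond_sum D u| <= M.
Proof.
move=> h; have H A : `|\sum_(t <- A | t \in D) u t| <= M.
  have [B hB ->] := big_restrict +%R D A u.
  apply: (le_trans (ler_norm_sum _ _ _)); apply: h => x.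
  by rewrite hB => /andP[_ /set_mem].
rewrite ler_norml; apply/andP; split.
- apply: (cvgr_to_ge (usum_cvg h)); apply/near_totally; exists fset0 => A _.
  by have := H A; rewrite ler_norml => /andP[].
- apply: (cvgr_to_le (usum_cvg h)); apply/near_totally; exists fset0 => A _.
  by have := H A; rewrite ler_norml => /andP[].
Qed.

Lemma usum_ge0 D u M : bsum D u M -> (forall t, 0 <= u t) -> 0 <= uncond_sum D u.
Proof.
move=> h u0; apply: (cvgr_to_ge (usum_cvg h)); apply/near_totally.
by exists fset0 => A _; apply: sumr_ge0.
Qed.

Lemma totally_eq_lim (F G : {fset R} -> R) (l l' : R) :
  F A @[A --> totally] --> l -> G A @[A --> totally] --> l' ->
  (forall A, F A = G A) -> l = l'.
Proof. by move=> h h' /funext E; move: h; rewrite E => h; apply: cvg_unique h h'. Qed.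

Lemma usum_lin D u v w M M' M'' c : bsum D u M -> bsum D v M' -> bsum D w M'' ->
  (forall t, w t = u t + c * v t) ->
  uncond_sum D w = uncond_sum D u + c * uncond_sum D v.
Proof.
move=> hu hv hw wE; apply: (totally_eq_lim (G := fun A =>
  \sum_(t <- A | t \in D) u t + c * \sum_(t <- A | t \in D) v t) (usum_cvg hw)).
  exact: (cvgD (usum_cvg hu) (cvgM (cvg_cst c) (usum_cvg hv))).
by move=> A /=; rewrite mulr_sumr -big_split; apply: eq_bigr.
Qed.

Lemma usum_split D D1 D2 u M M1 M2 : bsum D u M -> bsum D1 u M1 -> bsum D2 u M2 ->
  (forall t, D t <-> D1 t \/ D2 t) -> (forall t, D1 t -> ~ D2 t) ->
  uncond_sum D u = uncond_sum D1 u + uncond_sum D2 u.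
Proof.
move=> h h1 h2 DE dis; apply: (totally_eq_lim (G := fun A =>
  \sum_(t <- A | t \in D1) u t + \sum_(t <- A | t \in D2) u t) (usum_cvg h)).
  exact: (cvgD (usum_cvg h1) (usum_cvg h2)).
move=> A /=; rewrite !(big_mkcond (fun t => t \in _)) -big_split.
apply: eq_bigr => t _ /=; have [Dt|nDt] := pselect (D t).
- rewrite (mem_set Dt); have /DE[D1t|D2t] := Dt.
    by rewrite (mem_set D1t) memNset ?addr0//; exact: dis.
  by rewrite (mem_set D2t) memNset ?add0r// => /dis.
- rewrite !memNset ?addr0// => Dit; apply: nDt; apply/DE; [by right|by left].
Qed.

Lemma usum1 u z : uncond_sum [set z] u = u z.
Proof.
apply: cvg_lim => //; apply/cvgrPdist_le => e e0; apply/near_totally.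
exists [fset z]%fset => A zA; rewrite (_ : \sum_(t <- A | _) _ = u z).
  by rewrite subrr normr0 ltW.
rewrite (big_fset_sub _ _ _ zA) /= [X in X + _]big_mkcond big_seq_fset1 mem_set// [X in _ + X]big1_seq ?addr0//.
by move=> t /andP[/set_mem ->]; rewrite !inE eqxx.
Qed.

Lemma bsum1 u z : bsum [set z] u `|u z|.
Proof.
move=> A hA; have sub : (A `<=` [fset z])%fset.
  by apply/fsubsetP => x /hA ->; rewrite inE.
rewrite -[leRHS](big_seq_fset1 +%R z (fun t => `|u t|)).
by rewrite [leRHS](big_fset_sub _ _ _ sub) /= lerDl sumr_ge0.
Qed.

Lemma bsumU D D1 D2 u M1 M2 : bsum D1 u M1 -> bsum D2 u M2 ->
  (forall t, D t -> D1 t \/ D2 t) -> bsum D u (M1 + M2).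
Proof.
move=> h1 h2 DE A hA; rewrite (bigID (mem D1)) /=.
have [B1 hB1 ->] := big_restrict +%R D1 A (fun t => `|u t|).
rewrite lerD//; first by apply: h1 => x; rewrite hB1 => /andP[_ /set_mem].
rewrite (eq_bigl (fun t => t \in ~` D1)); last by move=> t; rewrite in_setC.
have [B2 hB2 ->] := big_restrict +%R (~` D1) A (fun t => `|u t|).
by apply: h2 => x; rewrite hB2 => /andP[/hA/DE[D1x|//]] /set_mem /(_ D1x).
Qed.

(** By induction from (1 + |w|) exp m <= exp (|w| + m): the deviation of a
    product from its linear part is at most the corresponding remainder of the
    exponential of the sum of the |u t - 1|. *)
Lemma prod_bounds u (l : seq R) : let m := \sum_(t <- l) `|u t - 1| in
  [/\ `|\prod_(t <- l) u t| <= expR m,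
      `|\prod_(t <- l) u t - 1| <= expR m - 1 &
      `|\prod_(t <- l) u t - 1 - \sum_(t <- l) (u t - 1)| <= expR m - 1 - m].
Proof.
elim: l => [|x l] /=.
  by rewrite !big_nil expR0 !subrr ?subr0 normr1 normr0.
rewrite !big_cons; set m := \sum_(t <- l) `|_|.
set P := \prod_(t <- l) _; set S := \sum_(t <- l) (u t - 1) => -[h1 h2 h3].
set w := u x - 1; have uE : u x = 1 + w by rewrite /w; ring.
have m0 : 0 <= m by apply: sumr_ge0.
have em : 1 <= expR m by have := expR_ge1Dx m; olra.
have ew := expR_ge1Dx `|w|; have w0 := normr_ge0 w.
have E : (1 + `|w|) * expR m <= expR (`|w| + m).
  by rewrite expRD ler_wpM2r// expR_ge0.
split.
- rewrite normrM; apply: le_trans E.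
  by apply: ler_pM => //; rewrite uE; have := ler_normD 1 w; rewrite normr1.
- have : `|w * P| <= `|w| * expR m by rewrite normrM ler_wpM2l.
  have -> : u x * P - 1 = w * P + (P - 1) by rewrite uE; ring.
  by have := ler_normD (w * P) (P - 1); nra.
- have : `|w * (P - 1)| <= `|w| * (expR m - 1) by rewrite normrM ler_wpM2l.
  have -> : u x * P - 1 - (w + S) = w * (P - 1) + (P - 1 - S).
    by rewrite uE; ring.
  by have := ler_normD (w * (P - 1)) (P - 1 - S); nra.
Qed.

(** Enlarging a finite set of indices beyond one that exhausts the sum of the
    deviations multiplies the product by a factor close to 1. *)
Lemma uprod_cvg D u M : bsum D (fun t => u t - 1) M ->
  (\prod_(t <- A | t \in D) u t) @[A --> totally] --> uncond_prod D u.
Proof.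
move=> h; apply: cvg_of_cauchy => e e0.
have M0 : 0 <= M by have := h fset0; rewrite big_seq_fset0; apply.
have K0 : 0 < expR M * expR 1 by rewrite mulr_gt0 ?expR_gt0.
pose e1 := Num.min 1 (e / (expR M * expR 1)).
have e10 : 0 < e1 by rewrite lt_min ltr01 divr_gt0.
have [A0 hA0] := bsum_tail h e10.
exists (\prod_(t <- A0 | t \in D) u t); apply/near_totally; exists A0 => A sub.
rewrite (big_fset_sub _ _ _ sub) /=.
have [B hB ->] := big_restrict *%R D (A `\` A0)%fset u.
have [C hC ->] := big_restrict *%R D A0 u.
have hm : \sum_(t <- B) `|u t - 1| <= e1.
  apply: hA0; first by move=> x; rewrite hB => /andP[_ /set_mem].
  by apply/fdisjointP => x; rewrite hB in_fsetD => /andP[/andP[]].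
have hc : \sum_(t <- C) `|u t - 1| <= M.
  by apply: h => x; rewrite hC => /andP[_ /set_mem].
have [_ hB2 _] := prod_bounds u B; have [hC1 _ _] := prod_bounds u C.
set m := \sum_(t <- B) _ in hm hB2.
have m0 : 0 <= m by apply: sumr_ge0.
rewrite -{2}[\prod_(t <- C) _]mulr1 -mulrBr normrM.
have me1 : e1 <= 1 by rewrite ge_min lexx.
have E : expR m - 1 <= m * expR 1.
  have := expR_ge1Dx (- m); rewrite expRN.
  have em := expR_gt0 m; have : expR m <= expR 1 by rewrite ler_expR; olra.
  move=> h1 h2; have : (1 + - m) * expR m <= 1.
    by rewrite -[leRHS](mulVf (lt0r_neq0 em)) ler_wpM2r// ltW.
  by nra.
have -> : e = expR M * (expR 1 * (e / (expR M * expR 1))).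
  by field; rewrite !gt_eqF ?expR_gt0.
apply: ler_pM => //; first by apply: le_trans hC1 _; rewrite ler_expR.
apply: (le_trans hB2); apply: (le_trans E); rewrite mulrC ler_wpM2l ?expR_ge0//.
by apply: le_trans hm _; rewrite ge_min lexx orbT.
Qed.

Lemma expR_rem_mono (m M : R) : 0 <= m -> m <= M ->
  expR m - 1 - m <= expR M - 1 - M.
Proof.
move=> m0 mM; have -> : M = m + (M - m) by ring.
rewrite expRD; have := expR_ge1Dx m; have := expR_ge1Dx (M - m).
set X := expR m; set Y := expR (M - m); nra.
Qed.

Lemma uprod_bounds D u M : bsum D (fun t => u t - 1) M ->
  [/\ `|uncond_prod D u| <= expR M,
      `|uncond_prod D u - 1| <= expR M - 1 &
      `|uncond_prod D u - 1 - uncond_sum D (fun t => u t - 1)| <= expR M - 1 - M].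
Proof.
move=> h; have cp := uprod_cvg h; have cs := usum_cvg h.
have H A : [/\ `|\prod_(t <- A | t \in D) u t| <= expR M,
      `|\prod_(t <- A | t \in D) u t - 1| <= expR M - 1 &
      `|\prod_(t <- A | t \in D) u t - 1 - \sum_(t <- A | t \in D) (u t - 1)|
         <= expR M - 1 - M].
  rewrite (big_fset_condE *%R) (big_fset_condE +%R); set B := [fset i in A | i \in D]%fset.
  have hB : \sum_(t <- B) `|u t - 1| <= M.
    by apply: h => x; rewrite !inE => /andP[_ /set_mem].
  have [h1 h2 h3] := prod_bounds u B.
  have em : expR (\sum_(t <- B) `|u t - 1|) <= expR M by rewrite ler_expR.
  split; [exact: le_trans h1 em|by apply: le_trans h2 _; rewrite lerD2r|].
  by apply: (le_trans h3); apply: expR_rem_mono => //; apply: sumr_ge0.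
have norm_cl (F : {fset R} -> R) (l L : R) : F A @[A --> totally] --> l ->
    (forall A, `|F A| <= L) -> `|l| <= L.
  move=> Fl FL; rewrite ler_norml; apply/andP; split.
  - apply: (cvgr_to_ge Fl); apply/near_totally; exists fset0 => A _.
    by have := FL A; rewrite ler_norml => /andP[].
  - apply: (cvgr_to_le Fl); apply/near_totally; exists fset0 => A _.
    by have := FL A; rewrite ler_norml => /andP[].
split.
- by apply: norm_cl cp _ => A; case: (H A).
- apply: (norm_cl (fun A => \prod_(t <- A | t \in D) u t - 1)).
    exact: cvgB cp (cvg_cst _).
  by move=> A; case: (H A).
- apply: (norm_cl (fun A => \prod_(t <- A | t \in D) u t - 1
                   - \sum_(t <- A | t \in D) (u t - 1))).
    exact: cvgB (cvgB cp (cvg_cst _)) cs.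
  by move=> A; case: (H A).
Qed.

Lemma uprod_split D D1 D2 u M M1 M2 : bsum D (fun t => u t - 1) M ->
  bsum D1 (fun t => u t - 1) M1 -> bsum D2 (fun t => u t - 1) M2 ->
  (forall t, D t <-> D1 t \/ D2 t) -> (forall t, D1 t -> ~ D2 t) ->
  uncond_prod D u = uncond_prod D1 u * uncond_prod D2 u.
Proof.
move=> h h1 h2 DE dis; apply: (totally_eq_lim (G := fun A =>
  \prod_(t <- A | t \in D1) u t * \prod_(t <- A | t \in D2) u t) (uprod_cvg h)).
  exact: (cvgM (uprod_cvg h1) (uprod_cvg h2)).
move=> A /=; rewrite !(big_mkcond (fun t => t \in _)) -big_split.
apply: eq_bigr => t _ /=; have [Dt|nDt] := pselect (D t).
- rewrite (mem_set Dt); have /DE[D1t|D2t] := Dt.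
    by rewrite (mem_set D1t) memNset ?mulr1//; exact: dis.
  by rewrite (mem_set D2t) memNset ?mul1r// => /dis.
- rewrite !memNset ?mulr1// => Dit; apply: nDt; apply/DE; [by right|by left].
Qed.

Lemma uprod1 u z : uncond_prod [set z] u = u z.
Proof.
apply: cvg_lim => //; apply/cvgrPdist_le => e e0; apply/near_totally.
exists [fset z]%fset => A zA; rewrite (_ : \prod_(t <- A | _) _ = u z).
  by rewrite subrr normr0 ltW.
rewrite (big_fset_sub _ _ _ zA) /= [X in X * _]big_mkcond big_seq_fset1 mem_set// [X in _ * X]big1_seq ?mulr1//.
by move=> t /andP[/set_mem ->]; rewrite !inE eqxx.
Qed.

Lemma fset_sorted A : exists2 l : seq R, sorted <%R l &
  (l =i A) /\ forall F : R -> R, \sum_(t <- A) F t = \sum_(t <- l) F t.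
Proof.
exists (sort <=%R A); first by rewrite sort_lt_sorted fset_uniq.
by split=> [x|F]; [rewrite mem_sort|apply: perm_big; rewrite perm_sym perm_sort].
Qed.

(** If the points are listed in increasing order, the jump at a point is
    bounded by the increment of [V] since the previous point, and these
    increments telescope. *)
Lemma sum_jumps_left (x y : R) j V A : nondec x y V ->
  (forall s z, x <= s -> s < z -> z <= y -> j z <= V z - V s) ->
  (forall z, z \in A -> x < z <= y) -> x <= y ->
  \sum_(t <- A) j t <= V y - V x.
Proof.
move=> Vn jV hA; have [l sl [lA ->]] := fset_sorted A.
have {lA}hl z : z \in l -> x < z <= y by rewrite lA; exact: hA.
have pl : path <%R x l.
  by rewrite lt_path_sortedE sl andbT; apply/allP => z /hl/andP[].
elim: l x pl {sl hA} Vn jV hl => [|z l IH] x /=.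
  by move=> _ Vn _ _ xy; rewrite big_nil subr_ge0; apply: Vn.
move=> /andP[xz pl] Vn jV hl xy; rewrite big_cons.
have zy : z <= y by have /andP[] := hl z (mem_head _ _).
have : \sum_(t <- l) j t <= V y - V z.
  apply: IH => // [u v zu|s u zs|u ul]; first by apply: Vn; olra.
    by apply: jV; olra.
  rewrite (path_sorted_lt pl ul) /=.
  by have /andP[] : x < u <= y by apply: hl; rewrite inE ul orbT.
by have := jV x z (lexx x) xz zy; olra.
Qed.

Lemma sum_jumps_right (x y : R) j V A : nondec x y V ->
  (forall z t, x <= z -> z < t -> t <= y -> j z <= V t - V z) ->
  (forall z, z \in A -> x <= z < y) -> x <= y ->
  \sum_(t <- A) j t <= V y - V x.
Proof.
move=> Vn jV hA; have [l sl [lA ->]] := fset_sorted A.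
have {lA}hl z : z \in l -> x <= z < y by rewrite lA; exact: hA.
elim: l x sl {hA} Vn jV hl => [|z l IH] x /=.
  by move=> _ Vn _ _ xy; rewrite big_nil subr_ge0; apply: Vn.
move=> pl Vn jV hl xy; rewrite big_cons.
have /andP[xz zy] := hl z (mem_head _ _).
have Vxz : V x <= V z by apply: Vn => //; olra.
case: l IH pl hl => [|z' l] IH pl hl.
  by rewrite big_nil; have := jV z y xz zy (lexx y); olra.
have z'y : x <= z' < y by apply: hl; rewrite !inE eqxx orbT.
have zz' : z < z' by case/andP: pl.
have : \sum_(t <- z' :: l) j t <= V y - V z'.
  apply: IH => // [|u v zu|s u zs|u ul|]; [by case/andP: pl|..|olra].
  - by apply: Vn; olra.
  - by apply: jV; olra.
  - have /andP[_ ->] : x <= u < y by apply: hl; rewrite inE ul orbT.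
    rewrite andbT; have /andP[_ pl'] := pl.
    by have /andP[] := path_le_mem pl' ul.
by have := jV z z' xz zz' ltac:(olra); olra.
Qed.

(** Here the bound on the jump needs room on both sides, which the midpoints
    between successive points provide. *)
Lemma sum_jumps_open (x y : R) j V A : nondec x y V ->
  (forall s z t, x < s -> s < z -> z < t -> t < y -> j z <= V t - V s) ->
  (forall z, z \in A -> x < z < y) -> x <= y ->
  \sum_(t <- A) j t <= V y - V x.
Proof.
move=> Vn jV hA; have [l sl [lA ->]] := fset_sorted A.
have {lA}hl z : z \in l -> x < z < y by rewrite lA; exact: hA.
elim: l x sl {hA} Vn jV hl => [|z l IH] x /=.
  by move=> _ Vn _ _ xy; rewrite big_nil subr_ge0; apply: Vn.
move=> pl Vn jV hl xy; rewrite big_cons.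
have /andP[xz zy] := hl z (mem_head _ _).
pose c := if l is z' :: _ then (z + z') / 2 else (z + y) / 2.
have [zc cy] : z < c /\ c < y.
  rewrite /c; clear c; case: l pl hl {IH} => [|z' l] /=; first by olra.
  by move=> /andP[zz' _] hl; have := hl z' ltac:(rewrite !inE eqxx orbT //); olra.
have cl (u : R) : u \in l -> c < u.
  rewrite /c; clear c zc cy; case: l pl hl {IH} => [|z' l] //= /andP[zz' pl] hl ul.
  by have /andP[] := path_le_mem pl ul; olra.
have : \sum_(t <- l) j t <= V y - V c.
  apply: (IH c (path_sorted pl) _ _ _ (ltW cy)).
  - by move=> u v ? ? ?; apply: Vn; olra.
  - by move=> s u t ? ? ? ?; apply: jV; olra.
  - move=> u ul; have /andP[_ ->] : x < u < y by apply: hl; rewrite inE ul orbT.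
    by rewrite cl.
have := jV ((x + z) / 2) z c ltac:(olra) ltac:(olra) zc cy.
by have := Vn x ((x + z) / 2) (lexx x) ltac:(olra) ltac:(olra); olra.
Qed.

End Unconditional.

(** * Limits of left sums *)

Section YoungIntegral.
Variables (R : realType) (a b : R) (lambda : nat -> seq R).
Hypothesis ab : a < b.
Hypothesis lamP : in_Lambda a b lambda.
Local Notation lsum := (lsum lambda).
Local Notation ulam := (ulam a lambda).

Lemma locally_good_restrict (P : R -> R -> Prop) u v : a <= u -> v <= b ->
  locally_good a b P -> locally_good u v P.
Proof.
move=> au vb h z /andP[uz zv]; have [d d0 [hl hr]] := h z ltac:(olra).
by exists d => //; split=> s t ? ? ? ?; [apply: hl|apply: hr] => //; olra.
Qed.

(** Continuity of the three-variable function u (w - v), which describes the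
    end terms of sums over short intervals. *)
Lemma corner (L1 L2 L3 e : R) : 0 < e -> exists2 d, 0 < d & forall u v w,
  `|u - L1| <= d -> `|v - L2| <= d -> `|w - L3| <= d ->
  `|u * (w - v) - L1 * (L3 - L2)| <= e.
Proof.
move=> e0; have n1 := normr_ge0 L1; have n2 := normr_ge0 L2.
have n3 := normr_ge0 L3.
pose S := `|L2| + `|L3| + 2 * `|L1| + 2.
have S0 : 0 < S by rewrite /S; olra.
have d0 : 0 < Num.min 1 (e / S) by rewrite lt_min ltr01 divr_gt0.
exists (Num.min 1 (e / S)) => // u v w.
have m1 : Num.min 1 (e / S) <= 1 by rewrite ge_min lexx.
have m2 : Num.min 1 (e / S) * S <= e.
  by rewrite -ler_pdivlMr// ge_min lexx orbT.
set d := Num.min 1 _ in d0 m1 m2 *; move=> hu hv hw.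
have -> : u * (w - v) - L1 * (L3 - L2) =
   (u - L1) * (w - v) + L1 * ((w - L3) - (v - L2)) by ring.
have h1 : `|w - v| <= `|L2| + `|L3| + 2.
  have -> : w - v = (w - L3) - (v - L2) + L3 - L2 by ring.
  have := ler_normB (w - L3 - (v - L2) + L3) L2.
  have := ler_normD (w - L3 - (v - L2)) L3.
  have := ler_normB (w - L3) (v - L2); olra.
have h2 : `|(w - L3) - (v - L2)| <= 2 * d.
  by have := ler_normB (w - L3) (v - L2); olra.
apply: (le_trans (ler_normD _ _)); apply: le_trans m2.
rewrite !normrM.
have := ler_pM (normr_ge0 _) (normr_ge0 _) hu h1.
have := ler_wpM2l n1 h2; rewrite /S; nra.
Qed.

Lemma left_reg_left G z : flat_reg a b G -> a < z <= b ->
  left_reg a G x @[x --> z^'-] --> left_lim G z.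
Proof.
move=> Gr zab; apply/cvg_leftP => e e0.
have /cvg_leftP/(_ _ e0)[d d0 hd] := regulated_left Gr zab.
have m1 : Num.max a (z - d) < z by rewrite gt_max; olra.
have m2 : a <= Num.max a (z - d) by rewrite le_max lexx.
have m3 : z - d <= Num.max a (z - d) by rewrite le_max lexx orbT.
exists (z - Num.max a (z - d)) => [|x xz]; first olra.
rewrite /left_reg gt_eqF; last olra.
have mx : Num.max a (z - d) < x by olra.
apply: (left_lim_dist mx (regulated_left Gr _)) => [|y yx]; first olra.
by apply: hd; olra.
Qed.

Lemma left_reg_right G z : flat_reg a b G -> a <= z < b ->
  left_reg a G x @[x --> z^'+] --> right_lim G z.
Proof.
move=> Gr zab; apply/cvg_rightP => e e0.
have /cvg_rightP/(_ _ e0)[d d0 hd] := regulated_right Gr zab.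
have m1 : z < Num.min b (z + d) by rewrite lt_min; olra.
have m2 : Num.min b (z + d) <= b by rewrite ge_min lexx.
have m3 : Num.min b (z + d) <= z + d by rewrite ge_min lexx orbT.
exists (Num.min b (z + d) - z) => [|x xz]; first olra.
rewrite /left_reg gt_eqF; last olra.
have mx : z < x by olra.
apply: (left_lim_dist mx (regulated_left Gr _)) => [|y yx]; first olra.
by apply: hd; olra.
Qed.

Lemma right_reg_left G z : flat_reg a b G -> a < z <= b ->
  right_reg b G x @[x --> z^'-] --> left_lim G z.
Proof.
move=> Gr zab; apply/cvg_leftP => e e0.
have /cvg_leftP/(_ _ e0)[d d0 hd] := regulated_left Gr zab.
have m1 : Num.max a (z - d) < z by rewrite gt_max; olra.
have m2 : a <= Num.max a (z - d) by rewrite le_max lexx.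
have m3 : z - d <= Num.max a (z - d) by rewrite le_max lexx orbT.
exists (z - Num.max a (z - d)) => [|x xz]; first olra.
rewrite /right_reg lt_eqF; last olra.
have mx : x < z by olra.
apply: (right_lim_dist mx (regulated_right Gr _)) => [|y yx]; first olra.
by apply: hd; olra.
Qed.

Lemma right_reg_right G z : flat_reg a b G -> a <= z < b ->
  right_reg b G x @[x --> z^'+] --> right_lim G z.
Proof.
move=> Gr zab; apply/cvg_rightP => e e0.
have /cvg_rightP/(_ _ e0)[d d0 hd] := regulated_right Gr zab.
have m1 : z < Num.min b (z + d) by rewrite lt_min; olra.
have m2 : Num.min b (z + d) <= b by rewrite ge_min lexx.
have m3 : Num.min b (z + d) <= z + d by rewrite ge_min lexx orbT.
exists (Num.min b (z + d) - z) => [|x xz]; first olra.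
rewrite /right_reg lt_eqF; last olra.
have mx : x < Num.min b (z + d) by olra.
apply: (right_lim_dist mx (regulated_right Gr _)) => [|y yx]; first olra.
by apply: hd; olra.
Qed.

Lemma left_cvg_jump f z : flat_reg a b f -> a < z <= b ->
  (f z - f x) @[x --> z^'-] --> left_jump f z.
Proof. by move=> fr zab; apply: cvgB; [exact: cvg_cst|exact: regulated_left fr zab]. Qed.

Lemma right_cvg_jump f z : flat_reg a b f -> a <= z < b ->
  (f x - f z) @[x --> z^'+] --> right_jump f z.
Proof.
by move=> fr zab; apply: cvgB; [apply: regulated_right fr _|exact: cvg_cst].
Qed.

(** The product of the jumps at [z] is a limit of the difference between a sum
    with two terms around [z] and the one-term sum, hence a small multiple of
    an increment of the control. *)
Lemma young_jumps_bound G h W : flat_reg a b G -> flat_reg a b h -> nondec a b W ->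
  young a b W G h -> forall e : R, 0 < e -> locally_good a b (fun s t =>
   bsum `]s, t[%classic (fun x => left_jump G x * right_jump h x)
      (e * (W t - W s))).
Proof.
move=> Gr hr Wn Y e e0; apply: locally_good_sub (Y e e0) _ => s t as_ st tb H A hA.
have -> : e * (W t - W s) = e * W t - e * W s by ring.
apply: (sum_jumps_open (V := fun x => e * W x)); last olra.
- by move=> x y sx xy yt; rewrite ler_wpM2l ?(ltW e0)//; apply: Wn; olra.
- move=> x z y sx xz zy yt; rewrite -mulrBr -[left_jump G z * _]subr0.
  have B x' y' : x < x' < z -> z < y' < y ->
      `|(G z - G x') * (h y' - h z)| <= e * (W y - W x).
    move=> x'x y'y.
    have := H x' [:: z; y'] (fun u v => u) ltac:(olra).
    rewrite /= /rsum_term addr0 => /(_ ltac:(olra) ltac:(olra)).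
    move=> /(_ (fun u v uv => ltac:(by rewrite lexx uv))).
    rewrite (_ : _ - _ = (G z - G x') * (h y' - h z)); last ring.
    move=> /le_trans; apply; rewrite ler_wpM2l ?(ltW e0)//.
    have := Wn y' y ltac:(olra) ltac:(olra) ltac:(olra).
    have := Wn x x' ltac:(olra) ltac:(olra) ltac:(olra); olra.
  apply: (right_lim_dist (f := fun y' => left_jump G z * (h y' - h z)) zy).
    by apply: cvgM; [exact: cvg_cst|apply: right_cvg_jump hr _; olra].
  move=> y' zy'.
  apply: (left_lim_dist (f := fun x' => (G z - G x') * (h y' - h z)) xz).
    by apply: cvgM; [apply: left_cvg_jump Gr _; olra|exact: cvg_cst].
  by move=> x' x'z; rewrite subr0; apply: B.
- by move=> z /hA; rewrite /= in_itv /=.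
Qed.

Section Integral.
Variables G h : R -> R.
Hypothesis GhY : ypair a b G h.
Hypothesis hjump : forall z, a < z < b -> ~ ulam z -> right_jump h z = 0.

Let K x y := G x * (h y - h x).

(** Splitting the interval from [p] to [n] at [z] changes the left sum by a
    multiple of [h n - h z], which is small if [h] has no right jump at
    [z]. *)
Lemma left_sum_asym : asym_add a b lambda K.
Proof.
case: (GhY) => Gr hr _; have [M M0 GM] := flat_reg_bounded ab Gr.
move=> z zab uz e e0; have e1 : 0 < e / (2 * M) by apply: divr_gt0 => //; olra.
have := right_cvg_jump hr (z := z) ltac:(olra); rewrite hjump//.
move=> /cvg_rightP/(_ _ e1)[d d0 hd]; exists d => // p n ap nb pz zn.
rewrite (_ : _ - _ = (G p - G z) * (h n - h z)); last by rewrite /K; ring.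
have := hd n zn; rewrite subr0 => h1.
have -> : e = (2 * M) * (e / (2 * M)) by field; olra.
rewrite normrM ler_pM//.
have := GM p ltac:(olra); have := GM z ltac:(olra).
by rewrite !ler_norml; olra.
Qed.

Lemma left_sum_cvgl z : a < z <= b ->
  K x z @[x --> z^'-] --> left_lim G z * left_jump h z.
Proof.
case: (GhY) => Gr hr _ zab; apply: cvgM; first exact: regulated_left Gr zab.
exact: left_cvg_jump.
Qed.

Lemma left_sum_cvgr z : a <= z < b ->
  K z y @[y --> z^'+] --> G z * right_jump h z.
Proof.
case: (GhY) => Gr hr _ zab; apply: cvgM; first exact: cvg_cst.
exact: right_cvg_jump.
Qed.

(** The limits of the two end terms of a left sum over [[s, t]], and the
    one-term sum for the interior. *)
Definition short_value s t :=
  G s * right_jump h s + right_lim G s * (left_lim h t - right_lim h s)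
  + left_lim G t * left_jump h t.

Lemma left_tag : tag (fun u v : R => u).
Proof. by move=> u v uv; rewrite lexx. Qed.

Lemma left_sum_local W : nondec a b W -> young a b W G h ->
  forall e : R, 0 < e -> locally_good a b (fun s t => forall e', 0 < e' ->
     \forall m \near \oo, `|lsum K s t m - short_value s t| <= e * (W t - W s) + e').
Proof.
move=> Wn Y e e0; case: (GhY) => Gr hr _.
apply: locally_good_sub (Y e e0) _ => s t as_ st tb H e' e'0.
have e2 : 0 < e' / 2 by olra.
have [d d0 hd] := corner (right_lim G s) (right_lim h s) (left_lim h t) e2.
have /cvg_rightP/(_ _ d0)[d1 d10 h1] := regulated_right Gr (z := s) ltac:(olra).
have /cvg_rightP/(_ _ d0)[d2 d20 h2] := regulated_right hr (z := s) ltac:(olra).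
have /cvg_leftP/(_ _ d0)[d3 d30 h3] := regulated_left hr (z := t) ltac:(olra).
have c1 : s < Num.min (s + d1) (s + d2) by rewrite lt_min; olra.
have c2 : t - d3 < t by olra.
have := lsum_ends lamP as_ st tb (@left_sum_cvgr s ltac:(olra))
  (@left_sum_cvgl t ltac:(olra)) e2 c1 c2.
apply: filterS => m [x1 [l [E]]]; rewrite lt_min => /andP[sx1 /andP[x1a x1b]] lt pl hm.
have xl := path_le_last pl.
have := hd (G x1) (h x1) (h (last x1 l)) (h1 x1 ltac:(olra))
  (h2 x1 ltac:(olra)) (h3 (last x1 l) ltac:(olra)).
have h4 : `|psum K x1 l - G x1 * (h (last x1 l) - h x1)|
    <= e * (W (last x1 l) - W x1) := H x1 l _ sx1 pl ltac:(olra) left_tag.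
move=> h5.
have : e * (W (last x1 l) - W x1) <= e * (W t - W s).
  rewrite ler_wpM2l ?(ltW e0)//.
  have := Wn s x1 ltac:(olra) ltac:(olra) ltac:(olra).
  have := Wn (last x1 l) t ltac:(olra) ltac:(olra) ltac:(olra); olra.
move: hm h4 h5; rewrite /short_value; set P := psum K x1 l; rewrite !ler_norml; olra.
Qed.

Lemma left_sum_small : forall e : R, 0 < e -> locally_good a b (fun s t =>
  forall x l, s < x -> path <%R x l -> last x l < t -> `|psum K x l| <= e).
Proof.
move=> e e0; have [W Wn Y] := ypair_young GhY; case: (GhY) => Gr hr _.
have [M M0 GM] := flat_reg_bounded ab Gr.
have Wab : W a <= W b by apply: Wn; rewrite ?(ltW ab).
have e1 : 0 < e / (2 * (W b - W a + 1)) by apply: divr_gt0 => //; olra.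
have e2 : 0 < e / (2 * M) by apply: divr_gt0 => //; olra.
apply: locally_good_sub (locally_goodI (Y _ e1) (hr _ e2)) _.
move=> s t as_ st tb [H fl] x l sx pl lt; have xl := path_le_last pl.
have h1 : `|psum K x l - G x * (h (last x l) - h x)|
    <= e / (2 * (W b - W a + 1)) * (W (last x l) - W x)
  := H x l _ sx pl lt left_tag.
have h2 : `|G x * (h (last x l) - h x)| <= e / 2.
  have -> : e / 2 = M * (e / (2 * M)) by field; olra.
  by rewrite normrM ler_pM//; [apply: GM; olra|apply: fl; olra].
have h3 : e / (2 * (W b - W a + 1)) * (W (last x l) - W x) <= e / 2.
  have -> : e / 2 = e / (2 * (W b - W a + 1)) * (W b - W a + 1).
    by field; olra.
  rewrite ler_wpM2l ?(ltW e1)//.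
  have := Wn a x ltac:(olra) ltac:(olra) ltac:(olra).
  have := Wn (last x l) b ltac:(olra) ltac:(olra) ltac:(olra); olra.
by move: h1 h2; rewrite !ler_norml; olra.
Qed.

(** On short intervals the sums are close to [short_value], so [lsum_sew]
    applies. *)
Lemma left_sum_lim : exists Phi : R -> R, [/\ Phi a = 0,
  forall s t, a <= s -> s < t -> t <= b -> lsum K s t @ \oo --> Phi t - Phi s,
  forall z, a < z <= b ->
    Phi x @[x --> z^'-] --> Phi z - left_lim G z * left_jump h z &
  forall z, a <= z < b ->
    Phi y @[y --> z^'+] --> Phi z + G z * right_jump h z].
Proof.
have [W Wn Y] := ypair_young GhY.
have [|Phi [Pa P]] := lsum_sew lamP (V := W) left_sum_asym.
  move=> e e0; apply: locally_good_sub (left_sum_local Wn Y e0) _.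
  by move=> s t _ _ _ H; exists (short_value s t).
have [Pl Pr] := lsum_jumps lamP P left_sum_cvgl left_sum_cvgr left_sum_small.
by exists Phi.
Qed.

End Integral.

End YoungIntegral.

(** * Left sums and the Left Young integral *)

Section RRS.
Variables (R : realType) (a b : R).
Hypothesis ab : a < b.
Variables (G h W W' Phi : R -> R) (u v : R).
Hypotheses (au : a <= u) (uv : u < v) (vb : v <= b).
Hypotheses (Gr : flat_reg a b G) (hr : flat_reg a b h).
Hypotheses (Wn : nondec a b W) (Wn' : nondec a b W').
Hypothesis YW : young a b W G h.
Hypothesis YW' : young a b W' (left_reg a G) (right_reg b h).
Hypothesis short : forall e : R, 0 < e -> locally_good a b (fun s t =>
  `|Phi t - Phi s - short_value G h s t| <= e * (W t - W s)).

Lemma right_nearI (P Q : R -> Prop) z :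
  (exists2 d, 0 < d & forall x, z < x < z + d -> P x) ->
  (exists2 d, 0 < d & forall x, z < x < z + d -> Q x) ->
  exists2 d, 0 < d & forall x, z < x < z + d -> P x /\ Q x.
Proof.
move=> [d d0 Pd] [d' d'0 Qd]; exists (Num.min d d'); first by rewrite lt_min d0.
have m1 : Num.min d d' <= d by rewrite ge_min lexx.
have m2 : Num.min d d' <= d' by rewrite ge_min lexx orbT.
by move=> x zx; split; [apply: Pd|apply: Qd]; olra.
Qed.

Lemma left_nearI (P Q : R -> Prop) z :
  (exists2 d, 0 < d & forall x, z - d < x < z -> P x) ->
  (exists2 d, 0 < d & forall x, z - d < x < z -> Q x) ->
  exists2 d, 0 < d & forall x, z - d < x < z -> P x /\ Q x.
Proof.
move=> [d d0 Pd] [d' d'0 Qd]; exists (Num.min d d'); first by rewrite lt_min d0.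
have m1 : Num.min d d' <= d by rewrite ge_min lexx.
have m2 : Num.min d d' <= d' by rewrite ge_min lexx orbT.
by move=> x zx; split; [apply: Pd|apply: Qd]; olra.
Qed.

(** Forcing these two points into a partition makes its first and last
    intervals short. *)
Lemma third_points (s t r q q' : R) : 0 < r -> r <= q -> r <= q' -> r <= t - s ->
  [/\ [/\ s < s + r / 3, s + r / 3 < t - r / 3 & t - r / 3 < t],
     s + r / 3 < s + q & t - q' < t - r / 3].
Proof. by move=> r0 rq rq' rt; split; [split|..]; olra. Qed.

Lemma interior_split (s t x y : R) k : itv_partition s t k -> x \in k ->
  y \in k -> x < t -> y < t -> exists x1 l,
  [/\ k = x1 :: rcons l t, s < x1 <= x, y <= last x1 l < t & path <%R x1 l].
Proof.
move=> [pk /eqP lk]; case: k pk lk => [//|x1 k] /=.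
case/lastP: k => [|l t'] /=.
  by rewrite !inE => _ -> /eqP -> _; rewrite ltxx.
rewrite last_rcons rcons_path => /and3P[sx1 pl lt'] t't; subst t'.
rewrite -!rcons_cons !mem_rcons ![_ \in t :: _]inE.
move=> xk yk xt yt.
have {}xk : x \in x1 :: l by case/orP: xk => // /eqP E; olra.
have {}yk : y \in x1 :: l by case/orP: yk => // /eqP E; olra.
exists x1, l; have /andP[x1x _] := path_le_mem pl xk.
by have /andP[_ yl] := path_le_mem pl yk; split=> //; rewrite ?sx1 ?yl.
Qed.

Let Gt := left_reg u G.
Let ht := right_reg v h.
Let jump2 x := left_jump G x * right_jump h x.
(* The sum of jump products runs over the open interval, so [v] is
   excluded. *)
Let jj y := if y == v then 0 else jump2 y.
(* The regularized [h] takes its right limit at [s], except at [v]; this is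
   the term lost between [h s] and that limit. *)
Let dd s := if s == v then 0 else G s * right_jump h s.

(** The Left Young integral is a Riemann-Stieltjes integral of regularized
    functions plus the sum of the products of a left and a right jump. The
    product at the right end of an interval is attached to its
    Riemann-Stieltjes term. *)
Definition corrected_term tau x y := rsum_term Gt ht tau x y + jj y.

Lemma GtE x : u < x -> Gt x = left_reg a G x.
Proof.
have [au' uv' vb' ab'] := And4 au uv vb ab.
by move=> ux; rewrite /Gt /left_reg !gt_eqF//; olra. Qed.

Lemma htE x : x < v -> ht x = right_reg b h x.
Proof.
have [au' uv' vb' ab'] := And4 au uv vb ab.
by move=> ux; rewrite /ht /right_reg !lt_eqF//; olra. Qed.

Lemma Gt_bounded : exists2 M, 0 < M & forall x, u <= x <= v -> `|Gt x| <= M.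
Proof.
have [au' uv' vb' ab'] := And4 au uv vb ab.
have [M M0 GM] := flat_reg_bounded ab Gr; exists M => // x uxv.
rewrite /Gt /left_reg; case: eqP => [_|/eqP xu]; first by apply: GM; olra.
have ux : u < x by rewrite lt_neqAle eq_sym xu; case/andP: uxv.
rewrite -[left_lim G x]subr0.
apply: (left_lim_dist ux (regulated_left Gr _)); first olra.
by move=> y yx; rewrite subr0; apply: GM; olra.
Qed.

Lemma psum_snd (F : R -> R) x l : psum (fun _ y => F y) x l = \sum_(y <- l) F y.
Proof. by elim: l x => [|y l IH] x /=; rewrite ?big_nil// big_cons IH. Qed.

Lemma bsum_list (D : set R) F M (l : seq R) : bsum D F M -> uniq l ->
  (forall x, x \in l -> D x) -> `|\sum_(y <- l) F y| <= M.
Proof.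
move=> h0 ul hl; apply: (le_trans (ler_norm_sum _ _ _)).
rewrite (perm_big (enum_fset [fset x in l]%fset)) /=.
  by apply: h0 => x; rewrite inE; exact: hl.
by apply: uniq_perm => // x; rewrite inE.
Qed.

(** With partition points close to [s] and [t], the first and last terms are
    close to their limits, and the inner sum is close to a one-term sum. The
    result is [short_value], up to the right jumps of [h] at the ends. *)
Lemma rrs_local (e : R) : 0 < e -> locally_good u v (fun s t =>
  forall eta : R, 0 < eta -> exists2 tau0, itv_partition s t tau0 &
  forall k tau, itv_partition s t k -> {subset tau0 <= k} -> tag tau ->
  `|psum (corrected_term tau) s k + dd s - dd t - (Phi t - Phi s)|
     <= e * (2 * (W t - W s) + (W' t - W' s)) + eta).
Proof.
have [au' uv' vb' ab'] := And4 au uv vb ab.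
move=> e0; have := locally_goodI (YW' e0) (young_jumps_bound Gr hr Wn YW e0).
move=> /(locally_goodI (short e0))/(locally_good_restrict au vb) H.
apply: locally_good_sub H _ => s t us st tv [HP [HY HJ]] eta eta0.
have [M M0 GM] := Gt_bounded.
have e4 : 0 < eta / 4 by olra.
have [d1 d10 C1] := corner (right_lim G s) (right_lim h s) (left_lim h t) e4.
have [d3 d30 C3] := corner (left_lim G t) (left_lim h t) (ht t) e4.
have e4M : 0 < eta / (4 * M) by apply: divr_gt0 => //; olra.
have sab : a <= s < b by olra.
have tab : a < t <= b by olra.
have /cvg_rightP/(_ _ d10) R1 := left_reg_right Gr sab.
have /cvg_rightP/(_ _ d10) R2 := right_reg_right hr sab.
have /cvg_rightP/(_ _ e4M) R3 := right_reg_right hr sab.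
have /cvg_leftP/(_ _ d10) R4 := right_reg_left hr tab.
have /cvg_leftP/(_ _ d30) R5 := right_reg_left hr tab.
have /cvg_leftP/(_ _ d30) R6 := left_reg_left Gr tab.
have [q q0 Rq] := right_nearI R1 (right_nearI R2 R3).
have [q' q'0 Lq] := left_nearI R4 (left_nearI R5 R6).
clear R1 R2 R3 R4 R5 R6.
pose r := Num.min (Num.min q q') (t - s).
have r0 : 0 < r by rewrite !lt_min q0 q'0 subr_gt0.
have [rq rq' rt] : [/\ r <= q, r <= q' & r <= t - s].
  by rewrite /r !ge_min !lexx !orbT.
clearbody r.
have [[b1 b2 b3] b4 b5] := third_points r0 rq rq' rt.
clear r0 rq rq' rt q0 q'0.
exists [:: s + r / 3; t - r / 3; t].
  by split; rewrite /= ?b1 ?b2 ?b3.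
move=> k tau kp sub tg.
have k1 : s + r / 3 \in k by apply: sub; rewrite !inE eqxx.
have k2 : t - r / 3 \in k by apply: sub; rewrite !inE eqxx orbT.
have [x1 [l [E /andP[sx1 x1q] /andP[qy1 lt] pl]]] :=
  interior_split kp k1 k2 (lt_trans b2 b3) b3.
have xl := path_le_last pl.
set y1 := last x1 l in lt xl qy1 *.
have [Rx1 [Rx2 Rx3]] : _ := Rq x1 (introT andP (conj sx1 (le_lt_trans x1q b4))).
have qy1' := lt_le_trans b5 qy1.
have [Ly1 [Ly2 Ly3]] := Lq y1 (introT andP (conj qy1' lt)).
have Lq' y : y1 <= y -> y < t -> `|left_reg a G y - left_lim G t| <= d3.
  move=> y1y yt; have [|_ []//] := Lq y _.
  by rewrite yt (lt_le_trans qy1' y1y).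
clear Rq Lq b1 b2 b3 b4 b5 k1 k2 sub qy1 qy1' x1q q q'.
have x1t := le_lt_trans xl lt; have sy1 := lt_le_trans sx1 xl.
have ux1 := le_lt_trans us sx1; have uy1 := le_lt_trans us sy1.
have x1v := lt_le_trans x1t tv; have y1v := lt_le_trans lt tv.
have sv := lt_le_trans st tv; have at' := le_lt_trans (le_trans au us) st.
have Ex1 : ht x1 = right_reg b h x1 by exact: htE.
have Ey1 : ht y1 = right_reg b h y1 by exact: htE.
have Es : ht s = right_lim h s by rewrite /ht /right_reg lt_eqF.
have /andP[tag1 tag1'] := tg s x1 (ltW sx1).
have /andP[tag3 tag3'] := tg y1 t (ltW lt).
have A1 : `|Gt (tau s x1) * (ht x1 - ht s)| <= eta / 4.
  have -> : eta / 4 = M * (eta / (4 * M)) by field; rewrite lt0r_neq0.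
  rewrite normrM ler_pM//.
    by apply: GM; rewrite (le_trans us tag1) (le_trans tag1' (ltW x1v)).
  by rewrite Ex1 Es.
have A2 : `|left_reg a G x1 * (right_reg b h y1 - right_reg b h x1)
   - right_lim G s * (left_lim h t - right_lim h s)| <= eta / 4.
  exact: (C1 _ _ _ Rx1 Rx2 Ly1).
have A3 : `|Gt (tau y1 t) * (ht t - ht y1)
   - left_lim G t * (ht t - left_lim h t)| <= eta / 4.
  apply: C3; last by rewrite subrr normr0 ltW.
  - rewrite GtE; last exact: lt_le_trans uy1 tag3.
    have [->|tt] := eqVneq (tau y1 t) t.
      by rewrite /left_reg gt_eqF// subrr normr0 ltW.
    by apply: Lq'; rewrite // lt_neqAle tt.
  - by rewrite Ey1.
clear C1 C3 Rx1 Rx2 Rx3 Ly1 Ly2 Ly3 Lq' d10 d30 e4M.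
have lst : uniq (x1 :: l).
  by apply: (sorted_uniq lt_trans ltxx).
have ly y : y \in x1 :: l -> s < y < t.
  move=> yl; have /andP[xy yy1] := path_le_mem pl yl.
  by rewrite (lt_le_trans sx1 xy) (le_lt_trans yy1 lt).
have A4 : `|\sum_(y <- x1 :: l) jj y| <= e * (W t - W s).
  rewrite (eq_big_seq jump2); last first.
    move=> y /ly/andP[_ yt]; rewrite /jj lt_eqF//; exact: lt_le_trans yt tv.
  by apply: bsum_list HJ lst _ => y yl; rewrite /= in_itv /= ly.
have A5 := HY x1 l tau sx1 pl lt tg.
rewrite -/y1 in A5.
have E5 : psum (rsum_term (left_reg a G) (right_reg b h) tau) x1 l =
          psum (rsum_term Gt ht tau) x1 l.
  apply: eq_psum => // x y x1x xy; rewrite -/y1 => yy1.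
  have /andP[t1 t2] := tg x y (ltW xy).
  rewrite /rsum_term GtE ?htE//.
  - exact: lt_trans xy (le_lt_trans yy1 y1v).
  - exact: le_lt_trans yy1 y1v.
  - exact: lt_le_trans ux1 (le_trans x1x t1).
have A6 : e * (W' y1 - W' x1) <= e * (W' t - W' s).
  rewrite ler_wpM2l ?(ltW e0)// lerB//.
    by apply: Wn'; [exact: le_trans au (ltW uy1)|exact: ltW|exact: le_trans tv vb].
  by apply: Wn'; [exact: le_trans au us|exact: ltW|exact: le_trans (ltW x1v) vb].
(* The regularized [h] jumps at [t] by its left and right jumps together,
   unless [t = v]. *)
have A7 : left_lim G t * (ht t - left_lim h t) + jj t - dd t =
          left_lim G t * left_jump h t.
  rewrite /jj /dd /ht /right_reg; case: eqP => [->|_].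
    by rewrite /left_jump; ring.
  by rewrite /jump2 /left_jump /right_jump; ring.
have A8 : dd s = G s * right_jump h s by rewrite /dd lt_eqF.
have -> : psum (corrected_term tau) s k =
   Gt (tau s x1) * (ht x1 - ht s) + psum (rsum_term Gt ht tau) x1 l
   + \sum_(y <- x1 :: l) jj y + Gt (tau y1 t) * (ht t - ht y1) + jj t.
  rewrite E /= psum_rcons /corrected_term psumD psum_snd big_cons.
  by rewrite -/y1 /rsum_term; ring.
rewrite A8; move: A7 => /eqP; rewrite subr_eq => /eqP A7.
rewrite E5 in A5.
have -> : e * (2 * (W t - W s) + (W' t - W' s)) =
  2 * (e * (W t - W s)) + e * (W' t - W' s) by ring.
move: HP A1 A2 A3 A4 A5 A6 A7; rewrite /short_value.
set S := \sum_(y <- _) _; set P := psum _ _ _.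
set T1 := Gt _ * _; set T2 := right_lim G s * _; set T3 := left_lim G t * left_jump h t.
set T4 := left_reg a G x1 * _; set T5 := Gt (tau y1 t) * _.
set T6 := left_lim G t * (ht t - _); set T7 := G s * right_jump h s.
set U1 := e * (W t - W s); set U2 := e * (W' t - W' s); set U3 := e * (W' y1 - W' x1).
clearbody S P T1 T2 T3 T4 T5 T6 T7 U1 U2 U3.
by rewrite !ler_norml; glra.
Qed.

Lemma itv_partition_split (s z t : R) k : itv_partition s t k -> z \in k ->
  exists k1 k2, [/\ k = rcons k1 z ++ k2, itv_partition s z (rcons k1 z) &
     itv_partition z t k2].
Proof.
move=> [pk /eqP lk] zk; case/splitPr: zk pk lk => k1 k2.
rewrite -cat_rcons cat_path last_cat last_rcons => /andP[p1 p2] lk.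
exists k1, k2; split => //; split => //; first by rewrite last_rcons.
by rewrite lk.
Qed.

Lemma itv_partition_mem (s t x : R) k : itv_partition s t k -> x \in k ->
  s < x <= t.
Proof.
move=> [pk /eqP <-] xk; rewrite (path_sorted_lt pk xk) /=.
by have /andP[] : s <= x <= last s k by apply: path_le_mem; rewrite // inE xk orbT.
Qed.

Lemma rrs_all (e : R) : 0 < e ->
  forall eta : R, 0 < eta -> exists2 tau0, itv_partition u v tau0 &
  forall k tau, itv_partition u v k -> {subset tau0 <= k} -> tag tau ->
  `|psum (corrected_term tau) u k + dd u - dd v - (Phi v - Phi u)|
     <= e * (2 * (W v - W u) + (W' v - W' u)) + eta.
Proof.
have [au' uv' vb' ab'] := And4 au uv vb ab.
move=> e0.
have := @cousin _ u v (fun s t => forall eta : R, 0 < eta ->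
  exists2 tau0, itv_partition s t tau0 &
  forall k tau, itv_partition s t k -> {subset tau0 <= k} -> tag tau ->
  `|psum (corrected_term tau) s k + dd s - dd t - (Phi t - Phi s)|
     <= e * (2 * (W t - W s) + (W' t - W' s)) + eta) _ (rrs_local e0) u v.
apply => // s z t us sz zt tv H1 H2 eta eta0.
have [tau1 p1 {}H1] := H1 (eta / 2) ltac:(olra).
have [tau2 p2 {}H2] := H2 (eta / 2) ltac:(olra).
exists (tau1 ++ tau2); first exact: itv_partition_cat p1 p2.
move=> k tau kp sub tg.
have ztau : z \in tau1.
  have [pp /eqP lz] := p1; case: tau1 pp lz {p1 H1 sub} => [|x l] /=; first olra.
  by move=> _ <-; rewrite mem_last.
have zk : z \in k by apply: sub; rewrite mem_cat ztau.
have [k1 [k2 [E kp1 kp2]]] := itv_partition_split kp zk.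
have s1 : {subset tau1 <= rcons k1 z}.
  move=> x xt; have : x \in k by apply: sub; rewrite mem_cat xt.
  rewrite E mem_cat => /orP[//|xk2].
  by have := itv_partition_mem kp2 xk2; have := itv_partition_mem p1 xt; olra.
have s2 : {subset tau2 <= k2}.
  move=> x xt; have : x \in k by apply: sub; rewrite mem_cat xt orbT.
  rewrite E mem_cat => /orP[xk2|//].
  by have := itv_partition_mem kp1 xk2; have := itv_partition_mem p2 xt; olra.
have h1 := H1 _ tau kp1 s1 tg; have h2 := H2 _ tau kp2 s2 tg.
rewrite E psum_cat last_rcons; move: h1 h2; rewrite !ler_norml !mulrDr; olra.
Qed.

(** Small bounds on short open intervals are added up by [cousin]. *)
Lemma jumps_bsum : exists M, bsum `]u, v[%classic jump2 M.
Proof.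
have [au' uv' vb' ab'] := And4 au uv vb ab.
have H := locally_good_restrict au vb (young_jumps_bound Gr hr Wn YW ltr01).
apply: (@cousin _ u v (fun s t => exists M, bsum `]s, t[%classic jump2 M)) => //.
- move=> s z t us sz zt tv [M1 B1] [M2 B2].
  exists (M1 + (`|jump2 z| + M2)).
  have B : bsum (`[z, t[%classic) jump2 (`|jump2 z| + M2).
    apply: (bsumU (@bsum1 _ jump2 z) B2) => x /=; rewrite !in_itv /= => /andP[zx xt].
    have [->|xz] := eqVneq x z; [by left|right].
    by rewrite lt_neqAle eq_sym xz zx.
  apply: (bsumU B1 B) => x /=; rewrite !in_itv /= => /andP[sx xt].
  by have [xz|zx] := ltP x z; [left; rewrite sx|right; rewrite xt].
- by apply: locally_good_sub H _ => s t us st tv B; eexists; exact: B.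
Qed.

(** The finite partition of [rrs_all] is refined by the points of a finite set
    that nearly exhausts the sum of the jump products. *)
Lemma is_LY_lt : is_LY G h u v (Phi v - Phi u).
Proof.
have [au' uv' vb' ab'] := And4 au uv vb ab.
right; split => //.
have [M BM] := jumps_bsum.
set S := uncond_sum `]u, v[%classic jump2.
exists (Phi v - Phi u - G u * right_jump h u - S); split.
- split; apply: flat_regulated => e e0.
    exact: locally_good_restrict au vb (Gr e0).
  exact: locally_good_restrict au vb (hr e0).
- move=> e e0.
  have V0 : 0 <= 2 * (W v - W u) + (W' v - W' u).
    have := Wn au (ltW uv) vb; have := Wn' au (ltW uv) vb; olra.
  have e10 : 0 < e / (4 * (2 * (W v - W u) + (W' v - W' u) + 1)).
    by apply: divr_gt0 => //; olra.
  have [tau0 p0 H0] := rrs_all e10 (eta := e / 4) ltac:(olra).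
  have e1V : e / (4 * (2 * (W v - W u) + (W' v - W' u) + 1))
      * (2 * (W v - W u) + (W' v - W' u)) <= e / 4.
    have -> : e / 4 = e / (4 * (2 * (W v - W u) + (W' v - W' u) + 1))
       * (2 * (W v - W u) + (W' v - W' u) + 1) by field; olra.
    by rewrite ler_wpM2l ?(ltW e10)//; olra.
  have e4 : 0 < e / 4 by olra.
  have [A0 hA0] := usum_near BM e4.
  pose L := tau0 ++ [seq x <- A0 | u < x < v].
  have Lin x : x \in L -> u < x <= v.
    rewrite mem_cat => /orP[|]; first exact: itv_partition_mem p0.
    by rewrite mem_filter => /andP[/andP[-> /ltW ->]].
  have vL : v \in L.
    rewrite mem_cat; apply/orP; left; have [pp /eqP lz] := p0.
    case: tau0 pp lz {p0 H0 L Lin} => [|x l] /=; first olra.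
    by move=> _ <-; rewrite mem_last.
  pose tau1 := sort <=%R (undup L).
  have sL : sorted <%R tau1 by rewrite sort_lt_sorted undup_uniq.
  have mL x : (x \in tau1) = (x \in L) by rewrite mem_sort mem_undup.
  have pL : path <%R u tau1.
    rewrite lt_path_sortedE sL andbT; apply/allP => x; rewrite mL => /Lin.
    by case/andP.
  exists tau1.
    split => //; apply/eqP/le_anti/andP; split.
      have := mem_last u tau1; rewrite inE => /orP[/eqP ->|]; first exact: ltW.
      by rewrite mL => /Lin/andP[].
    by have /andP[] : u <= v <= last u tau1
      by apply: path_le_mem; rewrite // inE mL vL orbT.
  move=> k xi kp sub xik.
  have [pk /eqP lk] := kp.
  have uk : uniq k.
    by apply: (sorted_uniq lt_trans ltxx); exact: path_sorted pk.
  (* Tags indexed by position become a function of the interval through its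
     right end. *)
  pose tau x y := if x <= xi (index y k) <= y then xi (index y k) else x.
  have tg : tag tau by move=> x y xy; rewrite /tau; case: ifP => //; rewrite lexx xy.
  have sub0 : {subset tau0 <= k}.
    by move=> x xt; apply: sub; rewrite mL mem_cat xt.
  have {H0} := H0 k tau kp sub0 tg.
  have -> : psum (corrected_term tau) u k =
      psum (rsum_term Gt ht tau) u k + \sum_(y <- k) jj y.
    by rewrite /corrected_term psumD psum_snd.
  have -> : psum (rsum_term Gt ht tau) u k = \sum_(0 <= i < size k)
      Gt (xi i) * (ht (nth u (u :: k) i.+1) - ht (nth u (u :: k) i)).
    rewrite -partition_sumE; apply: eq_big_nat => i /= ik.
    rewrite /rsum_term /tau index_uniq//; have := xik i ik => /= ->.
    by [].
  have -> : dd u = G u * right_jump h u by rewrite /dd lt_eqF.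
  have -> : dd v = 0 by rewrite /dd eqxx.
  have : `|\sum_(y <- k) jj y - S| <= e / 4.
    have := hA0 ([fset x in k] `|` A0)%fset (fsubsetUr _ _).
    congr (`|_ - _| <= _).
    rewrite (big_fset_condE +%R).
    have -> : \sum_(y <- k) jj y = \sum_(y <- [seq y <- k | y < v]) jump2 y.
      rewrite big_filter [LHS](bigID (fun y => y < v)) /= [X in _ + X]big1_seq.
        rewrite addr0; apply: eq_bigr => y yv; rewrite /jj lt_eqF//.
      move=> y /andP[yv yk]; have := itv_partition_mem kp yk => /andP[_ yv'].
      by rewrite /jj ifT//; rewrite eq_le yv' leNgt.
    apply: perm_big; apply: uniq_perm; rewrite ?filter_uniq ?fset_uniq//.
    move=> x; rewrite !inE mem_filter.
    apply/idP/idP => [/andP[/orP[xk|xA] /set_mem/=]|/andP[xv xk]].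
    + by rewrite in_itv /= => /andP[_ ->].
    + rewrite in_itv /= => xuv; have /andP[ux ->] := xuv.
      by rewrite /= sub// mL mem_cat mem_filter xuv xA orbT.
    + rewrite xk /=; apply: mem_set; rewrite /= in_itv /= xv andbT.
      by have /andP[] := itv_partition_mem kp xk.
  set X := \sum_(0 <= i < size k) _; set Y := \sum_(y <- k) _.
  rewrite -/Gt -/ht -/X !ler_norml ltr_norml; olra.
- exact: bsum_abs_summable BM.
- rewrite -/S; ring.
Qed.

End RRS.

(** * Existence and uniqueness of Young integrals *)

Section YoungTheorem.
Variables (R : realType) (a b : R) (lambda : nat -> seq R).
Hypothesis ab : a < b.
Hypothesis lamP : in_Lambda a b lambda.
Local Notation lsum := (lsum lambda).
Local Notation ulam := (ulam a lambda).

(** Both the limit of left sums along the partitions and the Left Young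
    integral, which does not depend on them, are determined by the same values
    on short intervals. *)
Theorem young_integral G h : ypair a b G h ->
  (forall z, a < z < b -> ~ ulam z -> right_jump h z = 0) ->
  exists Phi : R -> R, [/\ Phi a = 0,
    forall s t, a <= s -> s < t -> t <= b ->
      lsum (fun x y => G x * (h y - h x)) s t @ \oo --> Phi t - Phi s,
    forall z, a < z <= b ->
      Phi x @[x --> z^'-] --> Phi z - left_lim G z * left_jump h z,
    forall z, a <= z < b ->
      Phi y @[y --> z^'+] --> Phi z + G z * right_jump h z &
    forall u v, a <= u -> u <= v -> v <= b -> is_LY G h u v (Phi v - Phi u)].
Proof.
move=> GhY hj; have [Phi [Pa P Pl Pr]] := left_sum_lim ab lamP GhY hj.
exists Phi; split => // u v au uv vb.
move: uv; rewrite le_eqVlt => /orP[/eqP <-|uv]; first by left; rewrite subrr.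
have [W Wn Y] := ypair_young GhY; have [W' Wn' Y'] := ypair_young (ypair_reg GhY).
case: (GhY) => Gr hr _.
apply: (is_LY_lt ab au uv vb Gr hr Wn Wn' Y Y') => e e0.
apply: locally_good_sub (left_sum_local lamP GhY Wn Y e0) _ => s t as_ st tb H; apply/ler_addgt0Pr => e' e'0.
exact: seq_cvg_le (P s t as_ st tb) (H e' e'0).
Qed.

Lemma common_refinement (u v : R) k1 k2 : itv_partition u v k1 ->
  itv_partition u v k2 -> exists2 k, itv_partition u v k &
  {subset k1 <= k} /\ {subset k2 <= k}.
Proof.
move=> p1 p2; pose k := sort <=%R (undup (k1 ++ k2)).
have mk x : (x \in k) = (x \in k1) || (x \in k2).
  by rewrite mem_sort mem_undup mem_cat.
have kin x : x \in k -> u < x <= v.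
  by rewrite mk => /orP[|]; [exact: itv_partition_mem p1|exact: itv_partition_mem p2].
have pk : path <%R u k.
  rewrite lt_path_sortedE sort_lt_sorted undup_uniq andbT.
  by apply/allP => x /kin/andP[].
exists k; last by split=> x xk; rewrite mk xk ?orbT.
split => //; have [_ /eqP l1] := p1; rewrite -l1.
have := mem_last u k1; rewrite inE l1 => /orP[/eqP vu|vk1].
  by have := mem_last u k; rewrite inE vu => /orP[//|/kin]; rewrite vu; olra.
have /andP[_ h1] : u <= v <= last u k.
  by apply: path_le_mem; rewrite // inE mk vk1 orbT.
have := mem_last u k; rewrite inE => /orP[/eqP|/kin/andP[_]]; last first.
  by move=> h2; apply/eqP/le_anti; rewrite h1 h2.
by move=> E; have := itv_partition_mem p1 vk1; rewrite E in h1; olra.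
Qed.

(** Both values are approximated by the sum over a common refinement. *)
Lemma is_RRS_unique (G h : R -> R) u v I J : is_RRS G h u v I ->
  is_RRS G h u v J -> I = J.
Proof.
move=> HI HJ; apply/eqP; rewrite -subr_eq0 -normr_le0; apply/ler_addgt0Pr => e e0.
have [k1 p1 H1] := HI (e / 2) ltac:(olra); have [k2 p2 H2] := HJ (e / 2) ltac:(olra).
have [k kp [s1 s2]] := common_refinement p1 p2.
pose xi i := nth u (u :: k) i.
have xiP i : (i < size k)%N ->
    nth u (u :: k) i <= xi i <= nth u (u :: k) i.+1.
  move=> ik; rewrite /xi lexx /=; apply: ltW.
  by have [/(pathP u) pk _] := kp; apply: pk.
have := H1 k xi kp s1 xiP; have := H2 k xi kp s2 xiP.
by rewrite !ltr_norml ler_norml; olra.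
Qed.

Lemma is_LY_unique (G h : R -> R) u v I J : is_LY G h u v I ->
  is_LY G h u v J -> I = J.
Proof.
move=> [[uv ->]|[uv [I' [_ RI _ ->]]]] [[uv' ->]|[uv' [J' [_ RJ _ ->]]]] //; try olra.
by rewrite (is_RRS_unique RI RJ).
Qed.

End YoungTheorem.

(** * Covariation of Young pairs *)

Section Covariation.
Variables (R : realType) (a b : R) (lambda : nat -> seq R).
Hypothesis ab : a < b.
Hypothesis lamP : in_Lambda a b lambda.
Local Notation lsum := (lsum lambda).
Local Notation ulam := (ulam a lambda).

Let C (g h : R -> R) x y := (g y - g x) * (h y - h x).

Lemma cov_cvgl g h z : flat_reg a b g -> flat_reg a b h -> a < z <= b ->
  C g h x z @[x --> z^'-] --> left_jump g z * left_jump h z.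
Proof.
by move=> gr hr zab; apply: cvgM; [exact: left_cvg_jump gr zab|exact: left_cvg_jump hr zab].
Qed.

Lemma cov_cvgr g h z : flat_reg a b g -> flat_reg a b h -> a <= z < b ->
  C g h z y @[y --> z^'+] --> right_jump g z * right_jump h z.
Proof.
by move=> gr hr zab; apply: cvgM; [exact: right_cvg_jump gr zab|exact: right_cvg_jump hr zab].
Qed.

Lemma cross_small g h z : flat_reg a b g -> flat_reg a b h -> a < z < b ->
  right_jump h z = 0 -> forall e : R, 0 < e -> exists2 d, 0 < d &
  forall p n, a <= p -> n <= b -> z < n < z + d -> p <= z ->
  `|(g z - g p) * (h n - h z)| <= e.
Proof.
move=> gr hr zab hz e e0; have [M M0 gM] := flat_reg_bounded ab gr.
have e1 : 0 < e / (2 * M) by apply: divr_gt0 => //; olra.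
have := right_cvg_jump hr (z := z) ltac:(olra); rewrite hz//.
move=> /cvg_rightP/(_ _ e1)[d d0 hd]; exists d => // p n ap nb zn pz.
have := hd n zn; rewrite subr0 => h1.
have -> : e = (2 * M) * (e / (2 * M)) by field; olra.
rewrite normrM ler_pM//.
have := gM p ltac:(olra); have := gM z ltac:(olra).
by rewrite !ler_norml; olra.
Qed.

Lemma cross_small' g h z : flat_reg a b g -> flat_reg a b h -> a < z < b ->
  right_jump g z = 0 -> forall e : R, 0 < e -> exists2 d, 0 < d &
  forall p n, a <= p -> n <= b -> z < n < z + d -> p <= z ->
  `|(g n - g z) * (h z - h p)| <= e.
Proof.
move=> gr hr zab gz e e0; have [d d0 hd] := cross_small hr gr zab gz e0.
by exists d => // p n *; rewrite mulrC; apply: hd.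
Qed.

(** Splitting at [z] loses two products of an increment to the left of [z]
    with one to the right, which are small in the absence of right jumps at
    [z]. *)
Lemma cov_asym g h : flat_reg a b g -> flat_reg a b h ->
  (forall z, a < z < b -> ~ ulam z -> right_jump g z = 0) ->
  (forall z, a < z < b -> ~ ulam z -> right_jump h z = 0) ->
  asym_add a b lambda (C g h).
Proof.
move=> gr hr gj hj z zab uz e e0; have e2 : 0 < e / 2 by olra.
have [d d0 hd] := cross_small gr hr zab (hj z zab uz) e2.
have [d' d'0 hd'] := cross_small' gr hr zab (gj z zab uz) e2.
have m1 : Num.min d d' <= d by rewrite ge_min lexx.
have m2 : Num.min d d' <= d' by rewrite ge_min lexx orbT.
exists (Num.min d d') => [|p n ap nb pz zn]; first by rewrite lt_min d0.
have h1 := hd p n ap nb ltac:(olra) ltac:(olra).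
have h2 := hd' p n ap nb ltac:(olra) ltac:(olra).
rewrite (_ : _ - _ = (g z - g p) * (h n - h z) + (g n - g z) * (h z - h p)).
  by have := ler_normD ((g z - g p) * (h n - h z)) ((g n - g z) * (h z - h p)); olra.
rewrite /C; ring.
Qed.

Lemma right_tag : tag (fun x y : R => y).
Proof. by move=> x y xy; rewrite lexx xy. Qed.

(** A product of increments is the difference of the right and the left term
    of a Riemann-Stieltjes sum; both sums agree with the one-term sum. *)
Lemma cov_young g h W : young a b W g h -> forall e : R, 0 < e ->
  locally_good a b (fun s t => forall x l, s < x -> path <%R x l -> last x l < t ->
    `|psum (C g h) x l| <= e * (W (last x l) - W x)).
Proof.
move=> Y e e0; have e2 : 0 < e / 2 by olra.
apply: locally_good_sub (Y _ e2) _ => s t as_ st tb H x l sx pl lt.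
have := H x l _ sx pl lt (@left_tag R); have := H x l _ sx pl lt right_tag.
have -> : psum (C g h) x l = psum (rsum_term g h (fun x y => y)) x l
    - psum (rsum_term g h (fun x y => x)) x l.
  by rewrite -psumB; apply: eq_psum => // *; rewrite /C /rsum_term; ring.
by rewrite !ler_norml; olra.
Qed.

(** By [cov_young] sums over short open intervals are negligible, so only the
    end terms count: the covariation of a Young pair is carried by common
    jumps. *)
Lemma cov_lim g h : ypair a b g h ->
  (forall z, a < z < b -> ~ ulam z -> right_jump g z = 0) ->
  (forall z, a < z < b -> ~ ulam z -> right_jump h z = 0) ->
  exists S : R -> R, [/\ S a = 0,
  forall s t, a <= s -> s < t -> t <= b -> lsum (C g h) s t @ \oo --> S t - S s,
  forall z, a < z <= b ->
    S x @[x --> z^'-] --> S z - left_jump g z * left_jump h z &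
  forall z, a <= z < b ->
    S y @[y --> z^'+] --> S z + right_jump g z * right_jump h z].
Proof.
move=> Y gj hj; case: (Y) => gr hr _; have [W Wn YW] := ypair_young Y.
have [|S [Sa P]] := lsum_sew lamP (V := W) (cov_asym gr hr gj hj).
  move=> e e0; apply: locally_good_sub (cov_young YW e0) _ => s t as_ st tb H.
  exists (right_jump g s * right_jump h s + left_jump g t * left_jump h t).
  move=> e' e'0; have := lsum_ends lamP as_ st tb
    (cov_cvgr gr hr (z := s) ltac:(olra)) (cov_cvgl gr hr (z := t) ltac:(olra)) e'0 st st.
  apply: filterS => m [x1 [l [_ sx1 lt pl]]].
  have := H x1 l ltac:(olra) pl ltac:(olra); have xl := path_le_last pl.
  have : e * (W (last x1 l) - W x1) <= e * (W t - W s).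
    rewrite ler_wpM2l ?(ltW e0)// lerB//; apply: Wn; olra.
  by rewrite !ler_norml; olra.
have [|Sl Sr] := lsum_jumps lamP P (fun z => @cov_cvgl g h z gr hr)
    (fun z => @cov_cvgr g h z gr hr); last by exists S.
move=> e e0; have Wab : W a <= W b by apply: Wn; rewrite ?(ltW ab).
have e1 : 0 < e / (W b - W a + 1) by apply: divr_gt0 => //; olra.
apply: locally_good_sub (cov_young YW e1) _ => s t as_ st tb H x l sx pl lt.
apply: (le_trans (H x l sx pl lt)); have xl := path_le_last pl.
have -> : e = e / (W b - W a + 1) * (W b - W a + 1) by field; olra.
set q := e / _ in e1 *.
have -> : q * (W b - W a + 1) / (W b - W a + 1) = q by field; olra.
rewrite ler_wpM2l ?(ltW e1)//.
have := Wn a x ltac:(olra) ltac:(olra) ltac:(olra).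
have := Wn (last x l) b ltac:(olra) ltac:(olra) ltac:(olra); olra.
Qed.

End Covariation.

(** * Functions of bounded p-variation and their duals *)

Section Variation.
Variables (R : realType) (a b : R).
Hypothesis ab : a < b.
Implicit Types (f g h G W : R -> R).

(** The supremum over the partitions of [[a, y]] is superadditive. *)
Lemma W_control f q : 0 < q -> in_W a b q f -> exists2 W, nondec a b W &
  forall x y, a <= x -> x <= y -> y <= b -> `|f y - f x| `^ q <= W y - W x.
Proof.
move=> q0 fW; pose phi x y := `|f y - f x| `^ q.
pose A y := [set psum phi a s | s in [set s | itv_partition a y s]].
have [M hM] : exists M : R, forall s, itv_partition a b s -> psum phi a s <= M.
  exists (fine (pvar a b q f)) => s sp; rewrite -lee_fin fineK.
    by apply: ereal_sup_ubound; exists s => //; rewrite partition_sumE.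
  rewrite fin_numElt fW andbT; apply: (@lt_le_trans _ _ (psum phi a s)%:E).
    by rewrite ltNyr.
  by apply: ereal_sup_ubound; exists s => //; rewrite partition_sumE.
have phi0 x y : 0 <= phi x y by exact: powR_ge0.
have ub y s : a <= y -> y <= b -> itv_partition a y s -> psum phi a s <= M.
  move=> ay; rewrite le_eqVlt => /orP[/eqP ->|yb] sp; first exact: hM.
  have := hM _ (itv_partition_cat sp (itv_partition1 yb)).
  by rewrite psum_cat /=; have := phi0 (last a s) b; olra.
have ne y : a <= y -> A y !=set0.
  rewrite le_eqVlt => /orP[/eqP <-|ay].
    by exists (psum phi a [::]), [::] => //; split => /=.
  by exists (psum phi a [:: y]), [:: y] => //; exact: itv_partition1.
have hs y : a <= y -> y <= b -> has_sup (A y).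
  move=> ay yb; split; first exact: ne.
  by exists M => _ [s sp <-]; exact: ub sp.
have key x y : a <= x -> x <= y -> y <= b -> sup (A x) + phi x y <= sup (A y).
  move=> ax xy yb; rewrite -lerBrDr; apply: ge_sup; first exact: ne.
  move=> _ [s sp <-]; rewrite lerBrDr.
  have hy := hs y (le_trans ax xy) yb.
  move: xy; rewrite le_eqVlt => /orP[/eqP xy|xy].
    rewrite -xy in hy *; rewrite /phi subrr normr0 powR0 ?addr0; last olra.
    by apply: ub_le_sup hy.2 _ _; exists s.
  apply: ub_le_sup hy.2 _ _; exists (s ++ [:: y]).
    by apply: itv_partition_cat sp _; exact: itv_partition1.
  by rewrite psum_cat /= addr0; have [_ /eqP ->] := sp.
exists (fun y => sup (A y)) => x y ax xy yb.
  by have := key x y ax xy yb; have := phi0 x y; olra.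
by have := key x y ax xy yb; rewrite /phi; olra.
Qed.

Lemma control_W f q W : nondec a b W ->
  (forall x y, a <= x -> x <= y -> y <= b -> `|f y - f x| `^ q <= W y - W x) ->
  in_W a b q f.
Proof.
move=> Wn H; apply: (@le_lt_trans _ _ (W b - W a)%:E); last exact: ltry.
apply: ge_ereal_sup => _ [s [ps /eqP ls] <-]; rewrite lee_fin partition_sumE.
rewrite -{1}ls -psum_telescope; apply: ler_psum => // x y ? ? ?.
by apply: H => //; [exact: ltW|rewrite -ls].
Qed.

Lemma control_pow f q W : 0 < q ->
  nondec a b W ->
  (forall x y, a <= x -> x <= y -> y <= b -> `|f y - f x| `^ q <= W y - W x) ->
  forall x y, a <= x -> x <= y -> y <= b -> `|f y - f x| <= (W y - W x) `^ q^-1.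
Proof.
move=> q0 Wn H x y ax xy yb; rewrite powR_root ?invr_gt0//.
  by rewrite invrK; exact: H.
by rewrite subr_ge0; exact: Wn.
Qed.

Lemma W_flat f q : 0 < q -> in_W a b q f -> flat_reg a b f.
Proof.
move=> q0 /(W_control q0)[W Wn H] e e0.
have eq0 : 0 < e `^ q by exact: powR_gt0.
apply: locally_good_sub (nd_flat Wn eq0) _ => s t as_ st tb fl.
have key x y : s < x < t -> s < y < t -> x <= y -> `|f y - f x| <= e.
  move=> xs ys xy.
  have := control_pow q0 Wn H (x := x) (y := y) ltac:(olra) xy ltac:(olra).
  move=> /le_trans; apply; rewrite -[leRHS](powRr1 (ltW e0)).
  rewrite -(mulfV (lt0r_neq0 q0)) powRrM; apply: ge0_ler_powR.
  - by rewrite invr_ge0 ltW.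
  - by rewrite nnegrE subr_ge0; apply: Wn; olra.
  - by rewrite nnegrE powR_ge0.
  - by apply: le_trans (ler_norm _) _; apply: fl.
move=> x y xs ys; case: (leP x y) => [xy|/ltW xy]; last exact: key.
by rewrite distrC; exact: key.
Qed.

Lemma dual_flat p G : in_dualW a b p G -> flat_reg a b G.
Proof.
by move=> [[_ /regulated_flat//]|[_ [q [q0 _ GW]]]]; exact: W_flat q0 GW.
Qed.

(** The condition 1/p + 1/q > 1 in the definition of the dual class is the one
    of the Love-Young inequality, with the sum of the two variations as
    control. *)
Lemma dual_ypair p G h : 1 <= p -> in_dualW a b p G -> in_W a b p h ->
  flat_reg a b h -> ypair a b G h.
Proof.
move=> p1 GD hW hr; have p0 : 0 < p by olra.
split=> //; first exact: dual_flat GD.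
have [Wh Whn Hh] := W_control p0 hW.
case: GD => [[pE Gr]|[p1' [q [q0 pq GW]]]].
  left; exists Wh => // x y ax xy yb; have := Hh x y ax xy yb.
  by rewrite pE powRr1.
have [Wg Wgn Hg] := W_control q0 GW.
right; exists (fun x => Wg x + Wh x), q^-1, p^-1.
have mono (r w w' : R) : 0 < r -> 0 <= w -> w <= w' -> w `^ r <= w' `^ r.
  by move=> r0 w0 ww; apply: ge0_ler_powR; rewrite ?nnegrE ?(ltW r0)//; olra.
split.
- by move=> x y ax xy yb; rewrite lerD ?Wgn ?Whn.
- by split; rewrite ?invr_gt0//; olra.
- move=> x y ax xy yb; apply: le_trans (control_pow q0 Wgn Hg ax xy yb) _.
  have h1 := Wgn x y ax xy yb; have h2 := Whn x y ax xy yb.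
  by apply: mono; rewrite ?invr_gt0//; olra.
- move=> x y ax xy yb; apply: le_trans (control_pow p0 Whn Hh ax xy yb) _.
  have h1 := Wgn x y ax xy yb; have h2 := Whn x y ax xy yb.
  by apply: mono; rewrite ?invr_gt0//; olra.
Qed.

Lemma nd_ypair G W : flat_reg a b G -> nondec a b W -> ypair a b G W.
Proof.
move=> Gr Wn; split=> //; first exact: nd_flat.
by left; exists W => // x y ax xy yb; rewrite ger0_norm// subr_ge0; exact: Wn.
Qed.

(** As p < 2, the exponent q = p satisfies 1/p + 1/q > 1. *)
Lemma W_dual p h : 1 <= p < 2 -> in_W a b p h -> flat_reg a b h ->
  in_dualW a b p h.
Proof.
move=> /andP[]; rewrite le_eqVlt => /orP[/eqP p1|p1] p2 hW hr.
  by left; split=> //; exact: flat_regulated.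
right; split=> //; exists p; split=> //; first olra.
have : 2^-1 < p^-1 by rewrite ltf_pV2 ?posrE//; olra.
olra.
Qed.

Lemma nd_dual p W : 1 <= p -> nondec a b W -> in_dualW a b p W.
Proof.
rewrite le_eqVlt => /orP[/eqP p1|p1] Wn.
  by left; split=> //; apply: flat_regulated; exact: nd_flat.
right; split=> //; exists 1; split=> //.
  have pi0 : 0 < p^-1 by rewrite invr_gt0; olra.
  by rewrite invr1; olra.
apply: (control_W Wn) => x y ax xy yb; rewrite powRr1// ger0_norm// subr_ge0.
exact: Wn.
Qed.

(** Increments bounded by a power 1/i of a control are bounded by its power
    1/q for q >= i, at the price of a power of the total increment. So the
    larger of the two exponents serves both functions. *)
Lemma dual_dom p C G1 G2 H : 1 <= p -> in_dualW a b p G1 -> in_dualW a b p G2 ->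
  (forall x y, a <= x -> x < y -> y <= b ->
     `|H y - H x| <= C * (`|G1 y - G1 x| + `|G2 y - G2 x|)) ->
  in_dualW a b p H.
Proof.
move=> p1 D1 D2 HH.
have := flat_reg_dom (dual_flat D1) (dual_flat D2) HH.
case: D1 => [[pE r1]|[p1' [q1 [q10 pq1 W1]]]] Hr.
  by left; split=> //; exact: flat_regulated.
case: D2 => [[pE r2]|[_ [q2 [q20 pq2 W2]]]]; first olra.
right; split=> //.
have [V1 V1n H1] := W_control q10 W1; have [V2 V2n H2] := W_control q20 W2.
pose V x := V1 x + V2 x.
have Vn : nondec a b V by move=> x y ax xy yb; rewrite lerD ?V1n ?V2n.
pose q := Num.max q1 q2.
have q0 : 0 < q by rewrite lt_max q10.
have pq : 1 < p^-1 + q^-1 by rewrite /q; case: (leP q1 q2).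
exists q; split; [exact: q0|exact: pq|].
have Om0 : 0 <= V b - V a by rewrite subr_ge0; apply: Vn; rewrite ?(ltW ab).
pose c i := (V b - V a) `^ (i^-1 - q^-1).
have incr G W i : 0 < i -> i <= q -> nondec a b W ->
   (forall x y, a <= x -> x <= y -> y <= b -> W y - W x <= V y - V x) ->
   (forall x y, a <= x -> x <= y -> y <= b -> `|G y - G x| `^ i <= W y - W x) ->
   forall x y, a <= x -> x <= y -> y <= b ->
     `|G y - G x| <= c i * (V y - V x) `^ q^-1.
  move=> i0 iq Wn WV HG x y ax xy yb.
  apply: le_trans (control_pow i0 Wn HG ax xy yb) _.
  have w0 : 0 <= W y - W x by rewrite subr_ge0 Wn.
  have iq' : 0 <= i^-1 - q^-1 by rewrite subr_ge0 lef_pV2 ?posrE.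
  have -> : i^-1 = (i^-1 - q^-1) + q^-1 by ring.
  have -> : (W y - W x) `^ (i^-1 - q^-1 + q^-1) =
            (W y - W x) `^ (i^-1 - q^-1) * (W y - W x) `^ q^-1.
    apply: powRD; apply/implyP => /eqP E.
    have : 0 < i^-1 by rewrite invr_gt0.
    by move: E; rewrite subrK => ->; rewrite ltxx.
  have vw := WV x y ax xy yb.
  apply: ler_pM; rewrite ?powR_ge0//; apply: ge0_ler_powR; rewrite ?nnegrE ?invr_ge0 ?(ltW q0)//.
  - apply: (le_trans vw); rewrite lerB//; apply: Vn => //; olra.
  - olra.
have WV1 x y : a <= x -> x <= y -> y <= b -> V1 y - V1 x <= V y - V x.
  by move=> ax xy yb; have := V2n x y ax xy yb; rewrite /V; olra.
have WV2 x y : a <= x -> x <= y -> y <= b -> V2 y - V2 x <= V y - V x.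
  by move=> ax xy yb; have := V1n x y ax xy yb; rewrite /V; olra.
have iq1 : q1 <= q by rewrite /q le_max lexx.
have iq2 : q2 <= q by rewrite /q le_max lexx orbT.
have B1 := incr G1 V1 q1 q10 iq1 V1n WV1 H1.
have B2 := incr G2 V2 q2 q20 iq2 V2n WV2 H2.
pose D := `|C| * (c q1 + c q2).
have D0 : 0 <= D by rewrite mulr_ge0 ?addr_ge0 ?powR_ge0.
apply: (@control_W _ _ (fun x => D `^ q * V x)).
  by move=> x y ax xy yb; rewrite ler_wpM2l ?powR_ge0 ?Vn.
move=> x y ax; rewrite le_eqVlt => /orP[/eqP ->|xy] yb.
  by rewrite !subrr normr0 powR0//; olra.
have v0 : 0 <= V y - V x by rewrite subr_ge0 Vn// ltW.
have key : `|H y - H x| <= D * (V y - V x) `^ q^-1.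
  apply: (le_trans (HH x y ax xy yb)).
  have := B1 x y ax (ltW xy) yb; have := B2 x y ax (ltW xy) yb => b2 b1.
  apply: (@le_trans _ _ (`|C| * (`|G1 y - G1 x| + `|G2 y - G2 x|))).
    by rewrite ler_wpM2r ?addr_ge0// ler_norm.
  by rewrite /D -mulrA ler_wpM2l// mulrDl lerD.
rewrite -mulrBr.
apply: (@le_trans _ _ ((D * (V y - V x) `^ q^-1) `^ q)).
  by apply: ge0_ler_powR; rewrite ?nnegrE ?(ltW q0)// mulr_ge0 ?powR_ge0.
by rewrite powRM ?powR_ge0// -powRrM mulVf ?powRr1//; olra.
Qed.

Lemma dual_mul p G1 G2 : 1 <= p -> in_dualW a b p G1 -> in_dualW a b p G2 ->
  in_dualW a b p (fun x => G1 x * G2 x).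
Proof.
move=> p1 D1 D2; have [M M0 GM] := flat_reg_bounded ab (dual_flat D1).
have [N N0 GN] := flat_reg_bounded ab (dual_flat D2).
apply: (dual_dom (C := M + N) p1 D1 D2) => x y ax xy yb.
by apply: mul_increment_bound; [apply: GM; olra|apply: GN; olra].
Qed.

End Variation.

(** * Estimates of the exponential function *)

Section ExpBounds.
Variable R : realType.
Implicit Types (u j M : R).

Lemma expR_sub1_bound u : `|expR u - 1| <= `|u| * expR `|u|.
Proof.
have h1 := expR_ge1Dx u; have h2 : expR u - 1 <= u * expR u.
  have := expR_ge1Dx (- u); rewrite expRN => h.
  have : (1 + - u) * expR u <= 1.
    by rewrite -[leRHS](mulVf (lt0r_neq0 (expR_gt0 u))) ler_wpM2r// expR_ge0.
  olra.
have [u0|u0] := leP 0 u.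
  by rewrite !ger0_norm//; olra.
rewrite (ltr0_norm u0) ler0_norm; last by rewrite subr_le0 expR_le1 ltW.
have : 1 <= expR (- u) by have := expR_ge1Dx (- u); olra.
nra.
Qed.

Lemma expR_sub2_bound u : 0 <= expR u - 1 - u <= u ^+ 2 * expR `|u|.
Proof.
have h1 := expR_ge1Dx u; apply/andP; split; first olra.
have h2 : expR u - 1 <= u * expR u.
  have := expR_ge1Dx (- u); rewrite expRN => h.
  have : (1 + - u) * expR u <= 1.
    by rewrite -[leRHS](mulVf (lt0r_neq0 (expR_gt0 u))) ler_wpM2r// expR_ge0.
  olra.
have h3 : u * (expR u - 1) <= `|u| * (`|u| * expR `|u|).
  apply: (le_trans (ler_norm _)); rewrite normrM ler_wpM2l//.
  exact: expR_sub1_bound.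
have -> : u ^+ 2 = `|u| * `|u| by rewrite -expr2 real_normK// num_real.
rewrite -mulrA; olra.
Qed.

(** By the mean value theorem, as the derivative of the left side is the
    function estimated in [expR_sub2_bound]. *)
Lemma expR_sub3_bound u :
  `|expR u - 1 - u - u ^+ 2 / 2| <= `|u| ^+ 3 * expR `|u|.
Proof.
pose phi v : R := expR v - 1 - v - v ^+ 2 / 2.
have dphi (x : R) : is_derive x 1 phi (expR x - 1 - x).
  apply: is_derive_eq.
  by rewrite /GRing.scale /= !(mulr0, mulr1, subr0, add0r); olra.
have cphi (A : set R) : {within A, continuous phi}.
  apply: continuous_subspaceT => x; apply: differentiable_continuous.
  apply/derivable1_diffP; have [? _] := dphi x; by [].
have phi0 : phi 0 = 0 by rewrite /phi expR0; ring.
have bound c : `|c| <= `|u| -> `|(expR c - 1 - c) * u| <= `|u| ^+ 3 * expR `|u|.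
  move=> cu; have /andP[h1 h2] := expR_sub2_bound c.
  have -> : `|u| ^+ 3 * expR `|u| = (`|u| ^+ 2 * expR `|u|) * `|u| by ring.
  rewrite normrM ger0_norm// ler_wpM2r//.
  apply: (le_trans h2); rewrite -[c ^+ 2]real_normK ?num_real//.
  by apply: ler_pM; rewrite ?expR_ge0 ?ler_expR// lerXn2r ?nnegrE.
have [u0|u0] := leP 0 u.
  have [c /[!in_itv]/= cu E] := MVT_segment u0 (fun x _ => dphi x) (cphi _).
  move: E; rewrite phi0 !subr0 => E; rewrite -[X in `|X|]/(phi u) E; apply: bound.
  by rewrite !ger0_norm; olra.
have [c /[!in_itv]/= cu E] := MVT_segment (ltW u0) (fun x _ => dphi x) (cphi _).
move: E; rewrite phi0 !sub0r => E.
have -> : expR u - 1 - u - u ^+ 2 / 2 = (expR c - 1 - c) * u.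
  by rewrite -[LHS]/(phi u) -[LHS]opprK E; ring.
by apply: bound; rewrite !ler0_norm; olra.
Qed.

(** The factor of the jump products for a jump [j], equal to 1 - j^2 / 2 +
    O(|j|^3). *)
Definition wexp j := (1 + j) * expR (- j).

Definition wcst M := (1 + M) * expR M + 1.

Lemma wcst_gt0 M : 0 <= M -> 0 < wcst M.
Proof. by move=> M0; have := expR_gt0 M; rewrite /wcst; nra. Qed.

Lemma wexp_bound1 j M : `|j| <= M -> `|wexp j - 1| <= wcst M * j ^+ 2.
Proof.
move=> jM; have M0 : 0 <= M by exact: le_trans jM.
have -> : wexp j - 1 = (1 + j) * (expR (- j) - 1 - (- j)) - j ^+ 2.
  by rewrite /wexp; ring.
have /andP[h1 h2] := expR_sub2_bound (- j); rewrite sqrrN normrN in h2.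
have j2 : 0 <= j ^+ 2 by exact: sqr_ge0.
have eM : expR `|j| <= expR M by rewrite ler_expR.
have -> : wcst M * j ^+ 2 = (1 + M) * expR M * j ^+ 2 + j ^+ 2 by rewrite /wcst; ring.
apply: (le_trans (ler_normB _ _)); rewrite (ger0_norm j2) lerD2r.
rewrite normrM (ger0_norm h1) -mulrA; apply: ler_pM => //.
  by apply: le_trans (ler_normD _ _) _; rewrite normr1 lerD2l.
by apply: (le_trans h2); rewrite mulrC ler_wpM2r.
Qed.

Lemma wexp_bound2 j M : `|j| <= M -> `|wexp j - 1 + j ^+ 2 / 2| <= wcst M * `|j| ^+ 3.
Proof.
move=> jM; have M0 : 0 <= M by exact: le_trans jM.
have -> : wexp j - 1 + j ^+ 2 / 2 =
  (1 + j) * (expR (- j) - 1 - (- j) - (- j) ^+ 2 / 2) + j ^+ 3 / 2.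
  by rewrite /wexp; field.
have h := expR_sub3_bound (- j); rewrite normrN in h.
have j3 : 0 <= `|j| ^+ 3 by exact: exprn_ge0.
have eM : expR `|j| <= expR M by rewrite ler_expR.
have -> : wcst M * `|j| ^+ 3 = (1 + M) * expR M * `|j| ^+ 3 + `|j| ^+ 3.
  by rewrite /wcst; ring.
apply: (le_trans (ler_normD _ _)); apply: lerD.
  rewrite normrM -mulrA; apply: ler_pM => //.
    by apply: le_trans (ler_normD _ _) _; rewrite normr1 lerD2l.
  by apply: (le_trans h); rewrite mulrC ler_wpM2r.
by rewrite normrM normrX [ `|2^-1| ]ger0_norm//; olra.
Qed.

End ExpBounds.

(** * Products over jumps *)

Section JumpProducts.
Variable R : realType.
Implicit Types (D : set R) (j : R -> R) (m M d : R).

Lemma bsum_ge0 D (u : R -> R) m : bsum D u m -> 0 <= m.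
Proof. by move=> h; have := h fset0; rewrite big_seq_fset0; apply. Qed.

Lemma bsum_le D (u v : R -> R) m c : 0 <= c -> bsum D u m ->
  (forall t, D t -> `|v t| <= c * `|u t|) -> bsum D v (c * m).
Proof.
move=> c0 h uv A hA; apply: (@le_trans _ _ (\sum_(t <- A) c * `|u t|)).
  rewrite big_seq [leRHS]big_seq; apply: ler_sum => t tA.
  exact/uv/hA.
by rewrite -mulr_sumr ler_wpM2l//; apply: h.
Qed.

Lemma bsum_wexp D j m M : bsum D (fun t => j t ^+ 2) m -> 0 <= M ->
  (forall t, D t -> `|j t| <= M) ->
  bsum D (fun t => wexp (j t) - 1) (wcst M * m).
Proof.
move=> h M0 jM; apply: bsum_le h _ => [|t Dt]; first exact/ltW/wcst_gt0.
by rewrite [ `|j t ^+ 2| ]ger0_norm ?sqr_ge0//; apply: wexp_bound1; exact: jM.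
Qed.

(** The last bound, with [d] the size of the jumps, carries the second-order
    term that restores the jump part of the bracket in the expansion of the
    exponential. *)
Lemma uprod_wexp_bounds D j m M : bsum D (fun t => j t ^+ 2) m -> 0 <= M ->
  (forall t, D t -> `|j t| <= M) ->
  let P := uncond_prod D (fun t => wexp (j t)) in let k := wcst M * m in
  [/\ `|P| <= expR k, `|P - 1| <= k * expR k &
   forall d, 0 <= d -> (forall t, D t -> `|j t| <= d) ->
     `|P - 1 + 2^-1 * uncond_sum D (fun t => j t ^+ 2)|
        <= k ^+ 2 * expR k + wcst M * d * m].
Proof.
move=> h M0 jM P k; have hw := bsum_wexp h M0 jM.
have k0 : 0 <= k by exact: bsum_ge0 hw.
have [h1 h2 h3] := uprod_bounds hw; split=> //.
  apply: (le_trans h2); have := expR_sub1_bound k.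
  by rewrite (ger0_norm k0) => /(le_trans _); apply; exact: ler_norm.
move=> d d0 jd; rewrite -/P -/k in h3.
have w0 := ltW (wcst_gt0 M0).
have hv : bsum D (fun t => wexp (j t) - 1 + 2^-1 * j t ^+ 2) (wcst M * d * m).
  apply: bsum_le h _ => [|t Dt]; first exact: mulr_ge0.
  rewrite [2^-1 * _]mulrC; apply: (le_trans (wexp_bound2 (jM t Dt))).
  rewrite -mulrA ler_wpM2l// exprS normrX ler_wpM2r ?exprn_ge0//.
  exact: jd.
have E := usum_lin hw h hv (c := 2^-1) (fun t => erefl).
have := usum_le hv; rewrite E => h4.
have /andP[_ h5] := expR_sub2_bound k; rewrite (ger0_norm k0) in h5.
have -> : P - 1 + 2^-1 * uncond_sum D (fun t => j t ^+ 2) =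
  (P - 1 - uncond_sum D (fun t => wexp (j t) - 1)) +
  (uncond_sum D (fun t => wexp (j t) - 1)
   + 2^-1 * uncond_sum D (fun t => j t ^+ 2)) by ring.
apply: (le_trans (ler_normD _ _)); apply: lerD => //.
exact: le_trans h3 h5.
Qed.

End JumpProducts.

(** * Jumps of a function with quadratic variation *)

Section Exponential.
Variables (R : realType) (a b : R) (lambda : nat -> seq R) (f B : R -> R).
Hypothesis ab : a < b.
Hypothesis lamP : in_Lambda a b lambda.
Hypothesis fB : is_qcov a b lambda f f B.
Local Notation lsum := (lsum lambda).
Local Notation ulam := (ulam a lambda).

Lemma qvar_flat : flat_reg a b f.
Proof. by case: fB => /regulated_flat. Qed.

Lemma qvar_lim s t : a <= s -> s < t -> t <= b ->
  lsum (fun x y => (f y - f x) ^+ 2) s t @ \oo --> B t - B s.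
Proof.
move=> as_ st tb; case: fB => _ _ _ _ /(_ s t as_ st tb)[h _ _].
apply: cvg_trans h; apply: near_eq_cvg; near=> m.
by rewrite partition_sumE /lsum.
Unshelve. all: by end_near. Qed.

(** Sums of squares are nonnegative, and so are their limits. *)
Lemma qvar_nd : nondec a b B.
Proof.
move=> x y ax; rewrite le_eqVlt => /orP[/eqP ->//|xy] yb.
rewrite -subr_ge0; apply: (cvgr_to_ge (qvar_lim ax xy yb)).
near=> m; rewrite -(psum0 x (partition_restr x y (lambda m))).
by apply: ler_psum => [|? ? ? ? ?]; [exact: (restr_path lamP _ xy)|exact: sqr_ge0].
Unshelve. all: by end_near. Qed.

Lemma qvar_left_jump z : a < z <= b -> left_jump B z = left_jump f z ^+ 2.
Proof.
move=> /andP[az zb]; case: fB => _ _ _ _ /(_ a z (lexx a) az zb)[_ -> _].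
by rewrite expr2.
Qed.

Lemma qvar_right_jump z : a <= z < b -> right_jump B z = right_jump f z ^+ 2.
Proof.
move=> /andP[az zb]; case: fB => _ _ _ _ /(_ z b az zb (lexx b))[_ _ ->].
by rewrite expr2.
Qed.

Lemma left_sq_le s z : a <= s -> s < z -> z <= b -> left_jump f z ^+ 2 <= B z - B s.
Proof.
move=> as_ sz zb; rewrite -qvar_left_jump; last olra.
by rewrite /left_jump lerD2l lerN2; apply: nd_left_lim qvar_nd _ _ _.
Qed.

Lemma right_sq_le z t : a <= z -> z < t -> t <= b -> right_jump f z ^+ 2 <= B t - B z.
Proof.
move=> az zt tb; rewrite -qvar_right_jump; last olra.
by rewrite /right_jump lerD2r; apply: nd_right_lim qvar_nd _ _ _.
Qed.

Let jl t := left_jump f t ^+ 2.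
Let jr t := right_jump f t ^+ 2.

Lemma sq_norm_sum (j : R -> R) (A : {fset R}) :
  \sum_(t <- A) `|j t ^+ 2| = \sum_(t <- A) j t ^+ 2.
Proof. by apply: eq_bigr => t _; rewrite ger0_norm// sqr_ge0. Qed.

Lemma bsum_left x y : a <= x -> x <= y -> y <= b -> bsum `]x, y]%classic jl (B y - B x).
Proof.
move=> ax xy yb A hA; rewrite sq_norm_sum; apply: sum_jumps_left; last exact: xy.
- by move=> u v xu uv vy; apply: qvar_nd => //; olra.
- by move=> s z xs sz zy; apply: left_sq_le; olra.
- by move=> z /hA; rewrite /= in_itv.
Qed.

Lemma bsum_right x y : a <= x -> x <= y -> y <= b -> bsum `[x, y[%classic jr (B y - B x).
Proof.
move=> ax xy yb A hA; rewrite sq_norm_sum; apply: sum_jumps_right; last exact: xy.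
- by move=> u v xu uv vy; apply: qvar_nd => //; olra.
- by move=> s z xs sz zy; apply: right_sq_le; olra.
- by move=> z /hA; rewrite /= in_itv.
Qed.

(* The bracket with its jump at [z] removed. *)
Let Vl z t := if t < z then B t else left_lim B z.
Let Vr z t := if z < t then B t else right_lim B z.

Lemma Vl_nd x z : a <= x -> x < z -> z <= b -> nondec x z (Vl z).
Proof.
move=> ax xz zb u v xu uv vz; rewrite /Vl; case: (ltP v z) => vz'.
  by rewrite (le_lt_trans uv vz'); apply: qvar_nd => //; olra.
case: (ltP u z) => uz //; apply: nd_left_lim qvar_nd _ _ _ => //; olra.
Qed.

Lemma Vr_nd z y : a <= z -> z < y -> y <= b -> nondec z y (Vr z).
Proof.
move=> az zy yb u v zu uv vy; rewrite /Vr; case: (ltP z u) => zu'.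
  by rewrite (lt_le_trans zu' uv); apply: qvar_nd => //; olra.
case: (ltP z v) => zv //; apply: nd_right_lim qvar_nd _ _ _ => //; olra.
Qed.

(** On intervals that exclude the endpoint [z] the bound improves to an
    increment of [B] without its jump at [z]; so these sums tend to 0 as the
    interval shrinks to [z]. *)
Lemma bsum_left_open x z : a <= x -> x < z -> z <= b ->
  bsum `]x, z[%classic jl (left_lim B z - B x).
Proof.
move=> ax xz zb A hA; rewrite sq_norm_sum.
have -> : left_lim B z - B x = Vl z z - Vl z x by rewrite /Vl ltxx xz.
apply: sum_jumps_open; [exact: Vl_nd|..|exact: ltW].
- move=> s u t xs su ut tz; rewrite /Vl tz (lt_trans su (lt_trans ut tz)).
  have := left_sq_le (s := s) (z := u) ltac:(olra) su ltac:(olra).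
  by have := qvar_nd (x := u) (y := t) ltac:(olra) (ltW ut) ltac:(olra); rewrite /jl; olra.
- by move=> u /hA; rewrite /= in_itv.
Qed.

Lemma bsum_right_lopen x z : a <= x -> x < z -> z <= b ->
  bsum `[x, z[%classic jr (left_lim B z - B x).
Proof.
move=> ax xz zb A hA; rewrite sq_norm_sum.
have -> : left_lim B z - B x = Vl z z - Vl z x by rewrite /Vl ltxx xz.
apply: sum_jumps_right; [exact: Vl_nd|..|exact: ltW].
- move=> s t xs st tz; have sz := lt_le_trans st tz.
  have := right_sq_le (z := s) (t := (s + t) / 2) ltac:(olra) ltac:(olra) ltac:(olra).
  have nV := Vl_nd ax xz zb; have := nV ((s + t) / 2) t ltac:(olra) ltac:(olra) tz.
  rewrite /Vl sz; have -> : (s + t) / 2 < z by olra.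
  by rewrite /jr; olra.
- by move=> u /hA; rewrite /= in_itv.
Qed.

Lemma bsum_left_ropen z y : a <= z -> z < y -> y <= b ->
  bsum `]z, y]%classic jl (B y - right_lim B z).
Proof.
move=> az zy yb A hA; rewrite sq_norm_sum.
have -> : B y - right_lim B z = Vr z y - Vr z z by rewrite /Vr ltxx zy.
apply: sum_jumps_left; [exact: Vr_nd|..|exact: ltW].
- move=> s t zs st ty; have zt := le_lt_trans zs st.
  have := left_sq_le (s := (s + t) / 2) (z := t) ltac:(olra) ltac:(olra) ltac:(olra).
  have nV := Vr_nd az zy yb; have := nV s ((s + t) / 2) zs ltac:(olra) ltac:(olra).
  rewrite /Vr zt; have -> : z < (s + t) / 2 by olra.
  by rewrite /jl; olra.
- by move=> u /hA; rewrite /= in_itv.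
Qed.

Lemma bsum_right_open z y : a <= z -> z < y -> y <= b ->
  bsum `]z, y[%classic jr (B y - right_lim B z).
Proof.
move=> az zy yb A hA; rewrite sq_norm_sum.
have -> : B y - right_lim B z = Vr z y - Vr z z by rewrite /Vr ltxx zy.
apply: sum_jumps_open; [exact: Vr_nd|..|exact: ltW].
- move=> s u t zs su ut ty; rewrite /Vr zs (lt_trans zs (lt_trans su ut)).
  have := right_sq_le (z := u) (t := t) ltac:(olra) ut ltac:(olra).
  by have := qvar_nd (x := s) (y := u) ltac:(olra) (ltW su) ltac:(olra); rewrite /jr; olra.
- by move=> u /hA; rewrite /= in_itv.
Qed.

End Exponential.

(** * Expansion of one step *)

Section Algebra.
Variable R : realType.
Implicit Types (d m q Jl Jr Pl Pr Om De dl : R).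

Lemma prod_sub1 Pl Pr (c1 : R) m : 0 <= c1 -> 0 <= m ->
  `|Pl - 1| <= c1 * m -> `|Pr - 1| <= c1 * m ->
  `|Pl * Pr - 1| <= c1 ^+ 2 * m ^+ 2 + 2 * c1 * m.
Proof.
move=> c0 m0 hl hr.
have -> : Pl * Pr - 1 = (Pl - 1) * (Pr - 1) + (Pl - 1) + (Pr - 1) by ring.
have h := ler_pM (normr_ge0 _) (normr_ge0 _) hl hr.
apply: (le_trans (ler_normD _ _)); have := ler_normD ((Pl - 1) * (Pr - 1)) (Pl - 1).
rewrite normrM; have -> : c1 ^+ 2 * m ^+ 2 = c1 * m * (c1 * m) by ring.
olra.
Qed.

(** Here [d], [m] and [q] stand for the increments of [f], of its bracket and
    of the continuous part of the bracket, [Pl] and [Pr] for the products over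
    left and right jumps. In contrast to [exp_increment2], [d] and [m] need
    not be small. *)
Lemma exp_increment1 Om De (c1 : R) : 0 <= Om -> 0 <= De -> 0 <= c1 ->
  exists2 C, 0 < C & forall d m q Pl Pr, `|d| <= De -> 0 <= m -> m <= Om ->
  `|q| <= m -> `|Pl - 1| <= c1 * m -> `|Pr - 1| <= c1 * m ->
  `|expR (d - 2^-1 * q) * Pl * Pr - 1 - d| <= C * (d ^+ 2 + m).
Proof.
move=> O0 D0 c0; pose E := expR (De + Om); have E0 : 0 < E by exact: expR_gt0.
pose C := 2 * E + (E * Om + 1 + E * (c1 ^+ 2 * Om + 2 * c1)).
have c11 : 0 <= c1 ^+ 2 by exact: sqr_ge0.
have X0 : 0 <= E * Om by rewrite mulr_ge0// ltW.
have Y0 : 0 <= E * (c1 ^+ 2 * Om + 2 * c1).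
  by rewrite mulr_ge0 ?(ltW E0)// addr_ge0// mulr_ge0.
exists C; first by rewrite /C; olra.
move=> d m q Pl Pr hd m0 mO hq hl hr.
set u := d - _; have hu : `|u| <= De + Om.
  by move: hd hq; rewrite /u !ler_norml; olra.
have eu : expR `|u| <= E by rewrite ler_expR.
have eu' : expR u <= E by rewrite ler_expR; apply: le_trans (ler_norm _) hu.
have hP := prod_sub1 c0 m0 hl hr.
have q2 : q ^+ 2 <= Om * m.
  have -> : q ^+ 2 = `|q| ^+ 2 by rewrite real_normK ?num_real.
  by rewrite expr2; apply: ler_pM => //; olra.
have u2 : u ^+ 2 <= 2 * d ^+ 2 + Om * m.
  have : 0 <= (d + 2^-1 * q) ^+ 2 by exact: sqr_ge0.
  rewrite /u; nra.
have T1 : `|expR u - 1 - u| <= (2 * d ^+ 2 + Om * m) * E.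
  have /andP[h1 h2] := expR_sub2_bound u; rewrite ger0_norm//.
  apply: (le_trans h2); by apply: ler_pM; rewrite ?sqr_ge0 ?expR_ge0.
have T3 : `|expR u * (Pl * Pr - 1)| <= E * ((c1 ^+ 2 * Om + 2 * c1) * m).
  rewrite normrM (ger0_norm (expR_ge0 _)); apply: ler_pM; rewrite ?expR_ge0//.
  apply: (le_trans hP); rewrite [leRHS]mulrDl lerD2r -mulrA ler_wpM2l// expr2.
  by rewrite ler_wpM2r.
have -> : expR u * Pl * Pr - 1 - d =
   (expR u - 1 - u) - 2^-1 * q + expR u * (Pl * Pr - 1) by rewrite /u; ring.
have T2 : `|2^-1 * q| <= m by move: hq; rewrite !ler_norml; olra.
have d2 : 0 <= d ^+ 2 by exact: sqr_ge0.
apply: (@le_trans _ _ ((2 * d ^+ 2 + Om * m) * E + m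
   + E * ((c1 ^+ 2 * Om + 2 * c1) * m))).
  apply: (le_trans (ler_normD _ _)); apply: lerD => //.
  apply: (le_trans (ler_normB _ _)); exact: lerD.
rewrite /C; set X := E * Om in X0 *; set Y := E * (_ + _) in Y0 *.
have -> : (2 * d ^+ 2 + Om * m) * E + m + E * ((c1 ^+ 2 * Om + 2 * c1) * m) =
   2 * E * d ^+ 2 + (X + 1 + Y) * m by rewrite /X /Y; ring.
by nra.
Qed.

(** With [Jl] and [Jr] the sums of squared jumps, [q = m - Jl - Jr] and the
    products are close to [1 - Jl / 2] and [1 - Jr / 2]. So exp (d - q / 2) Pl
    Pr is close to 1 + d - m / 2 + d^2 / 2: the jumps cancel. *)
Lemma exp_increment2 (c1 c2 : R) : 0 <= c1 -> 0 <= c2 ->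
  exists2 C, 0 < C & forall dl d m q Jl Jr Pl Pr, 0 <= dl -> dl <= 1 ->
  `|d| <= dl -> 0 <= m -> m <= dl -> q = m - Jl - Jr ->
  `|q| <= m -> `|Pl - 1| <= c1 * m -> `|Pr - 1| <= c1 * m ->
  `|Pl - 1 + 2^-1 * Jl| <= c2 * dl * m -> `|Pr - 1 + 2^-1 * Jr| <= c2 * dl * m ->
  `|expR (d - 2^-1 * q) * Pl * Pr - 1 - d - 2^-1 * (d ^+ 2 - m)|
     <= C * dl * (d ^+ 2 + m).
Proof.
move=> c0 c20; pose E := expR (2 : R); have E0 : 0 < E by exact: expR_gt0.
pose C := 4 * E + (2 * E + 1 + 2 * c2 + c1 ^+ 2 + 2 * E * (c1 ^+ 2 + 2 * c1)).
have c11 : 0 <= c1 ^+ 2 by exact: sqr_ge0.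
have Y0 : 0 <= 2 * E * (c1 ^+ 2 + 2 * c1).
  by rewrite mulr_ge0 ?addr_ge0//; olra.
exists C; first by rewrite /C; olra.
move=> dl d m q Jl Jr Pl Pr dl0 dl1 hd m0 mdl qE hq hl hr hl2 hr2.
set u := d - _; have hu : `|u| <= 2 * dl.
  by move: hd hq; rewrite /u !ler_norml; olra.
have eu : expR `|u| <= E by rewrite ler_expR; olra.
have hP := prod_sub1 c0 m0 hl hr.
have mm : m ^+ 2 <= dl * m by rewrite expr2 ler_wpM2r.
have mm1 : m ^+ 2 <= m by apply: (le_trans mm); rewrite ler_piMl.
have q2 : q ^+ 2 <= m ^+ 2.
  by rewrite -(@real_normK _ q) ?num_real// lerXn2r ?nnegrE.
have u2 : u ^+ 2 <= 2 * d ^+ 2 + m.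
  have : 0 <= (d + 2^-1 * q) ^+ 2 by exact: sqr_ge0.
  rewrite /u; nra.
have u0 := normr_ge0 u.
have S1 : `|expR u - 1 - u - u ^+ 2 / 2| <= 2 * dl * (2 * d ^+ 2 + m) * E.
  apply: (le_trans (expR_sub3_bound u)); apply: ler_pM; rewrite ?expR_ge0 ?exprn_ge0//.
  rewrite exprS; apply: ler_pM => //; rewrite ?exprn_ge0//.
  by rewrite real_normK ?num_real.
have S2 : `|2^-1 * (q * (2^-2 * q - d))| <= dl * m.
  rewrite !normrM.
  have h1 : `|2^-2 * q - d| <= 2 * dl.
    by move: hd hq; rewrite !ler_norml; olra.
  have := ler_pM (normr_ge0 _) (normr_ge0 _) hq h1.
  by rewrite (@ger0_norm _ 2^-1)//; olra.
have S3 : `|(Pl - 1 + 2^-1 * Jl) + (Pr - 1 + 2^-1 * Jr) + (Pl - 1) * (Pr - 1)|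
     <= (2 * c2 + c1 ^+ 2) * (dl * m).
  have h := ler_pM (normr_ge0 _) (normr_ge0 _) hl hr; rewrite -normrM in h.
  have : c1 * m * (c1 * m) <= c1 ^+ 2 * (dl * m).
    have -> : c1 * m * (c1 * m) = c1 ^+ 2 * m ^+ 2 by ring.
    by rewrite ler_wpM2l.
  by move: h hl2 hr2; rewrite !ler_norml; olra.
have S4 : `|(expR u - 1) * (Pl * Pr - 1)| <= 2 * dl * E * ((c1 ^+ 2 + 2 * c1) * m).
  rewrite normrM; apply: ler_pM => //.
    apply: (le_trans (expR_sub1_bound u)); by apply: ler_pM; rewrite ?expR_ge0.
  by apply: (le_trans hP); rewrite [leRHS]mulrDl lerD2r ler_wpM2l.
have -> : expR u * Pl * Pr - 1 - d - 2^-1 * (d ^+ 2 - m) =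
   (expR u - 1 - u - u ^+ 2 / 2) + 2^-1 * (q * (2^-2 * q - d))
   + ((Pl - 1 + 2^-1 * Jl) + (Pr - 1 + 2^-1 * Jr) + (Pl - 1) * (Pr - 1))
   + (expR u - 1) * (Pl * Pr - 1).
  have mE : m = q + Jl + Jr by rewrite qE; ring.
  by rewrite mE /u; field.
have d2 : 0 <= d ^+ 2 by exact: sqr_ge0.
have dm0 : 0 <= dl * m by exact: mulr_ge0.
have dd0 : 0 <= dl * d ^+ 2 by exact: mulr_ge0.
apply: (@le_trans _ _ (2 * dl * (2 * d ^+ 2 + m) * E + dl * m
   + (2 * c2 + c1 ^+ 2) * (dl * m) + 2 * dl * E * ((c1 ^+ 2 + 2 * c1) * m))).
  apply: (le_trans (ler_normD _ _)); apply: lerD => //.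
  apply: (le_trans (ler_normD _ _)); apply: lerD => //.
  apply: (le_trans (ler_normD _ _)); exact: lerD.
rewrite /C; set Y := 2 * E * (_ + _) in Y0 *.
have -> : 2 * dl * (2 * d ^+ 2 + m) * E + dl * m + (2 * c2 + c1 ^+ 2) * (dl * m)
   + 2 * dl * E * ((c1 ^+ 2 + 2 * c1) * m) =
   4 * E * (dl * d ^+ 2) + (2 * E + 1 + (2 * c2 + c1 ^+ 2) + Y) * (dl * m).
  by rewrite /Y; ring.
set X := dl * d ^+ 2 in dd0 *; set Z := dl * m in dm0 *.
have -> : forall c : R, c * dl * (d ^+ 2 + m) = c * X + c * Z.
  by move=> c; rewrite /X /Z; ring.
by nra.
Qed.

End Algebra.

(** * The evolution factor *)

Section Evolution.
Variables (R : realType) (a b : R) (lambda : nat -> seq R) (f B : R -> R).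
Hypothesis ab : a < b.
Hypothesis lamP : in_Lambda a b lambda.
Hypothesis fB : is_qcov a b lambda f f B.
Local Notation ulam := (ulam a lambda).
Local Notation lj := (left_jump f).
Local Notation rj := (right_jump f).

Definition jump_sum_left x y := uncond_sum `]x, y]%classic (fun t => lj t ^+ 2).
Definition jump_sum_right x y := uncond_sum `[x, y[%classic (fun t => rj t ^+ 2).
Definition jump_prod_left x y := uncond_prod `]x, y]%classic (fun t => wexp (lj t)).
Definition jump_prod_right x y := uncond_prod `[x, y[%classic (fun t => wexp (rj t)).

(** The increment of the continuous part of the bracket. *)
Definition dcont x y := B y - B x - jump_sum_left x y - jump_sum_right x y.

(** The Doléans exponential on [[x, y]] with initial value 1. *)
Definition evo x y := expR (f y - f x - 2^-1 * dcont x y)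
  * jump_prod_left x y * jump_prod_right x y.

Let bl := bsum_left lamP fB.
Let br := bsum_right lamP fB.

Lemma jump_bound : exists2 M, 0 <= M &
  (forall t, a < t <= b -> `|lj t| <= M) /\ (forall t, a <= t < b -> `|rj t| <= M).
Proof.
have fr := qvar_flat fB; have [M M0 fM] := flat_reg_bounded ab fr.
exists (2 * M); first olra; split=> t tab.
- rewrite -[lj t]subr0; apply: (left_lim_dist (f := fun x => f t - f x) (c := a) (z := t)).
  + by case/andP: tab.
  + exact: left_cvg_jump fr tab.
  + move=> x xt; rewrite subr0; have := fM t ltac:(olra); have := fM x ltac:(olra).
    by rewrite !ler_norml; olra.
- rewrite -[rj t]subr0; apply: (right_lim_dist (f := fun x => f x - f t) (c := b) (z := t)).
  + by case/andP: tab.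
  + exact: right_cvg_jump fr tab.
  + move=> x xt; rewrite subr0; have := fM t ltac:(olra); have := fM x ltac:(olra).
    by rewrite !ler_norml; olra.
Qed.

Lemma bsum_wleft x y : a <= x -> x <= y -> y <= b ->
  exists m, bsum `]x, y]%classic (fun t => wexp (lj t) - 1) m.
Proof.
move=> ax xy yb; have [M M0 [hl _]] := jump_bound.
exists (wcst M * (B y - B x)); apply: bsum_wexp (bl ax xy yb) M0 _ => t.
by rewrite /= in_itv /= => txy; apply: hl; olra.
Qed.

Lemma bsum_wright x y : a <= x -> x <= y -> y <= b ->
  exists m, bsum `[x, y[%classic (fun t => wexp (rj t) - 1) m.
Proof.
move=> ax xy yb; have [M M0 [_ hr]] := jump_bound.
exists (wcst M * (B y - B x)); apply: bsum_wexp (br ax xy yb) M0 _ => t.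
by rewrite /= in_itv /= => txy; apply: hr; olra.
Qed.

Lemma split_oc (x y z t : R) : x <= y -> y <= z ->
  `]x, z]%classic t <-> `]x, y]%classic t \/ `]y, z]%classic t.
Proof.
move=> xy yz; rewrite /= !in_itv /=; split; olra.
Qed.

Lemma split_co (x y z t : R) : x <= y -> y <= z ->
  `[x, z[%classic t <-> `[x, y[%classic t \/ `[y, z[%classic t.
Proof.
move=> xy yz; rewrite /= !in_itv /=; split; olra.
Qed.

Lemma disj_oc (x y z t : R) : `]x, y]%classic t -> ~ `]y, z]%classic t.
Proof. by rewrite /= !in_itv /= => h1 h2; olra. Qed.

Lemma disj_co (x y z t : R) : `[x, y[%classic t -> ~ `[y, z[%classic t.
Proof. by rewrite /= !in_itv /= => h1 h2; olra. Qed.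

Lemma dcont_add x y z : a <= x -> x <= y -> y <= z -> z <= b ->
  dcont x z = dcont x y + dcont y z.
Proof.
move=> ax xy yz zb; have xz := le_trans xy yz; have ay := le_trans ax xy.
have yb := le_trans yz zb.
rewrite /dcont /jump_sum_left /jump_sum_right.
rewrite (usum_split (bl ax xz zb) (bl ax xy yb) (bl ay yz zb)
  (fun t => split_oc t xy yz) (@disj_oc x y z)).
rewrite (usum_split (br ax xz zb) (br ax xy yb) (br ay yz zb)
  (fun t => split_co t xy yz) (@disj_co x y z)).
ring.
Qed.

Lemma evo_mul x y z : a <= x -> x <= y -> y <= z -> z <= b ->
  evo x z = evo x y * evo y z.
Proof.
move=> ax xy yz zb; have xz := le_trans xy yz; have ay := le_trans ax xy.
have yb := le_trans yz zb.
have [m1 h1] := bsum_wleft ax xz zb; have [m2 h2] := bsum_wleft ax xy yb.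
have [m3 h3] := bsum_wleft ay yz zb.
have [n1 k1] := bsum_wright ax xz zb; have [n2 k2] := bsum_wright ax xy yb.
have [n3 k3] := bsum_wright ay yz zb.
rewrite /evo (dcont_add ax xy yz zb) /jump_prod_left /jump_prod_right.
rewrite (uprod_split h1 h2 h3 (fun t => split_oc t xy yz) (@disj_oc x y z)).
rewrite (uprod_split k1 k2 k3 (fun t => split_co t xy yz) (@disj_co x y z)).
have -> : f z - f x - 2^-1 * (dcont x y + dcont y z) =
  (f y - f x - 2^-1 * dcont x y) + (f z - f y - 2^-1 * dcont y z) by ring.
have reorder (e1 e2 p1 p2 r1 r2 : R) :
  e1 * e2 * (p1 * p2) * (r1 * r2) = e1 * p1 * r1 * (e2 * p2 * r2) by ring.
by rewrite expRD reorder.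
Qed.

Lemma evo_xx x : a <= x <= b -> evo x x = 1.
Proof.
move=> /andP[ax xb]; have bl0 := bl ax (lexx x) xb; have br0 := br ax (lexx x) xb.
rewrite subrr in bl0 br0.
have [M M0 [hl hr]] := jump_bound.
have wl0 := bsum_wexp bl0 M0; have wr0 := bsum_wexp br0 M0.
have [|_ /=] := uprod_wexp_bounds bl0 M0.
  by move=> t; rewrite /= in_itv /= => ?; apply: hl; olra.
rewrite mulr0 mul0r normr_le0 subr_eq0 => /eqP pl _.
have [|_ /=] := uprod_wexp_bounds br0 M0.
  by move=> t; rewrite /= in_itv /= => ?; apply: hr; olra.
rewrite mulr0 mul0r normr_le0 subr_eq0 => /eqP pr _.
rewrite /evo /jump_prod_left /jump_prod_right pl pr /dcont.
have := usum_le bl0; rewrite normr_le0 => /eqP; rewrite -/(jump_sum_left x x) => ->.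
have := usum_le br0; rewrite normr_le0 => /eqP; rewrite -/(jump_sum_right x x) => ->.
by rewrite !(subrr, subr0, mulr0) expR0 !mulr1.
Qed.

(** Sums of squared jumps over [[x, y]] are at most the increment of [B]; this
    turns the bounds on products of [wexp] into bounds by increments of [B]
    with constants independent of the interval. *)
Lemma evo_data : exists c1 c2 : R, [/\ 0 <= c1, 0 <= c2 &
  forall x y, a <= x -> x <= y -> y <= b -> let m := B y - B x in
  [/\ 0 <= m, `|dcont x y| <= m,
     `|jump_prod_left x y - 1| <= c1 * m, `|jump_prod_right x y - 1| <= c1 * m &
   forall dl, 0 <= dl -> m <= dl ->
     (forall t, x < t <= y -> `|lj t| <= dl) -> (forall t, x <= t < y -> `|rj t| <= dl) ->
     `|jump_prod_left x y - 1 + 2^-1 * jump_sum_left x y| <= c2 * dl * m /\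
     `|jump_prod_right x y - 1 + 2^-1 * jump_sum_right x y| <= c2 * dl * m]].
Proof.
have [M M0 [hl hr]] := jump_bound; have Bn := qvar_nd lamP fB.
pose Om := B b - B a; pose w := wcst M; have w0 : 0 < w by exact: wcst_gt0.
have O0 : 0 <= Om by rewrite subr_ge0; apply: Bn; rewrite ?(ltW ab).
pose E := expR (w * Om); have E0 : 0 < E by exact: expR_gt0.
have w20 : 0 <= w ^+ 2 by exact: sqr_ge0.
exists (w * E), (w ^+ 2 * E + w); split.
- by rewrite mulr_ge0// ltW.
- by rewrite addr_ge0 ?mulr_ge0// ltW.
move=> x y ax xy yb m.
have m0 : 0 <= m by rewrite subr_ge0; exact: Bn.
have mO : m <= Om.
  have := Bn a x (lexx a) ax ltac:(olra); have := Bn y b ltac:(olra) yb (lexx b).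
  by rewrite /m /Om; olra.
have eE : expR (w * m) <= E by rewrite ler_expR ler_wpM2l// ltW.
have hlx t : `]x, y]%classic t -> `|lj t| <= M.
  by rewrite /= in_itv /= => ?; apply: hl; olra.
have hrx t : `[x, y[%classic t -> `|rj t| <= M.
  by rewrite /= in_itv /= => ?; apply: hr; olra.
have [_ pl1 pl2] := uprod_wexp_bounds (bl ax xy yb) M0 hlx.
have [_ pr1 pr2] := uprod_wexp_bounds (br ax xy yb) M0 hrx.
have wm0 : 0 <= w * m by rewrite mulr_ge0// ltW.
have le1 : w * m * expR (w * m) <= w * E * m.
  by rewrite [leRHS]mulrAC ler_wpM2l.
split=> //.
- have h1 := usum_le (bl ax xy yb); have h2 := usum_le (br ax xy yb).
  have h3 := usum_ge0 (bl ax xy yb) (fun t => sqr_ge0 (lj t)).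
  have h4 := usum_ge0 (br ax xy yb) (fun t => sqr_ge0 (rj t)).
  move: h1 h2; rewrite (ger0_norm h3) (ger0_norm h4).
  rewrite -/(jump_sum_left x y) -/(jump_sum_right x y) -/m => h1 h2.
  rewrite /dcont -/m ler_norml.
  rewrite -/(jump_sum_left x y) in h3; rewrite -/(jump_sum_right x y) in h4; olra.
- exact: le_trans pl1 le1.
- exact: le_trans pr1 le1.
- move=> dl dl0 mdl jl jr.
  have le2 : (w * m) ^+ 2 * expR (w * m) + w * dl * m <= (w ^+ 2 * E + w) * dl * m.
    have -> : (w ^+ 2 * E + w) * dl * m = w ^+ 2 * (dl * m) * E + w * dl * m by ring.
    rewrite lerD2r exprMn; apply: ler_pM;
      first [exact: expR_ge0|exact: eE|by rewrite mulr_ge0 ?sqr_ge0|idtac].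
    by apply: ler_wpM2l => //; rewrite expr2; apply: ler_wpM2r.
  split.
  + apply: le_trans (pl2 dl dl0 _) le2 => t; rewrite /= in_itv /=; exact: jl.
  + apply: le_trans (pr2 dl dl0 _) le2 => t; rewrite /= in_itv /=; exact: jr.
Qed.

(** The equation dE = E df requires weighted sums of this error to be
    negligible. *)
Definition evo_err x y := evo x y - 1 - (f y - f x).

Lemma evo_err_bound : exists2 C, 0 < C & forall x y, a <= x -> x <= y -> y <= b ->
  `|evo_err x y| <= C * ((f y - f x) ^+ 2 + (B y - B x)).
Proof.
have [c1 [c2 [c10 c20 H]]] := evo_data; have Bn := qvar_nd lamP fB.
have [M M0 fM] := flat_reg_bounded ab (qvar_flat fB).
have O0 : 0 <= B b - B a by rewrite subr_ge0; apply: Bn; rewrite ?(ltW ab).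
have M20 : 0 <= 2 * M by olra.
have [C C0 HC] := exp_increment1 O0 M20 c10; exists C => // x y ax xy yb.
have [m0 hq pl pr _] := H x y ax xy yb.
rewrite /evo_err /evo; apply: HC => //.
- by have := fM x ltac:(olra); have := fM y ltac:(olra); rewrite !ler_norml; olra.
- have := Bn a x (lexx a) ax ltac:(olra).
  by have := Bn y b ltac:(olra) yb (lexx b); olra.
Qed.

Lemma flat_left_jump (dl s t z : R) : a <= s -> t <= b -> flat dl f s t ->
  s < z < t -> `|lj z| <= dl.
Proof.
move=> as_ tb fl /andP[sz zt]; rewrite -[lj z]subr0.
apply: (left_lim_dist (f := fun x => f z - f x) sz).
  by apply: left_cvg_jump (qvar_flat fB) _; olra.
by move=> x xz; rewrite subr0; apply: fl; olra.
Qed.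

Lemma flat_right_jump (dl s t z : R) : a <= s -> t <= b -> flat dl f s t ->
  s < z < t -> `|rj z| <= dl.
Proof.
move=> as_ tb fl /andP[sz zt]; rewrite -[rj z]subr0.
apply: (right_lim_dist (f := fun x => f x - f z) zt).
  by apply: right_cvg_jump (qvar_flat fB) _; olra.
by move=> x xz; rewrite subr0; apply: fl; olra.
Qed.

(** Short open intervals make the increments of [f] and [B] and all jumps
    inside small, as [exp_increment2] requires. *)
Lemma evo_err_local (e : R) : 0 < e -> locally_good a b (fun s t =>
  forall x y, s < x -> x < y -> y < t ->
  `|evo_err x y - 2^-1 * ((f y - f x) ^+ 2 - (B y - B x))|
     <= e * ((f y - f x) ^+ 2 + (B y - B x))).
Proof.
move=> e0; have [c1 [c2 [c10 c20 H]]] := evo_data; have Bn := qvar_nd lamP fB.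
have [C C0 HC] := exp_increment2 c10 c20.
pose dl := Num.min 1 (e / C).
have dl0 : 0 < dl by rewrite lt_min ltr01 divr_gt0.
have dl1 : dl <= 1 by rewrite ge_min lexx.
have dle : C * dl <= e.
  by rewrite mulrC -ler_pdivlMr// ge_min lexx orbT.
apply: locally_good_sub (locally_goodI (qvar_flat fB dl0) (nd_flat Bn dl0)) _.
move=> s t as_ st tb [fl Bl] x y sx xy yt.
have ax : a <= x by olra.
have yb : y <= b by olra.
have [m0 hq pl pr hd] := H x y ax (ltW xy) yb.
have mdl : B y - B x <= dl.
  by apply: le_trans (ler_norm _) _; apply: Bl; olra.
have jl0 t1 : x < t1 <= y -> `|lj t1| <= dl.
  by move=> ?; apply: flat_left_jump as_ tb fl _; olra.
have jr0 t1 : x <= t1 < y -> `|rj t1| <= dl.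
  by move=> ?; apply: flat_right_jump as_ tb fl _; olra.
have [hl2 hr2] := hd dl (ltW dl0) mdl jl0 jr0.
have S0 : 0 <= (f y - f x) ^+ 2 + (B y - B x) by rewrite addr_ge0// sqr_ge0.
apply: (@le_trans _ _ (C * dl * ((f y - f x) ^+ 2 + (B y - B x)))); last first.
  by rewrite ler_wpM2r.
rewrite /evo_err /evo.
apply: (HC dl (f y - f x) (B y - B x) (dcont x y) (jump_sum_left x y)
  (jump_sum_right x y)) => //; first exact: ltW.
by apply: fl; olra.
Qed.

(** The quantity [left_lim B z - B x] tends to 0; it bounds the contribution
    of the jumps strictly between [x] and [z]. *)
Lemma squeeze_left (F : R -> R) z l c : a < z <= b -> 0 <= c ->
  (forall x, a <= x -> x < z -> `|F x - l| <= c * (left_lim B z - B x)) ->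
  F x @[x --> z^'-] --> l.
Proof.
move=> zab c0 H; apply/cvg_leftP => e e0.
have e1 : 0 < e / (c + 1) by apply: divr_gt0 => //; olra.
have Br := nd_flat (qvar_nd lamP fB).
have /cvg_leftP/(_ _ e1)[d d0 hd] := regulated_left Br zab.
have m1 : Num.min d (z - a) <= d by rewrite ge_min lexx.
have m2 : Num.min d (z - a) <= z - a by rewrite ge_min lexx orbT.
exists (Num.min d (z - a)) => [|x xz]; first by rewrite lt_min d0; olra.
apply: (le_trans (H x _ _)); [olra|olra|].
have := hd x ltac:(olra); rewrite ler_norml => h.
have -> : e = (c + 1) * (e / (c + 1)) by field; olra.
have := nd_left_lim (qvar_nd lamP fB) (x := x) (y := z) ltac:(olra) ltac:(olra) ltac:(olra).
move=> h'; apply: ler_pM; olra.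
Qed.

Lemma squeeze_right (F : R -> R) z l c : a <= z < b -> 0 <= c ->
  (forall y, z < y -> y <= b -> `|F y - l| <= c * (B y - right_lim B z)) ->
  F x @[x --> z^'+] --> l.
Proof.
move=> zab c0 H; apply/cvg_rightP => e e0.
have e1 : 0 < e / (c + 1) by apply: divr_gt0 => //; olra.
have Br := nd_flat (qvar_nd lamP fB).
have /cvg_rightP/(_ _ e1)[d d0 hd] := regulated_right Br zab.
have m1 : Num.min d (b - z) <= d by rewrite ge_min lexx.
have m2 : Num.min d (b - z) <= b - z by rewrite ge_min lexx orbT.
exists (Num.min d (b - z)) => [|x xz]; first by rewrite lt_min d0; olra.
apply: (le_trans (H x _ _)); [olra|olra|].
have := hd x ltac:(olra); rewrite ler_norml => h.
have -> : e = (c + 1) * (e / (c + 1)) by field; olra.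
have := nd_right_lim (qvar_nd lamP fB) (x := z) (y := x) ltac:(olra) ltac:(olra) ltac:(olra).
move=> h'; apply: ler_pM; olra.
Qed.

Lemma wexp_mul (j : R) : expR j * wexp j = 1 + j.
Proof. by rewrite /wexp mulrCA -expRD subrr expR0 mulr1. Qed.

(** In the limit only the jump at [z] remains, with [expR j * wexp j = 1 +
    j]. *)
Lemma evo_left z : a < z <= b -> evo x z @[x --> z^'-] --> 1 + lj z.
Proof.
move=> zab; have [M M0 [hl hr]] := jump_bound.
have /andP[az zb] := zab; have Bn := qvar_nd lamP fB.
pose Om := B b - B a; pose w := wcst M; have w0 : 0 < w by exact: wcst_gt0.
pose E := expR (w * Om).
have etaO x : a <= x -> x < z -> 0 <= left_lim B z - B x <= Om.
  move=> ax xz; rewrite subr_ge0 (nd_left_lim Bn ax xz zb) /=.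
  have : left_lim B z <= B b.
    apply: (left_lim_le xz (regulated_left (nd_flat Bn) zab)) => u ux.
    by apply: Bn; olra.
  by have := Bn a x (lexx a) ax ltac:(olra); rewrite /Om; olra.
have wE x : a <= x -> x < z ->
    w * (left_lim B z - B x) * expR (w * (left_lim B z - B x))
      <= w * E * (left_lim B z - B x).
  move=> ax xz; have /andP[h1 h2] := etaO x ax xz.
  by rewrite [leRHS]mulrAC ler_wpM2l ?mulr_ge0 ?(ltW w0)// ler_expR ler_wpM2l// ltW.
have splitl x : x < z -> forall t, `]x, z]%classic t <-> `]x, z[%classic t \/ [set z] t.
  move=> xz t; rewrite /= !in_itv /=; split=> [/andP[xt tz]|[|->]]; [|olra|olra].
  by move: tz; rewrite le_eqVlt => /orP[/eqP ->|tz]; [right|left; rewrite xt].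
have disl x : forall t, `]x, z[%classic t -> ~ [set z] t.
  by move=> t; rewrite /= in_itv /= => h E'; rewrite E' ltxx andbF in h.
have c1 : jump_prod_left x z @[x --> z^'-] --> wexp (lj z).
  apply: (@squeeze_left _ _ _ (`|wexp (lj z)| * (w * E))) => //.
    by rewrite !mulr_ge0 ?expR_ge0 ?(ltW w0).
  move=> x ax xz; have bo := bsum_left_open lamP fB ax xz zb.
  have [m1 h1] := bsum_wleft ax (ltW xz) zb.
  have jb t : `]x, z[%classic t -> `|lj t| <= M.
    by rewrite /= in_itv /= => ?; apply: hl; olra.
  rewrite /jump_prod_left (uprod_split h1 (bsum_wexp bo M0 jb) (@bsum1 _ _ z)
    (splitl x xz) (@disl x)) uprod1.
  have [_ hp _] := uprod_wexp_bounds bo M0 jb.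
  rewrite -{2}[wexp (lj z)]mul1r -mulrBl normrM mulrC -!mulrA ler_wpM2l//.
  by rewrite mulrA; apply: le_trans hp (wE x ax xz).
have c2 : jump_prod_right x z @[x --> z^'-] --> (1 : R).
  apply: (@squeeze_left _ _ _ (w * E)) => //.
    by rewrite !mulr_ge0 ?expR_ge0 ?(ltW w0).
  move=> x ax xz; have bo := bsum_right_lopen lamP fB ax xz zb.
  have [|_ hp _] := uprod_wexp_bounds bo M0.
    by move=> t; rewrite /= in_itv /= => ?; apply: hr; olra.
  by apply: le_trans hp (wE x ax xz).
have c3 : dcont x z @[x --> z^'-] --> (0 : R).
  apply: (@squeeze_left _ _ _ 1) => //.
  move=> x ax xz; have bo := bsum_left_open lamP fB ax xz zb.
  have bo' := bsum_right_lopen lamP fB ax xz zb.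
  rewrite subr0 mul1r /dcont /jump_sum_left (usum_split (bl ax (ltW xz) zb) bo
    (@bsum1 _ _ z) (splitl x xz) (@disl x)) usum1 -(qvar_left_jump fB zab).
  have := usum_le bo; rewrite (ger0_norm (usum_ge0 bo (fun t => sqr_ge0 (lj t)))).
  have := usum_le bo'; rewrite (ger0_norm (usum_ge0 bo' (fun t => sqr_ge0 (rj t)))).
  have := usum_ge0 bo (fun t => sqr_ge0 (lj t)).
  have := usum_ge0 bo' (fun t => sqr_ge0 (rj t)).
  rewrite -/(jump_sum_right x z) /left_jump ler_norml; olra.
have c4 : (f z - f x - 2^-1 * dcont x z) @[x --> z^'-] --> lj z - 2^-1 * 0.
  apply: cvgB; first exact: left_cvg_jump (qvar_flat fB) zab.
  by apply: cvgM => //; exact: cvg_cst.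
rewrite mulr0 subr0 in c4.
have c5 : expR (f z - f x - 2^-1 * dcont x z) @[x --> z^'-] --> expR (lj z).
  by apply: continuous_cvg => //; exact: continuous_expR.
rewrite -wexp_mul -[X in _ --> X]mulr1.
exact: cvgM (cvgM c5 c1) c2.
Qed.

Lemma evo_right z : a <= z < b -> evo z y @[y --> z^'+] --> 1 + rj z.
Proof.
move=> zab; have [M M0 [hl hr]] := jump_bound.
have /andP[az zb] := zab; have Bn := qvar_nd lamP fB.
pose Om := B b - B a; pose w := wcst M; have w0 : 0 < w by exact: wcst_gt0.
pose E := expR (w * Om).
have etaO y : z < y -> y <= b -> 0 <= B y - right_lim B z <= Om.
  move=> zy yb; rewrite subr_ge0 (nd_right_lim Bn az zy yb) /=.
  have : B a <= right_lim B z.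
    apply: (right_lim_ge zy (regulated_right (nd_flat Bn) zab)) => u ux.
    by apply: Bn; olra.
  by have := Bn y b ltac:(olra) yb (lexx b); rewrite /Om; olra.
have wE y : z < y -> y <= b ->
    w * (B y - right_lim B z) * expR (w * (B y - right_lim B z))
      <= w * E * (B y - right_lim B z).
  move=> zy yb; have /andP[h1 h2] := etaO y zy yb.
  by rewrite [leRHS]mulrAC ler_wpM2l ?mulr_ge0 ?(ltW w0)// ler_expR ler_wpM2l// ltW.
have splitr y : z < y -> forall t, `[z, y[%classic t <-> `]z, y[%classic t \/ [set z] t.
  move=> zy t; rewrite /= !in_itv /=; split=> [/andP[zt ty]|[|->]]; [|olra|olra].
  by move: zt; rewrite le_eqVlt => /orP[/eqP ->|zt]; [right|left; rewrite ty zt].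
have disr y : forall t, `]z, y[%classic t -> ~ [set z] t.
  by move=> t; rewrite /= in_itv /= => h E'; rewrite E' ltxx in h.
have c1 : jump_prod_right z y @[y --> z^'+] --> wexp (rj z).
  apply: (@squeeze_right _ _ _ (`|wexp (rj z)| * (w * E))) => //.
    by rewrite !mulr_ge0 ?expR_ge0 ?(ltW w0).
  move=> y zy yb; have bo := bsum_right_open lamP fB az zy yb.
  have [m1 h1] := bsum_wright az (ltW zy) yb.
  have jb t : `]z, y[%classic t -> `|rj t| <= M.
    by rewrite /= in_itv /= => ?; apply: hr; olra.
  rewrite /jump_prod_right (uprod_split h1 (bsum_wexp bo M0 jb) (@bsum1 _ _ z)
    (splitr y zy) (@disr y)) uprod1.
  have [_ hp _] := uprod_wexp_bounds bo M0 jb.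
  rewrite -{2}[wexp (rj z)]mul1r -mulrBl normrM mulrC -!mulrA ler_wpM2l//.
  by rewrite mulrA; apply: le_trans hp (wE y zy yb).
have c2 : jump_prod_left z y @[y --> z^'+] --> (1 : R).
  apply: (@squeeze_right _ _ _ (w * E)) => //.
    by rewrite !mulr_ge0 ?expR_ge0 ?(ltW w0).
  move=> y zy yb; have bo := bsum_left_ropen lamP fB az zy yb.
  have [|_ hp _] := uprod_wexp_bounds bo M0.
    by move=> t; rewrite /= in_itv /= => ?; apply: hl; olra.
  by apply: le_trans hp (wE y zy yb).
have c3 : dcont z y @[y --> z^'+] --> (0 : R).
  apply: (@squeeze_right _ _ _ 1) => //.
  move=> y zy yb; have bo := bsum_right_open lamP fB az zy yb.
  have bo' := bsum_left_ropen lamP fB az zy yb.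
  rewrite subr0 mul1r /dcont /jump_sum_right (usum_split (br az (ltW zy) yb) bo
    (@bsum1 _ _ z) (splitr y zy) (@disr y)) usum1 -(qvar_right_jump fB zab).
  have := usum_le bo; rewrite (ger0_norm (usum_ge0 bo (fun t => sqr_ge0 (rj t)))).
  have := usum_le bo'; rewrite (ger0_norm (usum_ge0 bo' (fun t => sqr_ge0 (lj t)))).
  have := usum_ge0 bo (fun t => sqr_ge0 (rj t)).
  have := usum_ge0 bo' (fun t => sqr_ge0 (lj t)).
  rewrite -/(jump_sum_left z y) /right_jump ler_norml; olra.
have c4 : (f y - f z - 2^-1 * dcont z y) @[y --> z^'+] --> rj z - 2^-1 * 0.
  apply: cvgB; first exact: right_cvg_jump (qvar_flat fB) zab.
  by apply: cvgM => //; exact: cvg_cst.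
rewrite mulr0 subr0 in c4.
have c5 : expR (f y - f z - 2^-1 * dcont z y) @[y --> z^'+] --> expR (rj z).
  by apply: continuous_cvg => //; exact: continuous_expR.
rewrite -wexp_mul -[expR _ * _]mulr1 mulrAC.
exact: cvgM (cvgM c5 c2) c1.
Qed.

Lemma evo_bounded : exists2 E, 0 < E & forall x y, a <= x -> x <= y -> y <= b ->
  `|evo x y| <= E.
Proof.
have [C C0 HC] := evo_err_bound; have Bn := qvar_nd lamP fB.
have [M M0 fM] := flat_reg_bounded ab (qvar_flat fB).
have O0 : 0 <= B b - B a by rewrite subr_ge0; apply: Bn; rewrite ?(ltW ab).
have P0 : 0 <= C * ((2 * M) ^+ 2 + (B b - B a)).
  by rewrite mulr_ge0 ?(ltW C0)// addr_ge0// sqr_ge0.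
exists (1 + 2 * M + C * ((2 * M) ^+ 2 + (B b - B a))); first olra.
move=> x y ax xy yb; have := HC x y ax xy yb.
have h1 : `|f y - f x| <= 2 * M.
  by have := fM x ltac:(olra); have := fM y ltac:(olra); rewrite !ler_norml; olra.
have h2 : (f y - f x) ^+ 2 <= (2 * M) ^+ 2.
  by rewrite -[leLHS]real_normK ?num_real// lerXn2r ?nnegrE//; olra.
have h3 : B y - B x <= B b - B a.
  have := Bn a x (lexx a) ax ltac:(olra).
  by have := Bn y b ltac:(olra) yb (lexx b); olra.
have h4 : C * ((f y - f x) ^+ 2 + (B y - B x)) <= C * ((2 * M) ^+ 2 + (B b - B a)).
  by rewrite ler_wpM2l ?(ltW C0)// lerD.
by move: h1; rewrite /evo_err !ler_norml; olra.
Qed.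

(** At a point [z] outside the partitions, [evo p n = evo p z * evo z n] and
    both increments from [z] to [n] are small, as [f] has no right jump at
    [z]. *)
Lemma evo_err_vanish : (forall z, a < z < b -> ~ ulam z -> rj z = 0) ->
  vanish a b lambda evo_err.
Proof.
move=> fj; have fr := qvar_flat fB.
have vl z : a < z <= b -> evo_err x z @[x --> z^'-] --> (0 : R).
  move=> zab; have -> : 0 = 1 + lj z - 1 - lj z :> R by ring.
  apply: cvgB (left_cvg_jump fr zab); apply: cvgB (cvg_cst _); exact: evo_left.
have vr z : a <= z < b -> evo_err z y @[y --> z^'+] --> (0 : R).
  move=> zab; have -> : 0 = 1 + rj z - 1 - rj z :> R by ring.
  apply: cvgB (right_cvg_jump fr zab); apply: cvgB (cvg_cst _); exact: evo_right.
split=> // z zab uz e e0.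
have [E E0 hE] := evo_bounded.
have e3 : 0 < e / 3 by olra.
have e3E : 0 < e / (6 * E) by apply: divr_gt0 => //; olra.
have /cvg_leftP/(_ _ e3)[d1 d10 h1] := vl z ltac:(olra).
have /cvg_rightP/(_ _ e3E)[d2 d20 h2] := vr z ltac:(olra).
have := right_cvg_jump fr (z := z) ltac:(olra); rewrite (fj z zab uz).
move=> /cvg_rightP cr.
have [d3 d30 h3] := cr _ e3; have [d4 d40 h4] := cr _ e3E.
have [d d0 hd] := right_nearI (ex_intro2 _ _ d2 d20 h2)
  (right_nearI (ex_intro2 _ _ d3 d30 h3) (ex_intro2 _ _ d4 d40 h4)).
have m1 : Num.min d1 d <= d1 by rewrite ge_min lexx.
have m2 : Num.min d1 d <= d by rewrite ge_min lexx orbT.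
exists (Num.min d1 d) => [|p n ap nb pz zn]; first by rewrite lt_min d10.
have {}h1 := h1 p ltac:(olra); have [g2 [g3 g4]] := hd n ltac:(olra).
rewrite !subr0 in h1 g2 g3 g4.
have hEp := hE p z ap ltac:(olra) ltac:(olra).
have -> : evo_err p n = evo_err p z + evo p z * (evo_err z n + (f n - f z)) - (f n - f z).
  have am : evo p n = evo p z * evo z n by apply: evo_mul; olra.
  by rewrite /evo_err am; ring.
have : `|evo p z * (evo_err z n + (f n - f z))| <= e / 3.
  have -> : e / 3 = E * (e / (6 * E) + e / (6 * E)) by field; olra.
  rewrite normrM ler_pM//; apply: (le_trans (ler_normD _ _)); exact: lerD.
by move: h1 g3; rewrite !ler_norml; olra.
Qed.

End Evolution.

(** * Quadratic covariations *)

Section Brackets.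
Variables (R : realType) (a b : R) (lambda : nat -> seq R).
Hypothesis ab : a < b.
Hypothesis lamP : in_Lambda a b lambda.
Local Notation lsum := (lsum lambda).
Local Notation ulam := (ulam a lambda).
Implicit Types (f g h B Phi : R -> R).

Lemma left_lim_ext (F F' : R -> R) (c z l l' : R) : c < z ->
  F x @[x --> z^'-] --> l -> F' x @[x --> z^'-] --> l' ->
  (forall x, c < x < z -> F x = F' x) -> l = l'.
Proof.
move=> cz Fl Fl' E; apply/eqP; rewrite -subr_eq0 -normr_le0 -[X in `|X|]subr0.
apply: (left_lim_dist (f := fun x => F x - F' x) cz (cvgB Fl Fl')) => x /E ->.
by rewrite subrr subr0 normr0.
Qed.

Lemma right_lim_ext (F F' : R -> R) (c z l l' : R) : z < c ->
  F x @[x --> z^'+] --> l -> F' x @[x --> z^'+] --> l' ->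
  (forall x, z < x < c -> F x = F' x) -> l = l'.
Proof.
move=> cz Fl Fl' E; apply/eqP; rewrite -subr_eq0 -normr_le0 -[X in `|X|]subr0.
apply: (right_lim_dist (f := fun x => F x - F' x) cz (cvgB Fl Fl')) => x /E ->.
by rewrite subrr subr0 normr0.
Qed.

Lemma lsum_ext (K K' : R -> R -> R) s t m : s < t ->
  (forall x y, s <= x -> x < y -> y <= t -> K x y = K' x y) ->
  lsum K s t m = lsum K' s t m.
Proof.
move=> st E; apply: eq_psum; first exact: (restr_path lamP).
by move=> x y sx xy; rewrite last_rcons; exact: E.
Qed.

Lemma lsum_ext_cvg (K K' : R -> R -> R) s t (l : R) : s < t ->
  (forall x y, s <= x -> x < y -> y <= t -> K x y = K' x y) ->
  lsum K s t @ \oo --> l -> lsum K' s t @ \oo --> l.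
Proof.
move=> st E; rewrite (_ : lsum K s t = lsum K' s t)//.
by apply/funext => m; apply: lsum_ext.
Qed.

Lemma lsumD_cvg (K K' : R -> R -> R) s t (l l' : R) :
  lsum K s t @ \oo --> l -> lsum K' s t @ \oo --> l' ->
  lsum (fun x y => K x y + K' x y) s t @ \oo --> l + l'.
Proof.
move=> h h'; rewrite (_ : lsum _ s t = (fun m => lsum K s t m + lsum K' s t m)).
  exact: cvgD.
by apply/funext => m; exact: psumD.
Qed.

Lemma lsumZ_cvg (K : R -> R -> R) c s t (l : R) :
  lsum K s t @ \oo --> l -> lsum (fun x y => c * K x y) s t @ \oo --> c * l.
Proof.
move=> h; rewrite (_ : lsum _ s t = (fun m => c * lsum K s t m)).
  by apply: cvgM => //; exact: cvg_cst.
by apply/funext => m; exact: psumZ.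
Qed.

Lemma lsum_telescope_cvg (F : R -> R) s t :
  lsum (fun x y => F y - F x) s t @ \oo --> F t - F s.
Proof.
rewrite (_ : lsum _ s t = (fun=> F t - F s)); first exact: cvg_cst.
by apply/funext => m; rewrite /lsum psum_telescope last_rcons.
Qed.

Lemma vanish_of_asym (K : R -> R -> R) :
  (forall z, a < z <= b -> K x z @[x --> z^'-] --> (0 : R)) ->
  (forall z, a <= z < b -> K z y @[y --> z^'+] --> (0 : R)) ->
  asym_add a b lambda K -> vanish a b lambda K.
Proof.
move=> v1 v2 aK; split=> // z zab uz e e0; have e3 : 0 < e / 3 by olra.
have /cvg_leftP/(_ _ e3)[d1 d10 h1] := v1 z ltac:(olra).
have /cvg_rightP/(_ _ e3)[d2 d20 h2] := v2 z ltac:(olra).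
have [d3 d30 h3] := aK z zab uz _ e3.
exists (Num.min d1 (Num.min d2 d3)); first by rewrite !lt_min d10 d20.
move=> p n ap nb pz zn.
have m1 : Num.min d1 (Num.min d2 d3) <= d1 by rewrite ge_min lexx.
have m2 : Num.min d1 (Num.min d2 d3) <= d2 by rewrite !ge_min lexx !orbT.
have m3 : Num.min d1 (Num.min d2 d3) <= d3 by rewrite !ge_min lexx !orbT.
have := h1 p ltac:(olra); have := h2 n ltac:(olra).
have := h3 p n ap nb ltac:(olra) ltac:(olra).
by rewrite !subr0 !ler_norml; olra.
Qed.

Lemma is_qcovI f g Phi : flat_reg a b f -> flat_reg a b g -> Phi a = 0 ->
  (forall s t, a <= s -> s < t -> t <= b ->
     lsum (fun x y => (f y - f x) * (g y - g x)) s t @ \oo --> Phi t - Phi s) ->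
  (forall z, a < z <= b ->
     Phi x @[x --> z^'-] --> Phi z - left_jump f z * left_jump g z) ->
  (forall z, a <= z < b ->
     Phi y @[y --> z^'+] --> Phi z + right_jump f z * right_jump g z) ->
  is_qcov a b lambda f g Phi.
Proof.
move=> fr gr Pa P Pl Pr; split=> //; [exact: flat_regulated|exact: flat_regulated|..].
  by split=> z zab; apply/cvg_ex; eexists; [exact: Pl|exact: Pr].
move=> s t as_ st tb; split.
- have -> : (fun m => partition_sum (fun x y => (f y - f x) * (g y - g x)) s
     (partition_restr s t (lambda m))) = lsum (fun x y => (f y - f x) * (g y - g x)) s t.
    by apply/funext => m; rewrite partition_sumE.
  exact: P.
- rewrite {1}/left_jump (left_limE (Pl t ltac:(olra))); ring.
- rewrite {1}/right_jump (right_limE (Pr s ltac:(olra))); ring.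
Qed.

Lemma is_qcov_lim f g B s t : is_qcov a b lambda f g B ->
  a <= s -> s < t -> t <= b ->
  lsum (fun x y => (f y - f x) * (g y - g x)) s t @ \oo --> B t - B s.
Proof.
move=> [_ _ _ _ H] as_ st tb; have [h _ _] := H s t as_ st tb.
move: h; have -> : (fun m => partition_sum (fun x y => (f y - f x) * (g y - g x)) s
     (partition_restr s t (lambda m))) = lsum (fun x y => (f y - f x) * (g y - g x)) s t.
  by apply/funext => m; rewrite partition_sumE.
by [].
Qed.

Lemma is_qcov_unique f g B B' : is_qcov a b lambda f g B ->
  is_qcov a b lambda f g B' -> forall y, a <= y <= b -> B y = B' y.
Proof.
move=> H H' y /andP[]; rewrite le_eqVlt => /orP[/eqP <- _|ay yb].
  by case: H => _ _ _ -> _; case: H' => _ _ _ -> _.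
have h := is_qcov_lim H (lexx a) ay yb; have h' := is_qcov_lim H' (lexx a) ay yb.
have := cvg_unique _ h h'; case: H => _ _ _ -> _; case: H' => _ _ _ -> _.
by rewrite !subr0; apply.
Qed.

Lemma qcovP f g : has_qcov a b lambda f g ->
  is_qcov a b lambda f g (qcov a b lambda f g).
Proof. exact: getPex. Qed.

Lemma decomposition_jumps p f g h : regulated a b f ->
  in_Dplus a b lambda p f g h ->
  [/\ forall z, a < z < b -> ~ ulam z -> right_jump g z = 0,
     forall z, a < z < b -> ~ ulam z -> right_jump h z = 0,
     forall x y, a <= x -> x <= y -> y <= b ->
       f y - f x = (g y - g x) + (h y - h x),
     forall z, a < z <= b -> left_jump f z = left_jump g z + left_jump h z &
     forall z, a <= z < b -> right_jump f z = right_jump g z + right_jump h z].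
Proof.
move=> /regulated_flat fr [[[gr hr] _ _ _ [C fE]] sub].
have {}gr := regulated_flat gr; have {}hr := regulated_flat hr.
have fEx x y : a <= x -> x <= y -> y <= b -> f y - f x = (g y - g x) + (h y - h x).
  by move=> ax xy yb; rewrite !fE; [ring|olra|olra].
split=> //.
- move=> z zab uz; apply/eqP/negPn/negP => gz; apply: uz; apply: sub; left.
  by split.
- move=> z zab uz; apply/eqP/negPn/negP => gz; apply: uz; apply: sub; right.
  by split.
- move=> z zab; have /andP[az _] := zab.
  apply: (left_lim_ext az (left_cvg_jump fr zab)
    (cvgD (left_cvg_jump gr zab) (left_cvg_jump hr zab))) => x xz.
  by apply: fEx; olra.
- move=> z zab; have /andP[_ zb] := zab.
  apply: (right_lim_ext zb (right_cvg_jump fr zab)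
    (cvgD (right_cvg_jump gr zab) (right_cvg_jump hr zab))) => x xz.
  by apply: fEx; olra.
Qed.

(** The squared increment of [f] is the sum of those of [g] and [h] and of
    twice their product. As p < 2, both (g, h) and (h, h) are Young pairs,
    whose covariations exist. *)
Lemma decomposition_Q p f g h : 1 <= p < 2 -> regulated a b f ->
  in_Dplus a b lambda p f g h -> in_Q a b lambda f.
Proof.
move=> p12 fr0 D; have [gj hj fEx fl frr] := decomposition_jumps fr0 D.
case: D => [[[gr hr] [gQ gD] hW _ _] _].
have {fr0}fr := regulated_flat fr0.
have {}gr := regulated_flat gr; have {}hr := regulated_flat hr.
have [Bg HBg] := gQ.
have p1 : 1 <= p by olra.
have [S [Sa HS Sl Sr]] := cov_lim ab lamP (dual_ypair p1 gD hW hr) gj hj.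
have [T [Ta HT Tl Tr]] := cov_lim ab lamP
  (dual_ypair p1 (W_dual p12 hW hr) hW hr) hj hj.
have [_ _ /regulated_flat Br Ba HB] := HBg.
exists (fun x => Bg x + 2 * S x + T x); apply: is_qcovI => //.
- by rewrite Ba Sa Ta; ring.
- move=> s t as_ st tb.
  have := lsumD_cvg (lsumD_cvg (is_qcov_lim HBg as_ st tb)
    (lsumZ_cvg (c := 2) (HS s t as_ st tb))) (HT s t as_ st tb).
  rewrite (_ : _ + _ + _ = Bg t + 2 * S t + T t - (Bg s + 2 * S s + T s)); last ring.
  apply: lsum_ext_cvg => // x y sx xy yt; rewrite fEx; [ring|olra|olra|olra].
- move=> z zab; have /andP[az zb] := zab.
  have Bl : Bg x @[x --> z^'-] --> Bg z - left_jump g z * left_jump g z.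
    have [_ <- _] := HB a z (lexx a) az zb.
    by rewrite /left_jump subKr; exact: regulated_left Br zab.
  have := cvgD (cvgD Bl (cvgM (cvg_cst (2 : R)) (Sl z zab))) (Tl z zab).
  rewrite [X in _ --> X](_ : _ = Bg z + 2 * S z + T z - left_jump f z * left_jump f z).
    exact.
  by rewrite fl//; ring.
- move=> z zab; have /andP[az zb] := zab.
  have Bl : Bg x @[x --> z^'+] --> Bg z + right_jump g z * right_jump g z.
    have [_ _ <-] := HB z b az zb (lexx b).
    by rewrite /right_jump addrC subrK; exact: regulated_right Br zab.
  have := cvgD (cvgD Bl (cvgM (cvg_cst (2 : R)) (Sr z zab))) (Tr z zab).
  rewrite [X in _ --> X](_ : _ = Bg z + 2 * S z + T z + right_jump f z * right_jump f z).
    exact.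
  by rewrite frr//; ring.
Qed.

End Brackets.

(** * Negligible sums *)

Section EvolutionSums.
Variables (R : realType) (a b : R) (lambda : nat -> seq R) (f B : R -> R).
Hypothesis ab : a < b.
Hypothesis lamP : in_Lambda a b lambda.
Hypothesis fB : is_qcov a b lambda f f B.
Local Notation lsum := (lsum lambda).
Local Notation ulam := (ulam a lambda).
Local Notation evo := (evo f B).
Local Notation evo_err := (evo_err f B).
Hypothesis fj : forall z, a < z < b -> ~ ulam z -> right_jump f z = 0.

(** A control for sums: by the definition of [B] its sums tend to twice the
    increments of [B]. *)
Definition quad_ctrl x y := (f y - f x) ^+ 2 + (B y - B x).
(** Its sums tend to 0, by cancellation only. *)
Definition quad_err x y := (f y - f x) ^+ 2 - (B y - B x).

Lemma B_le x y : a <= x -> x <= y -> y <= b -> 0 <= B y - B x.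
Proof. by move=> ax xy yb; rewrite subr_ge0; exact: qvar_nd lamP fB x y ax xy yb. Qed.

Lemma quad_ctrl_ge0 x y : a <= x -> x < y -> y <= b -> 0 <= quad_ctrl x y.
Proof.
by move=> ax xy yb; rewrite addr_ge0 ?sqr_ge0//; apply: B_le => //; exact: ltW.
Qed.

Lemma quad_ctrlP : ctrl a b lambda quad_ctrl (fun x => 2 * B x).
Proof.
move=> s t as_ st tb e e0.
have /seq_cvgP/(_ _ e0) := lsumD_cvg (qvar_lim fB as_ st tb) (@lsum_telescope_cvg _ lambda B s t).
by apply: filterS => m; rewrite -/(lsum quad_ctrl s t m) ler_norml; olra.
Qed.

Lemma quad_err_lim s t : a <= s -> s < t -> t <= b ->
  lsum quad_err s t @ \oo --> (0 : R).
Proof.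
move=> as_ st tb.
have := lsumD_cvg (qvar_lim fB as_ st tb)
  (lsumZ_cvg (c := -1) (@lsum_telescope_cvg _ lambda B s t)).
rewrite mulN1r subrr; apply: (lsum_ext_cvg lamP) => // x y _ _ _.
by rewrite /quad_err mulN1r.
Qed.

Lemma quad_err_vanish : vanish a b lambda quad_err.
Proof.
have fr := qvar_flat fB; have Br := nd_flat (qvar_nd lamP fB).
apply: vanish_of_asym.
- move=> z zab; have := cvgB (cvgM (left_cvg_jump fr zab) (left_cvg_jump fr zab))
    (left_cvg_jump Br zab).
  by rewrite (qvar_left_jump fB zab) -expr2 subrr; exact.
- move=> z zab; have := cvgB (cvgM (right_cvg_jump fr zab) (right_cvg_jump fr zab))
    (right_cvg_jump Br zab).
  by rewrite (qvar_right_jump fB zab) -expr2 subrr; exact.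
- move=> z zab uz e e0; have [d d0 hd] := cov_asym ab fr fr fj fj zab uz e0.
  exists d => // p n ap nb pz zn; have := hd p n ap nb pz zn.
  by rewrite (_ : _ - _ = quad_err p n - quad_err p z - quad_err z n)// /quad_err; ring.
Qed.

Lemma quad_err_weighted G s t : flat_reg a b G -> a <= s -> s < t -> t <= b ->
  lsum (fun x y => G x * quad_err x y) s t @ \oo --> (0 : R).
Proof.
move=> Gr; apply: (lsum_weighted ab lamP quad_err_vanish quad_ctrlP) => //.
  move=> x y ax xy yb; have := sqr_ge0 (f y - f x); have := B_le ax (ltW xy) yb.
  by rewrite /quad_err /quad_ctrl ler_norml; olra.
exact: quad_err_lim.
Qed.

Let fine_err x y := evo_err x y - 2^-1 * quad_err x y.

(** By [evo_err_local] the evolution error is half of [quad_err], up to a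
    small multiple of [quad_ctrl] on short intervals. *)
Lemma fine_err_null s t : a <= s -> s < t -> t <= b ->
  lsum (fun x y => `|fine_err x y|) s t @ \oo --> (0 : R).
Proof.
apply: (lsum_dominated lamP _ quad_ctrlP quad_ctrl_ge0).
  apply: vanishD; first exact: evo_err_vanish ab lamP fB fj.
  apply: (@vanish_dom _ _ _ _ quad_err _ 1); first exact: quad_err_vanish.
  move=> x y _ _ _; rewrite normrN normrM ger0_norm// ler_wpM2r//; olra.
exact: (evo_err_local ab lamP fB).
Qed.

(** The evolution error splits into [quad_err], where cancellation survives
    the weight by [lsum_weighted], and a part negligible in absolute value. *)
Lemma evo_err_weighted G s t : flat_reg a b G -> a <= s -> s < t -> t <= b ->
  lsum (fun x y => G x * evo_err x y) s t @ \oo --> (0 : R).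
Proof.
move=> Gr as_ st tb; have [M M0 GM] := flat_reg_bounded ab Gr.
have h1 := lsumZ_cvg (c := 2^-1) (quad_err_weighted Gr as_ st tb).
have h2 : lsum (fun x y => G x * fine_err x y) s t @ \oo --> (0 : R).
  apply: (lsum_norm_null lamP (M := M) _ as_ st tb (fine_err_null as_ st tb)).
  by move=> x y ax xy yb; rewrite normrM ler_wpM2r//; apply: GM; olra.
have := lsumD_cvg h1 h2; rewrite mulr0 addr0; apply: (lsum_ext_cvg lamP) => // x y _ _ _.
by rewrite /fine_err; ring.
Qed.

(** By [evo_err_bound] the error is of the order of the control, so any
    further factor that is small on short intervals suffices. *)
Lemma evo_err_times (K : R -> R -> R) M :
  (forall x y, a <= x -> x < y -> y <= b -> `|K x y| <= M) ->
  (forall e : R, 0 < e -> locally_good a b (fun s t =>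
     forall x y, s < x -> x < y -> y < t -> `|K x y| <= e)) ->
  forall s t, a <= s -> s < t -> t <= b ->
  lsum (fun x y => `|evo_err x y * K x y|) s t @ \oo --> (0 : R).
Proof.
move=> KM Ks; have [C C0 HC] := evo_err_bound ab lamP fB.
apply: (lsum_dominated lamP _ quad_ctrlP quad_ctrl_ge0).
  apply: (@vanish_dom _ _ _ _ evo_err _ M); first exact: evo_err_vanish ab lamP fB fj.
  by move=> x y ax xy yb; rewrite normrM mulrC ler_wpM2r//; exact: KM.
move=> e e0; have e1 : 0 < e / C by exact: divr_gt0.
apply: locally_good_sub (Ks _ e1) _ => s t as_ st tb H x y sx xy yt.
have ax : a <= x by olra.
have yb : y <= b by olra.
have -> : e * quad_ctrl x y = (C * quad_ctrl x y) * (e / C) by field; olra.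
by rewrite normrM; apply: ler_pM => //; [apply: HC => //; exact: ltW|exact: H].
Qed.

Lemma incr_bounded : exists2 M, 0 < M & forall x y, a <= x -> x < y -> y <= b ->
  `|f y - f x| <= M.
Proof.
have [M M0 fM] := flat_reg_bounded ab (qvar_flat fB).
exists (2 * M) => [|x y ax xy yb]; first olra.
by have := fM x ltac:(olra); have := fM y ltac:(olra); rewrite !ler_norml; olra.
Qed.

Lemma incr_small (e : R) : 0 < e -> locally_good a b (fun s t =>
     forall x y, s < x -> x < y -> y < t -> `|f y - f x| <= e).
Proof.
move=> e0; apply: locally_good_sub (qvar_flat fB e0) _ => s t _ _ _ H x y sx xy yt.
by apply: H; olra.
Qed.

Lemma evo_err_small (e : R) : 0 < e -> locally_good a b (fun s t =>
     forall x y, s < x -> x < y -> y < t -> `|evo_err x y| <= e).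
Proof.
move=> e0; have [C C0 HC] := evo_err_bound ab lamP fB.
pose d := Num.min 1 (e / (2 * C)).
have d0 : 0 < d by rewrite lt_min ltr01 divr_gt0// mulr_gt0.
have d1 : d <= 1 by rewrite ge_min lexx.
have dC : d * (2 * C) <= e by rewrite -ler_pdivlMr ?mulr_gt0// ge_min lexx orbT.
have Br := nd_flat (qvar_nd lamP fB).
apply: locally_good_sub (locally_goodI (qvar_flat fB d0) (Br d d0)) _.
move=> s t as_ st tb [H H'] x y sx xy yt.
have h1 : `|f y - f x| <= d by apply: H; olra.
have h2 : B y - B x <= d by apply: le_trans (ler_norm _) _; apply: H'; olra.
apply: (le_trans (HC x y ltac:(olra) (ltW xy) ltac:(olra))).
have h3 : (f y - f x) ^+ 2 <= d.
  rewrite -(@real_normK _ (f y - f x)) ?num_real// expr2.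
  by apply: le_trans (ler_pM _ _ h1 h1) _ => //; rewrite ler_piMl// ltW.
by apply: le_trans dC; nra.
Qed.

Lemma evo_err_sq_null s t : a <= s -> s < t -> t <= b ->
  lsum (fun x y => `|evo_err x y * evo_err x y|) s t @ \oo --> (0 : R).
Proof.
have [E E0 hE] := evo_bounded ab lamP fB; have [M M0 fM] := incr_bounded.
apply: (@evo_err_times _ (E + 1 + M)); last exact: evo_err_small.
move=> x y ax xy yb; have := hE x y ax (ltW xy) yb; have := fM x y ax xy yb.
by rewrite /evo_err !ler_norml; olra.
Qed.

Lemma evo_err_incr_null s t : a <= s -> s < t -> t <= b ->
  lsum (fun x y => `|evo_err x y * (f y - f x)|) s t @ \oo --> (0 : R).
Proof.
have [M M0 fM] := incr_bounded.
by apply: (@evo_err_times _ M) => //; exact: incr_small.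
Qed.

End EvolutionSums.

(** * The exponential solves the equation *)

Section Existence.
Variables (R : realType) (a b : R) (lambda : nat -> seq R) (f : R -> R) (p : R).
Hypothesis ab : a < b.
Hypothesis lamP : in_Lambda a b lambda.
Hypothesis p12 : 1 <= p < 2.
Hypothesis fr0 : regulated a b f.
Variables g0 h0 : R -> R.
Hypothesis D0 : in_Dplus a b lambda p f g0 h0.
Local Notation lsum := (lsum lambda).
Local Notation ulam := (ulam a lambda).
Let B := qvar a b lambda f.
Let E := doleans a b lambda f.
Local Notation evo := (evo f B).
Local Notation evo_err := (evo_err f B).

Lemma fQ : in_Q a b lambda f.
Proof. refine (decomposition_Q ab lamP p12 fr0 D0). Qed.

Lemma fB : is_qcov a b lambda f f B.
Proof. exact: qcovP fQ. Qed.

Lemma f_flat : flat_reg a b f.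
Proof. exact: regulated_flat. Qed.

Lemma B_nd : nondec a b B.
Proof. exact: qvar_nd lamP fB. Qed.

Lemma f_jumps z : a < z < b -> ~ ulam z -> right_jump f z = 0.
Proof.
move=> zab uz; have [gj hj _ _ ->] := decomposition_jumps fr0 D0.
  by rewrite gj// hj// addr0.
by have /andP[/ltW -> ->] := zab.
Qed.

Lemma B_jumps z : a < z < b -> ~ ulam z -> right_jump B z = 0.
Proof.
move=> zab uz; rewrite (qvar_right_jump fB); last olra.
by rewrite f_jumps// expr0n.
Qed.

Lemma doleans_evo x : a <= x <= b -> E x = evo a x.
Proof.
move=> xab; rewrite /E /doleans; case: eqP => [->|_].
  by rewrite (evo_xx ab lamP fB)// lexx ltW.
rewrite /evo /dcont; have -> : B a = 0 by case: fB.
by rewrite subr0.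
Qed.

Lemma doleans_definedP : doleans_defined a b lambda f.
Proof.
split=> [|x axb]; first exact: fQ.
have [ax xb] := andP axb; have ax' := ltW ax.
have [m1 h1] := bsum_wleft ab lamP fB (lexx a) ax' xb.
have [m2 h2] := bsum_wright ab lamP fB (lexx a) ax' xb.
split.
- exact: bsum_abs_summable (bsum_left lamP fB (lexx a) ax' xb).
- exact: bsum_abs_summable (bsum_right lamP fB (lexx a) ax' xb).
- exact: bsum_abs_summable h1.
- exact: bsum_abs_summable h2.
Qed.

Lemma doleans_mul x y : a <= x -> x <= y -> y <= b -> E y = E x * evo x y.
Proof.
move=> ax xy yb; rewrite !doleans_evo; [|olra|olra].
exact: (evo_mul ab lamP fB (lexx a) ax xy yb).
Qed.

(** The exact form of dE = E df on one interval. *)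
Lemma doleans_incr x y : a <= x -> x <= y -> y <= b ->
  E y - E x = E x * ((f y - f x) + evo_err x y).
Proof. by move=> ax xy yb; rewrite (doleans_mul ax xy yb) /evo_err; ring. Qed.

Lemma f_dual : in_dualW a b p f.
Proof.
have [_ _ fEx _ _] := decomposition_jumps fr0 D0.
case: D0 => [[[gr hr] [gQ gD] hW _ _] _]; have /andP[p1 _] := p12.
apply: (dual_dom ab (C := 1) p1 gD (W_dual p12 hW (regulated_flat hr))).
by move=> x y ax xy yb; rewrite mul1r fEx ?ler_normD// ltW.
Qed.

(** Regularity and p-variation of the exponential, and of its reciprocal, are
    inherited from [f] and [B] through this bound. *)
Lemma evo_sub1_bound : exists2 C, 0 < C & forall x y, a <= x -> x <= y -> y <= b ->
  `|evo x y - 1| <= C * (`|f y - f x| + `|B y - B x|).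
Proof.
have [C C0 HC] := evo_err_bound ab lamP fB.
have [M M0 fM] := flat_reg_bounded ab f_flat.
exists (1 + C * (2 * M + 1)); first by nra.
move=> x y ax xy yb; have h1 := HC x y ax xy yb.
have h2 : `|f y - f x| <= 2 * M.
  by have := fM x ltac:(olra); have := fM y ltac:(olra); rewrite !ler_norml; olra.
have h3 : (f y - f x) ^+ 2 <= 2 * M * `|f y - f x|.
  by rewrite -(@real_normK _ (f y - f x)) ?num_real// expr2 ler_wpM2r.
have h4 : B y - B x <= `|B y - B x| by exact: ler_norm.
have -> : evo x y - 1 = evo_err x y + (f y - f x) by rewrite /evo_err; ring.
apply: (le_trans (ler_normD _ _)).
have n1 := normr_ge0 (f y - f x); have n2 := normr_ge0 (B y - B x).
have : C * ((f y - f x) ^+ 2 + (B y - B x)) <=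
       C * (2 * M * `|f y - f x| + `|B y - B x|).
  by rewrite ler_wpM2l ?(ltW C0)// lerD.
have c1 : 0 <= C * `|f y - f x| by rewrite mulr_ge0// ltW.
have c2 : 0 <= C * M * `|B y - B x| by rewrite !mulr_ge0// ltW.
move: h1; set v := `|evo_err x y|.
have -> : C * (2 * M * `|f y - f x| + `|B y - B x|) =
  2 * (C * M * `|f y - f x|) + C * `|B y - B x| by ring.
have -> : (1 + C * (2 * M + 1)) * (`|f y - f x| + `|B y - B x|) =
  `|f y - f x| + `|B y - B x| + 2 * (C * M * `|f y - f x|) + C * `|f y - f x|
  + 2 * (C * M * `|B y - B x|) + C * `|B y - B x| by ring.
olra.
Qed.

Lemma doleans_bounded : exists2 M, 0 < M & forall x, a <= x <= b -> `|E x| <= M.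
Proof.
have [M M0 hM] := evo_bounded ab lamP fB; exists M => // x xab.
by rewrite doleans_evo//; apply: hM; olra.
Qed.

Lemma doleans_dom : exists C, forall x y, a <= x -> x < y -> y <= b ->
  `|E y - E x| <= C * (`|f y - f x| + `|B y - B x|).
Proof.
have [C C0 HC] := evo_sub1_bound; have [M M0 EM] := doleans_bounded.
exists (M * C) => x y ax xy yb; rewrite (doleans_mul ax (ltW xy) yb).
rewrite -{2}[E x]mulr1 -mulrBr normrM -mulrA; apply: ler_pM => //.
  by apply: EM; olra.
exact: HC (ltW xy) yb.
Qed.

Lemma doleans_flat : flat_reg a b E.
Proof.
by have [C HC] := doleans_dom; exact: flat_reg_dom f_flat (nd_flat B_nd) HC.
Qed.

Lemma doleans_dual : in_dualW a b p E.
Proof.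
have /andP[p1 _] := p12.
by have [C HC] := doleans_dom; exact: (dual_dom ab p1 f_dual (nd_dual p1 B_nd) HC).
Qed.

Lemma doleans_left_jump z : a < z <= b ->
  left_jump E z = left_lim E z * left_jump f z.
Proof.
move=> zab; have /andP[az zb] := zab.
have [v1 _ _] := evo_err_vanish ab lamP fB f_jumps.
have El := regulated_left doleans_flat zab.
have h : (E x * ((f z - f x) + evo_err x z)) @[x --> z^'-] -->
    left_lim E z * left_jump f z.
  rewrite -[left_jump f z]addr0.
  by apply: cvgM => //; apply: cvgD (left_cvg_jump f_flat zab) (v1 z zab).
apply: (left_lim_ext az (left_cvg_jump doleans_flat zab) h) => x xz.
by apply: doleans_incr; olra.
Qed.

Lemma doleans_right_jump z : a <= z < b ->
  right_jump E z = E z * right_jump f z.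
Proof.
move=> zab; have /andP[az zb] := zab.
have [_ v2 _] := evo_err_vanish ab lamP fB f_jumps.
have h : (E z * ((f x - f z) + evo_err z x)) @[x --> z^'+] -->
    E z * right_jump f z.
  rewrite -[right_jump f z]addr0; apply: cvgM; first exact: cvg_cst.
  by apply: cvgD (right_cvg_jump f_flat zab) (v2 z zab).
apply: (right_lim_ext zb (right_cvg_jump doleans_flat zab) h) => x xz.
by apply: doleans_incr; olra.
Qed.

(** The product of increments is [E x * (f y - f x) ^+ 2] up to negligible
    terms; under the weight [E] the squared increment may be replaced by that
    of [B], which leaves the left sums of a Young integral. *)
Lemma doleans_cov : exists Phi, is_qcov a b lambda E f Phi /\
  forall y, a <= y <= b -> is_LY E B a y (Phi y).
Proof.
have Er := doleans_flat; have fr := f_flat.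
have [Phi [Pa P Pl Pr LY]] := young_integral ab lamP (nd_ypair Er B_nd) B_jumps.
exists Phi; split; last first.
  by move=> y yab; rewrite -[Phi y]subr0 -Pa; apply: LY; olra.
apply: is_qcovI => //.
- move=> s t as_ st tb.
  have h1 := quad_err_weighted ab lamP fB f_jumps Er as_ st tb.
  have h2 : lsum (fun x y => E x * (evo_err x y * (f y - f x))) s t @ \oo --> (0 : R).
    have [M M0 EM] := doleans_bounded.
    apply: (lsum_norm_null lamP (M := M) _ as_ st tb
      (evo_err_incr_null ab lamP fB f_jumps as_ st tb)) => x y ax xy yb.
    by rewrite normrM ler_wpM2r//; apply: EM; olra.
  have := lsumD_cvg (lsumD_cvg (P s t as_ st tb) h1) h2; rewrite !addr0.
  apply: (lsum_ext_cvg lamP) => // x y sx xy yt.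
  by rewrite doleans_incr; [rewrite /quad_err; ring|olra|olra|olra].
- move=> z zab; have := Pl z zab.
  by rewrite (qvar_left_jump fB zab) doleans_left_jump// expr2 mulrA.
- move=> z zab; have := Pr z zab.
  by rewrite (qvar_right_jump fB zab) doleans_right_jump// expr2 mulrA.
Qed.

Lemma doleans_qvar : exists Phi, is_qcov a b lambda E E Phi /\
  forall y, a <= y <= b -> is_LY (fun x => E x ^+ 2) B a y (Phi y).
Proof.
have Er := doleans_flat; have fr := f_flat; have Er2 := flat_mul ab Er Er.
have [Phi [Pa P Pl Pr LY]] := young_integral ab lamP (nd_ypair Er2 B_nd) B_jumps.
exists Phi; split; last first.
  by move=> y yab; rewrite -[Phi y]subr0 -Pa; apply: LY; olra.
apply: is_qcovI => //.
- move=> s t as_ st tb.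
  have h1 := quad_err_weighted ab lamP fB f_jumps Er2 as_ st tb.
  have [M M0 EM] := flat_reg_bounded ab Er2.
  have h2 : lsum (fun x y => E x * E x * (evo_err x y * (f y - f x))) s t
      @ \oo --> (0 : R).
    apply: (lsum_norm_null lamP (M := M) _ as_ st tb
      (evo_err_incr_null ab lamP fB f_jumps as_ st tb)) => x y ax xy yb.
    by rewrite normrM ler_wpM2r//; apply: EM; olra.
  have h3 : lsum (fun x y => E x * E x * (evo_err x y * evo_err x y)) s t
      @ \oo --> (0 : R).
    apply: (lsum_norm_null lamP (M := M) _ as_ st tb
      (evo_err_sq_null ab lamP fB f_jumps as_ st tb)) => x y ax xy yb.
    by rewrite normrM ler_wpM2r//; apply: EM; olra.
  have := lsumD_cvg (lsumD_cvg (lsumD_cvg (P s t as_ st tb) h1)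
    (lsumZ_cvg (c := 2) h2)) h3.
  rewrite mulr0 !addr0; apply: (lsum_ext_cvg lamP) => // x y sx xy yt.
  by rewrite doleans_incr; [rewrite /quad_err; ring|olra|olra|olra].
- move=> z zab; have := Pl z zab.
  rewrite (qvar_left_jump fB zab) (left_lim_mul Er Er zab) doleans_left_jump//.
  by rewrite expr2 mulrACA.
- move=> z zab; have := Pr z zab.
  by rewrite (qvar_right_jump fB zab) doleans_right_jump// expr2 mulrACA.
Qed.

(** The sums of [psi x * (E y - E x) - psi x * E x * (g y - g x)] are left
    sums of [psi * E] against [h], plus weighted sums of the evolution
    error. *)
Lemma doleans_LC g h psi : in_Dplus a b lambda p f g h -> in_dualW a b p psi ->
  exists2 Phi, is_LC a b lambda psi (fun x => - (psi x * E x)) E g Phi &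
    forall y, a <= y <= b -> is_LY (fun x => psi x * E x) h a y (Phi y - Phi a).
Proof.
move=> D psiD; have [gj hj fEx fl frr] := decomposition_jumps fr0 D.
case: D => [[[gr hr] _ hW _ _] _].
have {}gr := regulated_flat gr; have {}hr := regulated_flat hr.
have /andP[p1 _] := p12.
have pr := dual_flat psiD; have Er := doleans_flat.
have PE := dual_mul ab p1 psiD doleans_dual.
have [Phi [Pa P Pl Pr LY]] := young_integral ab lamP (dual_ypair p1 PE hW hr) hj.
exists Phi; last by move=> y yab; apply: LY; olra.
have PEr := dual_flat PE.
split=> //.
- split; first exact: flat_regulated.
  apply: flat_regulated; apply: (flat_reg_dom (C := 1) PEr PEr) => x y _ _ _.
  rewrite mul1r (_ : _ - _ = - (psi y * E y - psi x * E x)); last ring.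
  by rewrite normrN lerDl.
- by split; exact: flat_regulated.
- by split=> z zab; apply/cvg_ex; eexists; [exact: Pl|exact: Pr].
- move=> s t as_ st tb; split.
  + rewrite (_ : (fun m => _) = lsum (fun x y => psi x * (E y - E x)
      + - (psi x * E x) * (g y - g x)) s t); last first.
      by apply/funext => m; rewrite partition_sumE.
    have := lsumD_cvg (P s t as_ st tb)
      (evo_err_weighted ab lamP fB f_jumps PEr as_ st tb).
    rewrite addr0; apply: (lsum_ext_cvg lamP) => // x y sx xy yt.
    by rewrite doleans_incr ?fEx; [ring|olra|olra|olra|olra|olra|olra].
  + have tab : a < t <= b by olra.
    rewrite {1}/left_jump (left_limE (Pl t tab)) (left_lim_mul pr Er tab).
    rewrite (left_limE (cvgN (cvgM (regulated_left pr tab) (regulated_left Er tab)))).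
    by rewrite doleans_left_jump// fl//; ring.
  + have sab : a <= s < b by olra.
    rewrite {1}/right_jump (right_limE (Pr s sab)).
    by rewrite doleans_right_jump// frr//; ring.
Qed.

Theorem doleans_forward : forward_solution a b lambda p f E.
Proof.
have [P1 [Q1 L1]] := doleans_cov; have [P2 [Q2 L2]] := doleans_qvar.
have EQ : in_Q a b lambda E by exists P2.
have EfQ : has_qcov a b lambda E f by exists P1.
split.
- by split; [exact: doleans_dual|].
- by move=> g h D psi psiD; exact: doleans_LC.
- by split; [|exact: fQ|].
- move=> y yab; split.
  + rewrite [qvar _ _ _ _ y](is_qcov_unique (qcovP EQ) Q2 yab); exact: L2.
  + rewrite (is_qcov_unique (qcovP EfQ) Q1 yab); exact: L1.
Qed.

End Existence.

(** * Uniqueness of the solution *)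

Section Uniqueness.
Variables (R : realType) (a b : R) (lambda : nat -> seq R) (f : R -> R) (p : R).
Hypothesis ab : a < b.
Hypothesis lamP : in_Lambda a b lambda.
Hypothesis p12 : 1 <= p < 2.
Hypothesis fr0 : regulated a b f.
Variables g h : R -> R.
Hypothesis D0 : in_Dplus a b lambda p f g h.
Local Notation lsum := (lsum lambda).
Local Notation ulam := (ulam a lambda).
Let B := qvar a b lambda f.
Local Notation evo := (evo f B).
Local Notation evo_err := (evo_err f B).
Variable F : R -> R.
Hypothesis Fsol : forward_solution a b lambda p f F.

Let fB0 : is_qcov a b lambda f f B := fB ab lamP p12 fr0 D0.
Let fr : flat_reg a b f := regulated_flat fr0.
Let Bn : nondec a b B := B_nd ab lamP p12 fr0 D0.
Let fj := f_jumps fr0 D0.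

Lemma F_dual : in_dualW a b p F.
Proof. by case: Fsol => -[]. Qed.

Lemma F_flat : flat_reg a b F.
Proof. exact: (dual_flat F_dual). Qed.

(** The error of [F] in dF = F df on one interval. *)
Definition sol_err x y := F y - F x - F x * (f y - f x).

(** The Left Young integral against [h] is also the limit of left sums, so the
    equation becomes a statement on limits of sums. *)
Lemma solution_LC psi : in_dualW a b p psi -> exists Phi, [/\
  forall s t, a <= s -> s < t -> t <= b ->
    lsum (fun x y => psi x * F x * (h y - h x)) s t @ \oo --> Phi t - Phi s,
  forall z, a < z <= b ->
    Phi x @[x --> z^'-] --> Phi z - left_lim psi z * left_lim F z * left_jump h z,
  forall z, a <= z < b ->
    Phi y @[y --> z^'+] --> Phi z + psi z * F z * right_jump h z &
  exists2 Psi, is_LC a b lambda psi (fun x => - (psi x * F x)) F g Psi &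
    forall y, a <= y <= b -> Psi y = Phi y].
Proof.
move=> psiD; have /andP[p1 _] := p12.
have [gj hj _ _ _] := decomposition_jumps fr0 D0.
case: (D0) => [[[gr hr] _ hW _ _] _]; have {}hr := regulated_flat hr.
have PD := dual_mul ab p1 psiD F_dual.
have [Phi [Pa P Pl Pr LY]] := young_integral ab lamP (dual_ypair p1 PD hW hr) hj.
have [_ sol _ _] := Fsol; have [Psi LC LYpsi] := sol g h D0 psi psiD.
exists Phi; split=> //.
  by move=> z zab; rewrite -(left_lim_mul (dual_flat psiD) F_flat zab); exact: Pl.
exists Psi => // y yab; have [ay yb] := andP yab.
have := is_LY_unique (LYpsi y yab) (LY a y (lexx a) ay yb).
by rewrite Pa; case: LC => _ _ _ -> _; rewrite !subr0.
Qed.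

Lemma solution_sums psi s t : in_dualW a b p psi -> a <= s -> s < t -> t <= b ->
  lsum (fun x y => psi x * sol_err x y) s t @ \oo --> (0 : R).
Proof.
move=> psiD as_ st tb; have [Phi [P _ _ [Psi LC E]]] := solution_LC psiD.
have [_ _ fEx _ _] := decomposition_jumps fr0 D0.
have [_ _ _ _ H] := LC; have [h1 _ _] := H s t as_ st tb.
have {}h1 : lsum (fun x y => psi x * (F y - F x) + - (psi x * F x) * (g y - g x)) s t
    @ \oo --> Psi t - Psi s.
  move: h1; rewrite (_ : (fun m => _) = lsum (fun x y => psi x * (F y - F x)
      + - (psi x * F x) * (g y - g x)) s t)//.
  by apply/funext => m; rewrite partition_sumE.
rewrite !E in h1; [|olra|olra].
have := lsumD_cvg h1 (lsumZ_cvg (c := -1) (P s t as_ st tb)).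
rewrite mulN1r subrr; apply: (lsum_ext_cvg lamP) => // x y sx xy yt.
by rewrite /sol_err fEx; [ring|olra|olra|olra].
Qed.

Lemma one_dual : in_dualW a b p (fun=> 1).
Proof. by have /andP[p1 _] := p12; apply: nd_dual => // x y. Qed.

(** The jump relation of the vector integral with [psi = 1]. *)
Lemma solution_left_jump z : a < z <= b ->
  left_jump F z = left_lim F z * left_jump f z.
Proof.
move=> zab; have /andP[az zb] := zab.
have [Phi [_ Pl _ [Psi LC E]]] := solution_LC one_dual.
have [_ _ _ fl _] := decomposition_jumps fr0 D0.
have [_ _ _ _ H] := LC; have [_ hl _] := H a z (lexx a) az zb.
have L1 : left_lim (fun=> 1 : R) z = 1 by apply: left_limE; exact: cvg_cst.
have LF : left_lim (fun x => - (1 * F x)) z = - left_lim F z.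
  apply: left_limE; rewrite (_ : (fun x => - (1 * F x)) = (fun x => - F x)).
    by apply: cvgN; exact: regulated_left F_flat zab.
  by apply/funext => x; rewrite mul1r.
rewrite L1 LF in hl.
have LPsi : left_lim Psi z = Phi z - 1 * left_lim F z * left_jump h z.
  case: LC => _ _ /regulated_flat Psir _ _.
  have Plz := Pl z zab; rewrite L1 in Plz.
  by apply: (left_lim_ext az (regulated_left Psir zab) Plz) => x xz; apply: E; olra.
have {hl} : Psi z - left_lim Psi z = 1 * left_jump F z + - left_lim F z * left_jump g z.
  exact: hl.
rewrite LPsi E; last olra.
by rewrite fl// => Eq; rewrite mulrDr; olra.
Qed.

Lemma solution_right_jump z : a <= z < b ->
  right_jump F z = F z * right_jump f z.
Proof.
move=> zab; have /andP[az zb] := zab.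
have [Phi [_ _ Pr [Psi LC E]]] := solution_LC one_dual.
have [_ _ _ _ frr] := decomposition_jumps fr0 D0.
have [_ _ _ _ H] := LC; have [_ _ hr] := H z b az zb (lexx b).
have LPsi : right_lim Psi z = Phi z + 1 * F z * right_jump h z.
  case: LC => _ _ /regulated_flat Psir _ _.
  apply: (right_lim_ext zb (regulated_right Psir zab) (Pr z zab)) => x xz.
  by apply: E; olra.
have {hr} : right_lim Psi z - Psi z = 1 * right_jump F z + - (1 * F z) * right_jump g z.
  exact: hr.
rewrite LPsi E; last olra.
by rewrite frr// => Eq; rewrite mulrDr; olra.
Qed.

Lemma sol_err_vanish : vanish a b lambda sol_err.
Proof.
apply: vanish_of_asym.
- move=> z zab; have Fl := regulated_left F_flat zab.
  rewrite -(subrr (left_jump F z)) {2}solution_left_jump//.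
  apply: cvgB; first exact: left_cvg_jump F_flat zab.
  by apply: cvgM => //; exact: left_cvg_jump fr zab.
- move=> z zab; rewrite -(subrr (right_jump F z)) {2}solution_right_jump//.
  apply: cvgB; first exact: right_cvg_jump F_flat zab.
  by apply: cvgM; [exact: cvg_cst|exact: right_cvg_jump fr zab].
- move=> z zab uz e e0.
  have [d d0 hd] := cross_small ab F_flat fr zab (fj zab uz) e0.
  exists d => // p0 n ap nb pz zn.
  rewrite (_ : _ - _ = (F z - F p0) * (f n - f z)); last by rewrite /sol_err; ring.
  by apply: hd => //; apply: ltW; case/andP: pz.
Qed.

Lemma F_bounded : exists2 M, 0 < M & forall x, a <= x <= b -> `|F x| <= M.
Proof. exact: flat_reg_bounded ab F_flat. Qed.

(** The bracket equations identify brackets with Young integrals against [B],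
    hence with limits of left sums, and there increments of [B] may be
    replaced by squared increments of [f]. *)
Lemma solution_brackets : exists BF BFf, [/\
  forall s t, a <= s -> s < t -> t <= b ->
    lsum (fun x y => (F y - F x) ^+ 2) s t @ \oo --> BF t - BF s,
  forall s t, a <= s -> s < t -> t <= b ->
    lsum (fun x y => F x ^+ 2 * (f y - f x) ^+ 2) s t @ \oo --> BF t - BF s,
  forall s t, a <= s -> s < t -> t <= b ->
    lsum (fun x y => (F y - F x) * (f y - f x)) s t @ \oo --> BFf t - BFf s &
  forall s t, a <= s -> s < t -> t <= b ->
    lsum (fun x y => F x * (f y - f x) ^+ 2) s t @ \oo --> BFf t - BFf s].
Proof.
have [[_ FQ] _ [_ _ FfQ] LY] := Fsol.
have Fr := F_flat; have Fr2 := flat_mul ab Fr Fr.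
have Bj := B_jumps ab lamP p12 fr0 D0.
have [P1 [P1a HP1 _ _ LY1]] := young_integral ab lamP (nd_ypair Fr Bn) Bj.
have [P2 [P2a HP2 _ _ LY2]] := young_integral ab lamP (nd_ypair Fr2 Bn) Bj.
have E1 y : a <= y <= b -> qcov a b lambda F f y = P1 y.
  move=> yab; have [ay yb] := andP yab; have [_ L] := LY y yab.
  by rewrite (is_LY_unique L (LY1 a y (lexx a) ay yb)) P1a subr0.
have E2 y : a <= y <= b -> qvar a b lambda F y = P2 y.
  move=> yab; have [ay yb] := andP yab; have [L _] := LY y yab.
  by rewrite (is_LY_unique L (LY2 a y (lexx a) ay yb)) P2a subr0.
exists P2, P1; split=> s t as_ st tb.
- rewrite -!E2; [|olra|olra].
  exact: is_qcov_lim (qcovP FQ) as_ st tb.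
- have := lsumD_cvg (HP2 s t as_ st tb) (quad_err_weighted ab lamP fB0 fj Fr2 as_ st tb).
  rewrite addr0; apply: (lsum_ext_cvg lamP) => // x y _ _ _.
  by rewrite /quad_err; ring.
- rewrite -!E1; [|olra|olra].
  exact: is_qcov_lim (qcovP FfQ) as_ st tb.
- have := lsumD_cvg (HP1 s t as_ st tb) (quad_err_weighted ab lamP fB0 fj Fr as_ st tb).
  rewrite addr0; apply: (lsum_ext_cvg lamP) => // x y _ _ _.
  by rewrite /quad_err; ring.
Qed.

(** In (dF - F df)^2 = (dF)^2 - F^2 (df)^2 - 2 F (dF - F df) df the first two
    terms have the same limit. The sums of (dF - F df) df tend to 0 by the
    equation for the covariation, also under the weight F. *)
Lemma sol_err_sq_null s t : a <= s -> s < t -> t <= b ->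
  lsum (fun x y => sol_err x y ^+ 2) s t @ \oo --> (0 : R).
Proof.
move=> as_ st tb; have [BF [BFf [H1 H2 H3 H4]]] := solution_brackets.
have [M M0 FM] := F_bounded; have [N N0 fN] := incr_bounded ab fB0.
pose K1 x y := sol_err x y * (f y - f x).
pose U x y := (F y - F x) ^+ 2 + (1 + M) * (f y - f x) ^+ 2.
have K1lim u v : a <= u -> u < v -> v <= b -> lsum K1 u v @ \oo --> (0 : R).
  move=> au uv vb.
  have := lsumD_cvg (H3 u v au uv vb) (lsumZ_cvg (c := -1) (H4 u v au uv vb)).
  rewrite mulN1r subrr; apply: (lsum_ext_cvg lamP) => // x y _ _ _.
  by rewrite /K1 /sol_err; ring.
have UV : ctrl a b lambda U (fun x => BF x + (1 + M) * B x).
  move=> u v au uv vb e e0.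
  have /seq_cvgP/(_ _ e0) := lsumD_cvg (H1 u v au uv vb)
    (lsumZ_cvg (c := 1 + M) (qvar_lim fB0 au uv vb)).
  by apply: filterS => m; rewrite -/(lsum U u v m) ler_norml mulrBr; olra.
have K1van : vanish a b lambda K1.
  apply: (@vanish_dom _ _ _ _ sol_err _ N sol_err_vanish) => x y ax xy yb.
  by rewrite normrM mulrC ler_wpM2r//; exact: fN.
have FK1 : lsum (fun x y => F x * K1 x y) s t @ \oo --> (0 : R).
  apply: (lsum_weighted ab lamP K1van UV _ K1lim F_flat) => // x y ax xy yb.
  have Fx := FM x ltac:(olra).
  have -> : K1 x y = (F y - F x) * (f y - f x) - F x * (f y - f x) ^+ 2.
    by rewrite /K1 /sol_err; ring.
  have -> : U x y = (F y - F x) ^+ 2 + (f y - f x) ^+ 2 + M * (f y - f x) ^+ 2.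
    by rewrite /U; ring.
  apply: (le_trans (ler_normB _ _)); apply: lerD.
    have := sqr_ge0 (F y - F x - (f y - f x)); have := sqr_ge0 (F y - F x + (f y - f x)).
    by rewrite ler_norml; have := sqr_ge0 (F y - F x); have := sqr_ge0 (f y - f x); nra.
  by rewrite normrM [ `|_ ^+ 2| ]ger0_norm ?sqr_ge0// ler_wpM2r// sqr_ge0.
have := lsumD_cvg (lsumD_cvg (H1 s t as_ st tb) (lsumZ_cvg (c := -1) (H2 s t as_ st tb)))
  (lsumZ_cvg (c := -2) FK1).
rewrite mulN1r subrr mulr0 addr0; apply: (lsum_ext_cvg lamP) => // x y _ _ _.
by rewrite /K1 /sol_err; ring.
Qed.

Definition defect x y := F y - F x * evo x y.

Lemma defectE x y : defect x y = sol_err x y - F x * evo_err x y.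
Proof. by rewrite /defect /sol_err /evo_err; ring. Qed.

Lemma defect_vanish : vanish a b lambda defect.
Proof.
have [M M0 FM] := F_bounded.
have -> : defect = (fun x y => sol_err x y + - (F x * evo_err x y)).
  by apply/funext => x; apply/funext => y; exact: defectE.
apply: vanishD; first exact: sol_err_vanish.
apply: (@vanish_dom _ _ _ _ evo_err _ M); first exact: evo_err_vanish ab lamP fB0 fj.
by move=> x y ax xy yb; rewrite normrN normrM ler_wpM2r//; apply: FM; olra.
Qed.

Lemma defect_sums psi s t : in_dualW a b p psi -> a <= s -> s < t -> t <= b ->
  lsum (fun x y => psi x * defect x y) s t @ \oo --> (0 : R).
Proof.
move=> psiD as_ st tb; have Pr := flat_mul ab (dual_flat psiD) F_flat.
have := lsumD_cvg (solution_sums psiD as_ st tb)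
  (lsumZ_cvg (c := -1) (evo_err_weighted ab lamP fB0 fj Pr as_ st tb)).
rewrite mulr0 addr0; apply: (lsum_ext_cvg lamP) => // x y _ _ _.
by rewrite defectE; ring.
Qed.

Lemma defect_sq_null s t : a <= s -> s < t -> t <= b ->
  lsum (fun x y => defect x y ^+ 2) s t @ \oo --> (0 : R).
Proof.
move=> as_ st tb; have [M M0 FM] := F_bounded.
have h1 := sol_err_sq_null as_ st tb.
have h2 := evo_err_sq_null ab lamP fB0 fj as_ st tb.
have h3 := lsumD_cvg (lsumZ_cvg (c := 2) h1) (lsumZ_cvg (c := 2 * M ^+ 2) h2).
rewrite !mulr0 addr0 in h3.
apply/seq_cvgP => e e0; move/seq_cvgP: h3 => /(_ e e0); apply: filterS => m.
rewrite !subr0; apply: le_trans; apply: le_trans (ler_norm _); rewrite ger0_norm.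
  apply: ler_psum => [|x y sx xy]; first exact: (restr_path lamP).
  rewrite last_rcons => yt; have Fx := FM x ltac:(olra).
  rewrite defectE ger0_norm -?expr2 ?sqr_ge0//.
  have F2 : F x ^+ 2 <= M ^+ 2.
    by rewrite -(@real_normK _ (F x)) ?num_real// lerXn2r ?nnegrE// ltW.
  have := ler_wpM2r (sqr_ge0 (evo_err x y)) F2.
  have := sqr_ge0 (sol_err x y + F x * evo_err x y); nra.
rewrite /lsum -(psum0 s (partition_restr s t (lambda m))).
by apply: ler_psum => [|x y _ _ _]; [exact: (restr_path lamP)|exact: sqr_ge0].
Qed.

(** The weight of the uniqueness proof, cut off outside [[s, t]] because there
    the evolution factor may vanish. *)
Definition inv_evo s t x := if s <= x <= t then (evo s x)^-1 else 0.

(** Its increments are controlled by those of [f] and [B] inside [[s, t]], and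
    by the two jumps of the cut-off. *)
Lemma inv_evo_dual s t : a <= s -> s < t -> t <= b ->
  (forall x, s <= x <= t -> `|evo s x - 1| <= 2^-1) ->
  in_dualW a b p (inv_evo s t).
Proof.
move=> as_ st tb H; have /andP[p1 _] := p12.
have [C C0 HC] := evo_sub1_bound ab lamP p12 fr0 D0; rewrite -/B in HC.
(* A unit of control for each of the two jumps of the cut-off. *)
pose N (x : R) : R := (s <= x)%R%:R + (t < x)%R%:R.
have Nn x y : x <= y -> N x <= N y.
  move=> xy; rewrite /N lerD// ler_nat.
    by case: (leP s x) => //= sx; rewrite (le_trans sx xy).
  by case: (ltP t x) => //= tx; rewrite (lt_le_trans tx xy).
pose V x := B x + N x.
have Vn : nondec a b V by move=> x y ax xy yb; rewrite lerD ?Bn ?Nn.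
have lo x : s <= x <= t -> 2^-1 <= evo s x <= 3 / 2.
  by move=> /H; rewrite ler_norml; olra.
have inv2 x : s <= x <= t -> 0 <= (evo s x)^-1 <= 2.
  move=> xst; have /andP[l1 l2] := lo x xst.
  have e0 : 0 < evo s x by olra.
  by rewrite invr_ge0 (ltW e0) /= -[leRHS]invrK lef_pV2 ?posrE// invr_gt0.
apply: (dual_dom ab (C := 6 * C + 2) p1 (f_dual ab p12 fr0 D0) (nd_dual p1 Vn)).
move=> x y ax xy yb.
have dV : `|V y - V x| = (B y - B x) + (N y - N x).
  rewrite ger0_norm; first by rewrite /V; ring.
  by rewrite subr_ge0; apply: Vn => //; exact: ltW.
have dB : 0 <= B y - B x by rewrite subr_ge0; apply: Bn => //; exact: ltW.
have dN : 0 <= N y - N x by rewrite subr_ge0; apply: Nn; exact: ltW.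
have df := normr_ge0 (f y - f x).
rewrite dV /inv_evo; case: ifP => yst; case: ifP => xst.
- have [/andP[sx xt] /andP[sy yt]] := (xst, yst).
  have em : evo s y = evo s x * evo x y.
    by apply: (evo_mul ab lamP fB0 as_ sx (ltW xy) yb).
  have /andP[lx ux] := lo x xst; have /andP[ly uy] := lo y yst.
  have -> : (evo s y)^-1 - (evo s x)^-1 = - (evo s y)^-1 * (evo x y - 1).
    rewrite em; field; rewrite -?em; apply/andP; split; apply/eqP; last olra.
    by move=> E0; rewrite em E0 mulr0 in ly; olra.
  rewrite normrM normrN; have /andP[i0 i2] := inv2 y yst; rewrite (ger0_norm i0).
  have := HC x y ax (ltW xy) yb; rewrite (ger0_norm dB) => hC.
  apply: (le_trans (ler_pM i0 (normr_ge0 _) i2 hC)).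
  have c1 : 0 <= C * `|f y - f x| by rewrite mulr_ge0// ltW.
  have c2 : 0 <= C * (B y - B x) by rewrite mulr_ge0// ltW.
  have c3 : 0 <= C * (N y - N x) by rewrite mulr_ge0// ltW.
  olra.
- have N1 : 1 <= N y - N x.
    have /andP[sy yt] := yst; rewrite /N sy ltNge yt /=.
    have xs : s <= x = false.
      by move: xst; rewrite (le_trans (ltW xy) yt) andbT.
    by rewrite xs ltNge (le_trans (ltW xy) yt) /=; olra.
  have /andP[i0 i2] := inv2 y yst; rewrite subr0 (ger0_norm i0).
  have c1 : 0 <= C * `|f y - f x| by rewrite mulr_ge0// ltW.
  have c2 : 0 <= C * (B y - B x) by rewrite mulr_ge0// ltW.
  have c3 : 0 <= C * (N y - N x) by rewrite mulr_ge0// ltW.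
  olra.
- have N1 : 1 <= N y - N x.
    have /andP[sx xt] := xst; have sy := le_trans sx (ltW xy).
    have ty : t < y by move: yst; rewrite sy /= ltNge => ->.
    by rewrite /N sx sy ty ltNge xt /=; olra.
  have /andP[i0 i2] := inv2 x xst; rewrite sub0r normrN (ger0_norm i0).
  have c1 : 0 <= C * `|f y - f x| by rewrite mulr_ge0// ltW.
  have c2 : 0 <= C * (B y - B x) by rewrite mulr_ge0// ltW.
  have c3 : 0 <= C * (N y - N x) by rewrite mulr_ge0// ltW.
  olra.
- rewrite subrr normr0; apply: mulr_ge0; olra.
Qed.

(** Since [psi y * defect x y = psi y * F y - psi x * F x] for [psi] the
    reciprocal of the evolution factor, these terms telescope. Replacing [psi
    y] by [psi x] gives sums that tend to 0 by the equation, and the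
    difference tends to 0 by the Cauchy-Schwarz inequality. The hypothesis
    keeps the reciprocal bounded. *)
Lemma short_evolution s t : a <= s -> s < t -> t <= b ->
  (forall x, s <= x <= t -> `|evo s x - 1| <= 2^-1) ->
  F t = F s * evo s t.
Proof.
move=> as_ st tb H; have psiD := inv_evo_dual as_ st tb H.
set psi := inv_evo s t in psiD.
have [C C0 HC] := evo_sub1_bound ab lamP p12 fr0 D0; rewrite -/B in HC.
have lo x : s <= x <= t -> 2^-1 <= evo s x <= 3 / 2.
  by move=> /H; rewrite ler_norml; olra.
have psiE x : s <= x <= t -> psi x = (evo s x)^-1.
  by move=> xst; rewrite /psi /inv_evo xst.
have mulE x y : s <= x -> x < y -> y <= t -> evo s y = evo s x * evo x y.
  move=> sx xy yt; apply: (evo_mul ab lamP fB0 as_ sx (ltW xy)); olra.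
have psiM x y : s <= x -> x < y -> y <= t -> psi x = evo x y * psi y.
  move=> sx xy yt; rewrite !psiE; [|olra|olra].
  have := lo x ltac:(olra); have := lo y ltac:(olra); rewrite (mulE x y) // => l1 l2.
  field; apply/andP; split; apply/eqP; last olra.
  by move=> E0; rewrite E0 mulr0 in l1; olra.
have h1 := defect_sums psiD as_ st tb.
have inv2 x : s <= x <= t -> `|psi x| <= 2.
  move=> xst; have /andP[l1 l2] := lo x xst; rewrite psiE//.
  have e0 : 0 < evo s x by olra.
  by rewrite ger0_norm ?invr_ge0 ?(ltW e0)// -[leRHS]invrK lef_pV2 ?posrE// invr_gt0.
(* From (u + v)^2 <= 2 u^2 + 2 v^2, with v the increment of [B], where v^2 <=
   (B b - B a) v. *)
pose L := 2 * (2 * C) ^+ 2 * (1 + (B b - B a)).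
have O0 : 0 <= B b - B a by rewrite subr_ge0; apply: Bn; rewrite ?(ltW ab).
have L0 : 0 < L by rewrite /L !mulr_gt0 ?exprn_gt0 ?mulr_gt0//; olra.
have dpsi x y : s <= x -> x < y -> y <= t ->
    (psi y - psi x) ^+ 2 <= L * quad_ctrl f B x y.
  move=> sx xy yt; rewrite (psiM x y)//.
  have dB : 0 <= B y - B x by apply: (B_le lamP fB0); olra.
  have dB1 : B y - B x <= B b - B a.
    have := @Bn a x ltac:(olra) ltac:(olra) ltac:(olra).
    have := @Bn y b ltac:(olra) ltac:(olra) ltac:(olra); olra.
  have -> : psi y - evo x y * psi y = - psi y * (evo x y - 1) by ring.
  have hC := HC x y ltac:(olra) ltac:(olra) ltac:(olra); rewrite (ger0_norm dB) in hC.
  have h2 : `|- psi y * (evo x y - 1)| <= 2 * C * (`|f y - f x| + (B y - B x)).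
    rewrite normrM normrN -mulrA; apply: ler_pM => //; apply: inv2; olra.
  rewrite -(@real_normK _ (- psi y * _)) ?num_real//.
  apply: (@le_trans _ _ ((2 * C * (`|f y - f x| + (B y - B x))) ^+ 2)).
    by rewrite lerXn2r ?nnegrE// (le_trans _ h2).
  rewrite exprMn /L -mulrA -[leRHS]mulrA [leRHS]mulrCA ler_wpM2l ?sqr_ge0//.
  rewrite /quad_ctrl -(@real_normK _ (f y - f x)) ?num_real//.
  set u := `|f y - f x|; set v := B y - B x in dB dB1 *; set O := B b - B a in O0 dB1 *.
  have := sqr_ge0 (u - v); have vv : v ^+ 2 <= O * v by rewrite expr2 ler_wpM2r.
  have : 0 <= O * u ^+ 2 by rewrite mulr_ge0 ?sqr_ge0.
  have -> : (u + v) ^+ 2 = 2 * (u ^+ 2 + v ^+ 2) - (u - v) ^+ 2 by ring.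
  have -> : 2 * ((1 + O) * (u ^+ 2 + v)) = 2 * (u ^+ 2 + v + O * u ^+ 2 + O * v) by ring.
  olra.
have h2 : lsum (fun x y => (psi y - psi x) * defect x y) s t @ \oo --> (0 : R).
  apply/seq_cvgP => e e0.
  have V0 : 0 <= B t - B s by apply: (B_le lamP fB0); olra.
  (* The parameter of 2 u v <= c u^2 + v^2 / c, chosen such that the first sum
     is at most [e / 2]. *)
  pose c := e / (L * (2 * (B t - B s) + 1)).
  have w0 : 0 < 2 * (B t - B s) + 1 by apply: ltr_wpDl; rewrite ?mulr_ge0.
  have c0 : 0 < c by rewrite divr_gt0// mulr_gt0.
  have ec : 0 < c * e by exact: mulr_gt0.
  have /seq_cvgP/(_ _ ec) d2 := defect_sq_null as_ st tb.
  have q2 := quad_ctrlP fB0 as_ st tb ltr01.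
  near=> m; rewrite subr0.
  have d2m : `|lsum (fun x y => defect x y ^+ 2) s t m - 0| <= c * e by near: m.
  have q2m : lsum (quad_ctrl f B) s t m <= 2 * B t - 2 * B s + 1 by near: m.
  have pth := restr_path lamP m st.
  have lst : last s (partition_restr s t (lambda m)) = t by rewrite last_rcons.
  apply: (le_trans (ler_norm_psum _ _ _)).
  have : psum (fun x y => `|(psi y - psi x) * defect x y|) s
      (partition_restr s t (lambda m)) <=
      psum (fun x y => c / 2 * L * quad_ctrl f B x y + c^-1 / 2 * defect x y ^+ 2) s
      (partition_restr s t (lambda m)).
    apply: ler_psum => // x y sx xy; rewrite lst => yt.
    have h3 := dpsi x y sx xy yt; set u := psi y - psi x in h3 *.
    set v := defect x y.
    have : 0 <= (c * `|u| - `|v|) ^+ 2 by exact: sqr_ge0.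
    rewrite normrM -(@real_normK _ v) ?num_real//.
    rewrite -(@real_normK _ u) ?num_real// in h3.
    have := ler_wpM2l (ltW c0) h3; move: `|u| `|v| => U W hq hs.
    have -> : U * W = (c^-1 / 2) * (2 * (c * U) * W) by field; olra.
    have -> : c / 2 * L * quad_ctrl f B x y = (c^-1 / 2) * (c * (c * (L * quad_ctrl f B x y))).
      by field; olra.
    rewrite -mulrDr ler_wpM2l//; first by rewrite divr_ge0// invr_ge0 ltW.
    have := ler_wpM2l (ltW c0) hq; olra.
  move=> /le_trans; apply; rewrite psumD !psumZ.
  rewrite subr0 in d2m; have d3 := le_trans (ler_norm _) d2m.
  have e1 : c / 2 * L * lsum (quad_ctrl f B) s t m <= e / 2.
    have -> : e / 2 = c / 2 * L * (2 * (B t - B s) + 1).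
      by rewrite /c; field; rewrite !gt_eqF.
    apply: ler_wpM2l; first by rewrite mulr_ge0 ?(ltW L0)// divr_ge0// ltW.
    by rewrite mulrBr.
  have e2 : c^-1 / 2 * lsum (fun x y => defect x y ^+ 2) s t m <= e / 2.
    have -> : e / 2 = c^-1 / 2 * (c * e) by field; olra.
    by rewrite ler_wpM2l// divr_ge0// invr_ge0 ltW.
  by move: e1 e2; rewrite /lsum; olra.
have h3 := lsumD_cvg h1 h2; rewrite addr0 in h3.
have h4 : lsum (fun x y => psi y * F y - psi x * F x) s t @ \oo --> (0 : R).
  apply: (lsum_ext_cvg lamP st _ h3) => x y sx xy yt.
  rewrite -mulrDl (_ : psi x + (psi y - psi x) = psi y); last ring.
  by rewrite (psiM x y)// /defect; ring.
have h5 := @lsum_telescope_cvg _ lambda (fun x => psi x * F x) s t.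
have E := cvg_unique _ h5 h4; have {}E : psi t * F t - psi s * F s = 0 by exact: E.
have l1 := lo t ltac:(olra).
rewrite !psiE in E; [|olra|olra].
rewrite (evo_xx ab lamP fB0) in E; last olra.
have -> : F t = evo s t * ((evo s t)^-1 * F t) by field; olra.
move/eqP: E; rewrite subr_eq0 => /eqP ->; rewrite invr1; ring.
Unshelve. all: by end_near. Qed.

(** Near each point, [short_evolution] applies to intervals that avoid the
    point itself. A jump there, where the evolution factor may vanish, is
    crossed by a one-sided limit of the defect. *)
Lemma evolution s t : a <= s -> s < t -> t <= b -> F t = F s * evo s t.
Proof.
apply: (@cousin _ a b (fun s t => F t = F s * evo s t)).
  move=> u z v au uz zv vb -> ->; rewrite -mulrA; congr (_ * _); symmetry.
  by apply: (evo_mul ab lamP fB0 au (ltW uz) (ltW zv) vb).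
have [C C0 HC] := evo_sub1_bound ab lamP p12 fr0 D0; rewrite -/B in HC.
have d0 : 0 < (4 * C)^-1 by rewrite invr_gt0 mulr_gt0.
apply: locally_good_sub (locally_goodI (fr d0) (nd_flat Bn d0)) _.
move=> u v au uv vb [ffl Bfl].
have inner x y : u < x -> x < y -> y < v -> F y = F x * evo x y.
  move=> ux xy yv; apply: short_evolution; [olra|olra|olra|] => z xz.
  apply: (le_trans (HC x z _ _ _)); [olra|olra|olra|].
  have h1 := ffl z x ltac:(olra) ltac:(olra); have h2 := Bfl z x ltac:(olra) ltac:(olra).
  have -> : 2^-1 = C * ((4 * C)^-1 + (4 * C)^-1) by field; olra.
  by rewrite ler_wpM2l ?(ltW C0)// lerD.
have [v1 v2 _] := defect_vanish.
have right_end x : u < x -> x < v -> F v = F x * evo x v.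
  move=> ux xv; apply/eqP; rewrite -subr_eq0 -normr_le0.
  have hv := v1 v ltac:(olra).
  apply/ler_addgt0Pr => e e0; rewrite add0r.
  have /cvg_leftP/(_ _ e0)[d d'0 hd] := hv.
  have m1 : Num.max x (v - d) < v by rewrite gt_max; olra.
  pose y := (Num.max x (v - d) + v) / 2.
  have m2 : x <= Num.max x (v - d) by rewrite le_max lexx.
  have m3 : v - d <= Num.max x (v - d) by rewrite le_max lexx orbT.
  have := hd y ltac:(rewrite /y; olra).
  rewrite /defect (inner x y) //; [|rewrite /y; olra|rewrite /y; olra].
  rewrite subr0 -mulrA -(evo_mul ab lamP fB0); rewrite ?/y; try olra.
apply/eqP; rewrite -subr_eq0 -normr_le0.
have [E E0 hE] := evo_bounded ab lamP fB0.
apply/ler_addgt0Pr => e e0; rewrite add0r.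
have e1 : 0 < e / E by exact: divr_gt0.
have /cvg_rightP/(_ _ e1)[d d'0 hd] := v2 u ltac:(olra).
have m1 : u < Num.min v (u + d) by rewrite lt_min; olra.
have m2 : Num.min v (u + d) <= v by rewrite ge_min lexx.
have m3 : Num.min v (u + d) <= u + d by rewrite ge_min lexx orbT.
pose x := (Num.min v (u + d) + u) / 2.
have ux : u < x by rewrite /x; olra.
have xv : x < v by rewrite /x; olra.
have := hd x ltac:(rewrite /x; olra); rewrite subr0 => hx.
rewrite (right_end x ux xv).
rewrite (evo_mul ab lamP fB0 au (ltW ux) (ltW xv) vb).
rewrite (_ : _ - _ = defect u x * evo x v); last by rewrite /defect; ring.
have -> : e = e / E * E by field; olra.
rewrite normrM; apply: ler_pM => //; apply: hE; olra.
Qed.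

Theorem forward_unique : F a = 1 -> {in `[a, b], F =1 doleans a b lambda f}.
Proof.
move=> Fa x; rewrite in_itv /= => xab.
rewrite (doleans_evo ab lamP p12 fr0 D0)//.
have [ax xb] := andP xab; move: ax; rewrite le_eqVlt => /orP[/eqP <-|ax].
  by rewrite (evo_xx ab lamP fB0)// lexx ltW.
by rewrite (evolution (lexx a) ax xb) Fa mul1r.
Qed.

End Uniqueness.

Theorem theorem48 (R : realType) (a b : R) (lambda : nat -> seq R) (p : R)
    (f : R -> R) :
  a < b -> in_Lambda a b lambda -> 1 <= p < 2 ->
  decomposable a b lambda p f ->
  (exists g h, in_Dplus a b lambda p f g h) ->
  [/\ doleans_defined a b lambda f,
      in_dualW a b p (doleans a b lambda f)
        /\ in_Q a b lambda (doleans a b lambda f),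
      doleans a b lambda f a = 1,
      forward_solution a b lambda p f (doleans a b lambda f) &
      forall F : R -> R, in_dualW a b p F -> in_Q a b lambda F -> F a = 1 ->
        forward_solution a b lambda p f F ->
        {in `[a, b], F =1 doleans a b lambda f}].
Proof.
move=> ab lamP p12 [fr0 _] [g [h D0]].
have [P [EQ _]] := doleans_qvar ab lamP p12 fr0 D0.
split; first exact: (doleans_definedP ab lamP p12 fr0 D0).
- by split; [exact: (doleans_dual ab lamP p12 fr0 D0)|exists P].
- by rewrite /doleans eqxx.
- exact: (doleans_forward ab lamP p12 fr0 D0).
- move=> F _ _ Fa Fsol; exact: (forward_unique ab lamP p12 fr0 D0 Fsol Fa).
Qed.
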